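(* There exist an absolute constant $\alpha>0$ and a constant $\varepsilon>0$ such that the following holds. Let $G$ be an $(n,d,\lambda)$-graph with $200<d<n$ and $\lambda<\varepsilon d$. Then Router has a strategy to win the $r$-Routing game on $G$ for $r=\alpha n d\,\frac{\log(d/\lambda)}{\log n}$. Moreover, Router can respond to each request in $O(n^3d^3)$ time, and each path in $\mathcal P$ has length $O\!\left(\frac{\log n}{\log(d/\lambda)}\right)$.
   Context: An $(n,d,\lambda)$-graph is a $d$-regular graph on $n$ vertices whose adjacency matrix has second largest absolute eigenvalue at most $\lambda$. The $r$-Routing game on a $d$-regular graph $G$ is played by Adversary and Router. Router maintains a family $\mathcal P$ of pairwise edge-disjoint paths in $G$, initially empty. In each turn Adversary makes one of two requests, and each request must be fulfilled by Router before the next one is revealed: (1) Find-Path $a$ $b$: given vertices $a,b\in V(G)$ such that each of $a$ and $b$ is an endpoint of fewer than $d/200$ paths in $\mathcal P$, and such that $|\mathcal P|<r$, Router must find a path from $a$ to $b$ that is edge-disjoint from all paths in $\mathcal P$; this path is added to $\mathcal P$. If no such path is found, Router loses. (2) Remove-Path $P$: a given path $P\in\mathcal P$ is removed from $\mathcal P$. Router wins the $r$-Routing game if she can satisfy every (infinite) sequence of such requests. *)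

(* Defs.v *)
From HB Require Import structures.
From mathcomp Require Import all_boot all_order all_algebra.
From mathcomp Require Import all_classical all_reals all_analysis.

Set Implicit Arguments.
Unset Strict Implicit.
Unset Printing Implicit Defensive.

Import Order.TTheory GRing.Theory Num.Theory.

Local Open Scope ring_scope.

(** * (n,d,lambda)-graphs *)

Definition simple_graph (n : nat) (e : rel 'I_n) : Prop :=
  symmetric e /\ irreflexive e.

Definition regular_graph (n : nat) (e : rel 'I_n) (d : nat) : Prop :=
  forall u, #|[set v | e u v]| = d.

Definition adjmx (R : realType) (n : nat) (e : rel 'I_n) : 'M[R]_n :=
  \matrix_(i, j) (e i j)%:R.

(* [s] lists the eigenvalues of [A], with multiplicity, by decreasing absolute
   value. *)
Definition abs_spectrum (R : realType) (n : nat) (A : 'M[R]_n) (s : seq R)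
  : Prop :=
  char_poly A = \prod_(x <- s) ('X - x%:P) /\
  sorted (fun x y : R => `|y| <= `|x|) s.

Definition ndl_graph (R : realType) (n d : nat) (lam : R) (e : rel 'I_n)
  : Prop :=
  [/\ simple_graph e, regular_graph e d &
      exists2 s : seq R, abs_spectrum (adjmx R e) s & `|s`_1| <= lam].

(** * Paths, given by their sequences of vertices *)

Definition is_path (n : nat) (e : rel 'I_n) (a b : 'I_n) (p : seq 'I_n)
  : bool :=
  if p is x :: p' then
    [&& x == a, last x p' == b, path e x p' & uniq (x :: p')]
  else false.

Definition path_edges (n : nat) (p : seq 'I_n) : seq {set 'I_n} :=
  if p is x :: p' then pairmap (fun u v => [set u; v]) x p' else [::].

Definition path_length (n : nat) (p : seq 'I_n) : nat := size (path_edges p).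

Definition edge_disjoint (n : nat) (p p' : seq 'I_n) : bool :=
  ~~ has (mem (path_edges p)) (path_edges p').

Definition is_endpoint (n : nat) (v : 'I_n) (p : seq 'I_n) : bool :=
  if p is x :: p' then (v == x) || (v == last x p') else false.

(** * The routing game *)

Inductive request (n : nat) : Type :=
| FindPath of 'I_n & 'I_n
| RemovePath of seq 'I_n.

(* The family of paths is a list, used as a multiset: trivial one-vertex paths
   (requests with a = b) may be repeated. *)
Definition legal (R : realType) (n d : nat) (r : R) (P : seq (seq 'I_n))
    (q : request n) : Prop :=
  match q with
  | FindPath a b =>
      [/\ (count (is_endpoint a) P)%:R < d%:R / 200 :> R,
          (count (is_endpoint b) P)%:R < d%:R / 200 :> R &
          (size P)%:R < r]
  | RemovePath p => p \in P
  end.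

Definition fulfils (n : nat) (e : rel 'I_n) (P : seq (seq 'I_n))
    (q : request n) (p : seq 'I_n) : Prop :=
  match q with
  | FindPath a b => is_path e a b p /\ all (edge_disjoint p) P
  | RemovePath _ => True
  end.

(* Histories are listed most recent request first.  A strategy maps a history
   to the answer to its most recent request; the answer to a Remove-Path
   request is ignored. *)
Definition strategy (n : nat) : Type := seq (request n) -> seq 'I_n.

Fixpoint family_after (n : nat) (sigma : strategy n) (h : seq (request n))
  : seq (seq 'I_n) :=
  match h with
  | [::] => [::]
  | FindPath a b :: h' => sigma h :: family_after sigma h'
  | RemovePath p :: h' => rem p (family_after sigma h')
  end.

Definition history (n : nat) (q : nat -> request n) (i : nat)
  : seq (request n) := rev (mkseq q i).

(* Adversary obeys the rules in the first [i] turns. *)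
Definition legal_before (R : realType) (n d : nat) (r : R)
    (sigma : strategy n) (q : nat -> request n) (i : nat) : Prop :=
  forall j, (j < i)%N -> legal d r (family_after sigma (history q j)) (q j).

Definition wins (R : realType) (n d : nat) (e : rel 'I_n) (r : R)
    (sigma : strategy n) : Prop :=
  forall (q : nat -> request n) (i : nat),
    legal_before d r sigma q i.+1 ->
    fulfils e (family_after sigma (history q i)) (q i) (sigma (history q i.+1)).

Definition paths_bounded (R : realType) (n d : nat) (r ell : R)
    (sigma : strategy n) : Prop :=
  forall (q : nat -> request n) (i : nat),
    legal_before d r sigma q i ->
    forall p, p \in family_after sigma (history q i) -> (path_length p)%:R <= ell.

(** * Computation model: a structured word RAM

    Programs act on scalar variables and arrays of machine words, both named by
    numbers.  Arithmetic is modulo [W] (with truncated subtraction), and time is the number of evaluated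
    expression nodes plus the number of executed elementary commands and
    tests. *)

Inductive binop : Type := OpAdd | OpSub | OpMul | OpDiv | OpMod | OpEq | OpLt.

Inductive expr : Type :=
| Cst of nat
| Var of nat
| Get of nat & expr
| Bin of binop & expr & expr.

Inductive cmd : Type :=
| Skip
| Assign of nat & expr
| Put of nat & expr & expr
| Seq of cmd & cmd
| If of expr & cmd & cmd
| While of expr & cmd.

Record store : Type := Store { var : nat -> nat; arr : nat -> nat -> nat }.

Definition upd (A : Type) (f : nat -> A) (x : nat) (v : A) : nat -> A :=
  fun y => if y == x then v else f y.

Definition set_var (s : store) (x v : nat) : store :=
  Store (upd (var s) x v) (arr s).

Definition set_arr (s : store) (a i v : nat) : store :=
  Store (var s) (upd (arr s) a (upd (arr s a) i v)).

Definition eval_op (o : binop) (x y : nat) : nat :=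
  match o with
  | OpAdd => (x + y)%N
  | OpSub => (x - y)%N
  | OpMul => (x * y)%N
  | OpDiv => (x %/ y)%N
  | OpMod => (x %% y)%N
  | OpEq => nat_of_bool (x == y)
  | OpLt => nat_of_bool (x < y)%N
  end.

Fixpoint eval (W : nat) (s : store) (x : expr) : nat :=
  match x with
  | Cst c => (c %% W)%N
  | Var v => var s v
  | Get a i => arr s a (eval W s i)
  | Bin o x1 x2 => (eval_op o (eval W s x1) (eval W s x2) %% W)%N
  end.

Fixpoint cost (x : expr) : nat :=
  match x with
  | Cst _ | Var _ => 1
  | Get _ i => (cost i).+1
  | Bin _ x1 x2 => (cost x1 + cost x2).+1
  end.

(* [exec W c s t s']: started in [s], [c] halts in [s'] after time [t]. *)
Inductive exec (W : nat) : cmd -> store -> nat -> store -> Prop :=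
| exec_skip s : exec W Skip s 1 s
| exec_assign v x s :
    exec W (Assign v x) s (cost x).+1 (set_var s v (eval W s x))
| exec_put a i x s :
    exec W (Put a i x) s (cost i + cost x).+1
      (set_arr s a (eval W s i) (eval W s x))
| exec_seq c1 c2 s1 t1 s2 t2 s3 :
    exec W c1 s1 t1 s2 -> exec W c2 s2 t2 s3 ->
    exec W (Seq c1 c2) s1 (t1 + t2) s3
| exec_if x c1 c2 s t s' :
    exec W (if eval W s x != 0%N then c1 else c2) s t s' ->
    exec W (If x c1 c2) s (cost x + t).+1 s'
| exec_while_end x c s :
    eval W s x = 0%N -> exec W (While x c) s (cost x).+1 s
| exec_while_step x c s t1 s1 t2 s2 :
    eval W s x <> 0%N -> exec W c s t1 s1 -> exec W (While x c) s1 t2 s2 ->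
    exec W (While x c) s (cost x + t1 + t2).+1 s2.

(** * Router's program

    Variables 0, 1, 2 initially hold n, d and lambda rounded up to an integer,
    and array 0 holds the adjacency matrix in row-major order; everything else
    is 0.  A request is passed in variables 3 (0 for Find-Path, 1 for
    Remove-Path), 4, 5 (the vertices a, b) and 6 (number of vertices of the
    path to be removed), and in array 1 (the vertices of that path).  An
    answer is read off in the same way from variable 6 and array 1.  The store
    persists from one request to the next. *)

Definition init_store (R : realType) (n d : nat) (lam : R) (e : rel 'I_n)
  : store :=
  Store (fun x => nth 0%N [:: n; d; `|Num.ceil lam|%N] x)
        (fun a i => nat_of_bool ((a == 0%N) &&
           [exists u : 'I_n, [exists v : 'I_n,
              (i == u * n + v)%N && e u v]])).

Definition load_request (n : nat) (q : request n) (s : store) : store :=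
  match q with
  | FindPath a b => set_var (set_var (set_var s 3 0) 4 a) 5 b
  | RemovePath p =>
      let s1 := set_var (set_var s 3 1) 6 (size p) in
      Store (var s1)
        (upd (arr s1) 1 (fun i => nth (arr s1 1%N i) (map val p) i))
  end.

Definition output (s : store) : seq nat := mkseq (arr s 1) (var s 6).

(* Run on each request in turn, [prog] answers according to [sigma], within
   time [T] per request. *)
Definition implements (R : realType) (n d : nat) (lam : R) (e : rel 'I_n)
    (r : R) (W T : nat) (prog : cmd) (sigma : strategy n) : Prop :=
  forall q : nat -> request n,
  exists s : nat -> store,
    s 0%N = init_store d lam e /\
    forall i, legal_before d r sigma q i.+1 ->
      (exists2 t, (t <= T)%N &
         exec W prog (load_request (q i) (s i)) t (s i.+1)) /\
      (if q i is FindPath _ _ then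
         output (s i.+1) = map val (sigma (history q i.+1))
       else True).

(* Main.v *)
(** Every path is oriented from its two ends towards a middle vertex, which turns
    it into arcs.  Besides the used arcs Router keeps a plan: a set [Q] of saturated
    vertices, the set [B] of critical vertices, which have more than [d/50]
    neighbours in [Q], and for each critical vertex at least [d - 2(d/50)] reserved
    outgoing arcs, so that few used or reserved arcs have the same head.  A path may
    leave a critical vertex only along one of its reserved arcs, and any other
    vertex only towards a vertex outside [Q].  Then every vertex has at least
    [9/10 d] open arcs whatever Adversary did, and by expander mixing the searches
    from [a] and [b] along open arcs both reach more than half of the vertices
    within [O(log n / log (d/lambda))] steps.  A common vertex at minimal total
    distance yields the new path.

    Afterwards [B] and [Q] are recomputed from scratch, as a least fixpoint
    determined by the used arcs.  There are few of these, so by mixing both sets are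
    small.  Vertices that stay critical keep their reserved arcs, which nobody else
    could have taken; for the new critical vertices arcs are reserved by repeatedly
    treating those few of whose neighbours are crowded by untreated ones, and mixing
    shows that this never gets stuck.  Removing a path only relaxes the plan.

    All of this takes [O(n^3)] steps of the word RAM, and Router's strategy is read
    off the runs of the program. *)

Require Import Defs.
From HB Require Import structures.
From mathcomp Require Import all_boot all_order all_algebra.
From mathcomp Require Import all_classical all_reals all_analysis.
From mathcomp Require Import spectral complex ring lra zify.

Set Implicit Arguments.
Unset Strict Implicit.
Unset Printing Implicit Defensive.

Import Order.TTheory GRing.Theory Num.Theory.
Local Open Scope ring_scope.

(** * Expander mixing *)

Section Spectral.
Local Open Scope sesquilinear_scope.

(** Adversary limits how many paths end at a vertex; how many pass through it is Router's doing.
    Orienting each path towards its middle makes this controllable: at every vertex the used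
    out-degree is at most the used in-degree plus the number of paths ending there, so it suffices
    to bound arcs at their heads. But if saturated heads were simply forbidden, a vertex with mostly
    saturated neighbours could not be left at all. Such a vertex gets reserved arcs, paid for in
    advance at their heads, and these are the only arcs that may still enter a saturated vertex. The
    load counts every edge out of a critical vertex, reserved or not. Saturation and criticality
    therefore depend on the used arcs alone, and their sizes can be bounded without knowing how
    earlier reservations were made. The ratio 10^6 between [d] and [lam] leaves slack: each
    application of mixing compares degrees that differ by at least d/200 from the expected ones, so
    set sizes change by a factor of at least (10^6/200)^2, apart from the growth of the searches,
    where a factor d/lam per step is all that is wanted. *)

Definition sqnorm (R : pzRingType) n (v : 'rV[R]_n) : R := \sum_i v 0 i ^+ 2.

Lemma sqnorm_complex (R : rcfType) n (v : 'rV[R]_n) :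
  (sqnorm v)%:C%C = \sum_i `|(map_mx (real_complex R) v) 0 i| ^+ 2.
Proof.
rewrite rmorph_sum; apply: eq_bigr => i _; rewrite mxE sqr_normc conjc_real.
by rewrite -rmorphM.
Qed.

Lemma sum_norm_unitary (C : numClosedFieldType) n (P : 'M[C]_n) (v : 'rV[C]_n) :
  P \is unitarymx -> \sum_i `|(v *m P) 0 i| ^+ 2 = \sum_i `|v 0 i| ^+ 2.
Proof.
have E (w : 'rV[C]_n) : \sum_i `|w 0 i| ^+ 2 = (w *m w ^t*) 0 0.
  by rewrite mxE; apply: eq_bigr => i _; rewrite normCK !mxE.
move=> uP; rewrite !E; congr (_ 0 0).
by rewrite trmx_mul map_mxM mulmxA (mulmxtVK _ uP).
Qed.

(** All entries of [s] are smaller than [mu] in absolute value, so [mu] is a simple eigenvalue and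
    [w] spans its eigenspace. In a unitary eigenbasis [v], orthogonal to [w], has no component along
    [mu], and every other component is stretched by at most [lam]. *)
Lemma spectral_bound (R : rcfType) n (A : 'M[R]_n) (s : seq R) (mu lam : R)
    (w v : 'rV[R]_n) :
  A^T = A -> char_poly A = \prod_(x <- mu :: s) ('X - x%:P) ->
  {in s, forall x, `|x| <= lam} -> lam < `|mu| ->
  w != 0 -> w *m A = mu *: w -> v *m w^T = 0 ->
  sqnorm (v *m A) <= lam ^+ 2 * sqnorm v.
Proof.
move=> symA chA sle lt_mu w0 wA vw.
(* The spectral theorem is applied over the complex numbers, where the real symmetric [A] becomes a
   normal matrix. *)
set f := real_complex R; pose Ac := map_mx f A.
have nAc : Ac \is normalmx.
  have aC : Ac ^t* = Ac.
    apply/matrixP => i j; rewrite !mxE conj_Creal ?complex_real //.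
    by rewrite -[in LHS]symA mxE.
  by apply/normalmxP; rewrite aC.
move: (orthomx_spectralP nAc); set P := spectralmx Ac; set D := spectral_diag Ac.
have uP : P \is unitarymx by apply: spectral_unitarymx.
rewrite (invmx_unitary uP) => defA.
have uPt : P ^t* \is unitarymx by rewrite trmxC_unitary.
have PPt : P *m P ^t* = 1%:M by apply/unitarymxP.
(* Comparing characteristic polynomials identifies the diagonal [D] with [mu :: s] as a multiset;
   the simplicity of [mu] needs the multiplicities. *)
have cP : char_poly Ac = \prod_(x <- [seq D 0 i | i <- enum 'I_n]) ('X - x%:P).
  rewrite big_map big_enum /=.
  transitivity (char_poly (diag_mx D)); last first.
    rewrite char_poly_trig; first by apply: eq_bigr => i _; rewrite mxE eqxx.
    by apply/is_trig_mxP => i j ij; rewrite mxE; case: eqP ij => // ->; rewrite ltnn.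
  rewrite /char_poly /char_poly_mx defA.
  have -> : 'X%:M - map_mx polyC (P ^t* *m diag_mx D *m P) =
     map_mx polyC (P ^t*) *m ('X%:M - map_mx polyC (diag_mx D)) *m map_mx polyC P.
    rewrite mulmxBr mulmxBl -!map_mxM /=; congr (_ - _).
    rewrite scalar_mxC -mulmxA -map_mxM /=.
    by move: (mulmx1C PPt) => ->; rewrite map_mx1 mulmx1.
  rewrite !det_mulmx mulrC mulrA -det_mulmx -map_mxM PPt map_mx1 det1 mul1r.
  by [].
have pE : perm_eq [seq D 0 i | i <- enum 'I_n] [seq f x | x <- mu :: s].
  apply: prod_XsubC_eq; rewrite -cP -map_char_poly chA rmorph_prod big_map.
  by apply: eq_bigr => x _; rewrite rmorphB /= map_polyX map_polyC.
(* These are the coordinates of [v] and [w] in the eigenbasis; those of [w] vanish wherever the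
   eigenvalue is not [mu]. *)
pose u := map_mx f v *m P ^t*; pose z := map_mx f w *m P ^t*.
have zD i : z 0 i * (D 0 i - f mu) = 0.
  have : z *m diag_mx D = f mu *: z.
    have wAc : map_mx f w *m Ac = f mu *: map_mx f w.
      by rewrite -map_mxM wA map_mxZ.
    by rewrite /z scalemxAl -wAc defA -!mulmxA PPt mulmx1.
  move/matrixP/(_ 0 i); rewrite mul_mx_diag !mxE => e.
  by rewrite mulrBr e mulrC subrr.
have uz : u *m z ^t* = 0.
  rewrite /u /z trmx_mul map_mxM mulmxA trmxCK (mulmxKtV _ uP) //.
  have -> : (map_mx f w) ^t* = map_mx f (w^T).
    by apply/matrixP => i j; rewrite !mxE conj_Creal ?complex_real.
  by rewrite -map_mxM vw map_mx0.
have key i : u 0 i = 0 \/ `|D 0 i| <= f lam.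
  have : D 0 i \in [seq f x | x <- mu :: s].
    by rewrite -(perm_mem pE) map_f ?mem_enum.
  rewrite inE => /orP [/eqP Di|/mapP [x /sle xs ->]]; last first.
    right; rewrite normc_def /= expr0n addr0 sqrtr_sqr.
    by rewrite lecR.
  have c1 : #|[set j | D 0 j == f mu]| = 1%N.
    have /permP/(_ (pred1 (f mu))) := pE; rewrite [in RHS]/= eqxx.
    rewrite -[count _ (map f s)]size_filter.
    have -> : [seq x <- map f s | pred1 (f mu) x] = [::].
      apply/eqP; rewrite -(negbK (_ == _)) -has_filter; apply/hasPn => y /mapP [x xs ->].
      apply/negP => /eqP /complexI e; move: (sle _ xs); rewrite e => h.
      by move: (lt_le_trans lt_mu h); rewrite ltxx.
    rewrite count_map /= addn0 => e1; apply: etrans e1.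
    rewrite cardE -size_filter /enum_mem -filter_predI; congr size.
    by apply: eq_filter => j; rewrite !inE andbT.
  move/eqP/cards1P: c1 => [j Ej].
  have ij : i = j by move/setP/(_ i): Ej; rewrite !inE Di eqxx => /esym/eqP.
  left; have zj k : k != i -> z 0 k = 0.
    move=> ki; have := zD k => /eqP; rewrite mulf_eq0 => /orP [/eqP //|].
    rewrite subr_eq0 => h; move/setP/(_ k): Ej; rewrite !inE h => /esym/eqP e.
    by rewrite e ij eqxx in ki.
  have zi : z 0 i != 0.
    apply/eqP => zi0; case/eqP: w0.
    apply: (@map_mx_inj _ _ f) => //=; rewrite map_mx0.
    have -> : map_mx f w = z *m P by rewrite /z (mulmxKtV _ uP).
    suff -> : z = 0 by rewrite mul0mx.
    apply/rowP => k; rewrite [RHS]mxE.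
    by case: (eqVneq k i) => [->//|ki]; rewrite zj.
  move/matrixP/(_ 0 0): uz; rewrite [LHS]mxE [RHS]mxE.
  have zc k : (z ^t*) k 0 = (z 0 k)^* by rewrite !mxE.
  rewrite (bigD1 i) //= big1 => [|k ki]; last by rewrite zc (zj k ki) conjC0 mulr0.
  rewrite addr0 zc => /eqP; rewrite mulf_eq0 => /orP [/eqP //|].
  by rewrite conjC_eq0 (negbTE zi).
rewrite -lecR rmorphM /= !sqnorm_complex -/f map_mxM -/Ac defA mulmxA mulmxA.
rewrite (sum_norm_unitary _ uP) -(sum_norm_unitary (map_mx f v) uPt) -/u.
rewrite mulr_sumr; apply: ler_sum => i _; rewrite mul_mx_diag mxE.
rewrite normrM exprMn mulrC; case: (key i) => [->|le].
  by rewrite normr0 expr0n /= !mulr0.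
rewrite ler_wpM2r ?exprn_ge0 //.
rewrite (_ : f (lam ^+ 2) = f lam ^+ 2); last by rewrite /f rmorphXn.
by rewrite lerXn2r ?nnegrE // (le_trans _ le).
Qed.

End Spectral.

(** * Mixing and expansion in an (n, d, lambda)-graph *)

Definition nbhd n (e : rel 'I_n) (u : 'I_n) : {set 'I_n} := [set v | e u v].

Section Mixing.
Variables (R : realType) (n d : nat) (lam : R) (e : rel 'I_n).
Hypotheses (Ge : ndl_graph d lam e) (dn : (d < n)%N) (lam_lt_d : lam < d%:R).

Let A := adjmx R e.

Lemma ndl_card u : #|nbhd e u| = d.
Proof. by case: Ge => _ /(_ u). Qed.

Lemma ndl_sym : symmetric e.
Proof. by case: Ge => -[]. Qed.

Let n_gt0 : (0 < n)%N. Proof. exact: leq_trans dn. Qed.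

Let ones : 'rV[R]_n := const_mx 1.

Lemma ones_adjmx : ones *m A = d%:R *: ones.
Proof.
apply/rowP => j; rewrite !mxE mulr1 -(ndl_card j) -sum1_card natr_sum.
rewrite [RHS]big_mkcond; apply: eq_bigr => i _.
by rewrite !mxE mul1r inE ndl_sym; case: e.
Qed.

(** From the second entry on, the ordered spectrum is bounded by [lam < d]. The eigenvalue [d] of
    the all-ones vector must therefore be its head, and a vector of sum zero is orthogonal to that
    eigenvector. *)
Lemma ndl_opnorm (v : 'rV[R]_n) :
  \sum_i v 0 i = 0 -> sqnorm (v *m A) <= lam ^+ 2 * sqnorm v.
Proof.
move=> v0; case: (Ge) => _ _ [s [chA srt] le1].
have ones0 : ones != 0.
  by apply/eqP => /rowP/(_ (Ordinal n_gt0)); rewrite !mxE => /eqP; rewrite oner_eq0.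
have sz : size s = n.
  by move: (congr1 (fun p : {poly R} => size p) chA);
     rewrite size_char_poly size_prod_XsubC => -[].
case: s sz srt le1 chA => [|mu s] sz srt /= le1 chA.
  by have := n_gt0; rewrite -[X in (_ < X)%N]sz.
have sle : {in s, forall x, `|x| <= lam}.
  move=> x; case: s srt le1 {sz chA} => [//|y s] /= /andP [_ srt] le1.
  rewrite inE => /orP [/eqP -> //|xs]; apply: le_trans le1.
  have tr : transitive (fun x y : R => `|y| <= `|x|).
    by move=> a b c ab bc; apply: le_trans ab.
  by move: (order_path_min tr srt) => /allP/(_ _ xs).
have mud : mu = d%:R.
  have : root (char_poly A) d%:R.
    rewrite -eigenvalue_root_char; apply/eigenvalueP; exists ones => //.
    exact: ones_adjmx.
  rewrite chA root_prod_XsubC inE => /orP [/eqP -> //|/sle].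
  by rewrite normr_nat leNgt lam_lt_d.
apply: (@spectral_bound _ _ _ s mu lam ones) => //.
- by apply/matrixP => i j; rewrite !mxE ndl_sym.
- by rewrite mud normr_nat.
- by rewrite mud ones_adjmx.
- apply/matrixP => i j; rewrite !mxE !ord1 -[RHS]v0.
  by apply: eq_bigr => k _; rewrite !mxE mulr1.
Qed.

(* The indicator vector of [X], projected orthogonally to the constants. *)
Let ind (X : {set 'I_n}) : 'rV[R]_n := \row_i ((i \in X)%:R - #|X|%:R / n%:R).

Lemma sum_mem (X : {set 'I_n}) : \sum_i (i \in X)%:R = #|X|%:R :> R.
Proof.
rewrite -sum1_card natr_sum [RHS]big_mkcond; apply: eq_bigr => i _.
by case: (i \in X).
Qed.

Let nR : n%:R != 0 :> R. Proof. by rewrite pnatr_eq0 -lt0n. Qed.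

Lemma ind_sum X : \sum_i ind X 0 i = 0.
Proof.
under eq_bigr do rewrite mxE.
by rewrite sumrB sum_mem sumr_const card_ord -[_ *+ n]mulr_natr divfK // subrr.
Qed.

Lemma ind_sqnorm X : sqnorm (ind X) = #|X|%:R - #|X|%:R ^+ 2 / n%:R.
Proof.
rewrite /sqnorm.
transitivity (\sum_i ((i \in X)%:R * (1 - 2 * (#|X|%:R / n%:R)) + (#|X|%:R / n%:R) ^+ 2 : R)).
  by apply: eq_bigr => i _; rewrite mxE; case: (i \in X) => /=; ring.
rewrite big_split /= -mulr_suml sum_mem sumr_const card_ord -[_ *+ n]mulr_natr.
by field.
Qed.

Lemma ind_adjmx X y : (ind X *m A) 0 y = #|nbhd e y :&: X|%:R - d%:R * #|X|%:R / n%:R.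
Proof.
rewrite mxE.
transitivity (\sum_i ((i \in nbhd e y :&: X)%:R - (#|X|%:R / n%:R) * (i \in nbhd e y)%:R : R)).
  apply: eq_bigr => i _; rewrite !mxE !inE ndl_sym.
  by case: (e y i); case: (i \in X) => /=; ring.
by rewrite sumrB -mulr_sumr !sum_mem ndl_card; ring.
Qed.

Lemma sqr_sum_le (Y : {set 'I_n}) (a : 'I_n -> R) :
  (\sum_(y in Y) a y) ^+ 2 <= #|Y|%:R * \sum_(y in Y) a y ^+ 2.
Proof.
case: (eqVneq Y finset.set0) => [->|Y0]; first by rewrite big_set0 expr0n cards0 mul0r.
have cY : 0 < #|Y|%:R :> R by rewrite ltr0n card_gt0.
set S := \sum_(y in Y) a y; set S2 := \sum_(y in Y) a y ^+ 2.
have : 0 <= \sum_(y in Y) (a y - S / #|Y|%:R) ^+ 2 by apply: sumr_ge0 => i _; apply: sqr_ge0.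
suff -> : \sum_(y in Y) (a y - S / #|Y|%:R) ^+ 2 = S2 - S ^+ 2 / #|Y|%:R.
  by rewrite subr_ge0 ler_pdivrMr // mulrC.
transitivity (\sum_(y in Y) (a y ^+ 2 - 2 * (S / #|Y|%:R) * a y + (S / #|Y|%:R) ^+ 2)).
  by apply: eq_bigr => i _; ring.
rewrite big_split /= sumrB -mulr_sumr -/S -/S2 sumr_const -[_ *+ #|Y|]mulr_natr.
by field; rewrite gt_eqF.
Qed.

(** The discrepancy is a sum over [Y] of entries of [ind X *m A]. Cauchy-Schwarz bounds its square
    by the sum of their squares, which is extended from [Y] to all vertices to meet the norm
    bound. *)
Lemma expander_mixing (X Y : {set 'I_n}) :
  ((\sum_(y in Y) #|nbhd e y :&: X|)%:R - d%:R * #|X|%:R * #|Y|%:R / n%:R) ^+ 2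
    <= lam ^+ 2 * #|X|%:R * #|Y|%:R.
Proof.
have -> : (\sum_(y in Y) #|nbhd e y :&: X|)%:R - d%:R * #|X|%:R * #|Y|%:R / n%:R
          = \sum_(y in Y) (ind X *m A) 0 y.
  under [RHS]eq_bigr do rewrite ind_adjmx.
  by rewrite sumrB natr_sum sumr_const -[_ *+ #|Y|]mulr_natr; congr (_ - _); ring.
apply: le_trans (sqr_sum_le _ _) _.
rewrite mulrC ler_wpM2r ?ler0n //.
apply: (@le_trans _ _ (sqnorm (ind X *m A))).
  rewrite /sqnorm [leRHS](bigID (mem Y)) /= lerDl.
  by apply: sumr_ge0 => i _; apply: sqr_ge0.
apply: le_trans (ndl_opnorm (ind_sum X)) _.
rewrite ler_wpM2l ?sqr_ge0 // ind_sqnorm gerBl.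
by rewrite divr_ge0 ?sqr_ge0 ?ler0n.
Qed.

(** All later uses of mixing take this form. At least [c * d * #|X|] edges run from [X] to [Y] where
    at most [c' * d * #|X|] are expected, and the excess is at most [lam] times the root of
    [#|X| * #|Y|]. *)
Lemma expansion (c c' : R) (X Y : {set 'I_n}) :
  (forall x, x \in X -> c * d%:R <= #|nbhd e x :&: Y|%:R) ->
  #|Y|%:R <= c' * n%:R -> c' <= c ->
  ((c - c') * d%:R) ^+ 2 * #|X|%:R <= lam ^+ 2 * #|Y|%:R.
Proof.
move=> deg Yle cc; case: (eqVneq X finset.set0) => [->|X0].
  by rewrite cards0 mulr0 mulr_ge0 ?sqr_ge0 ?ler0n.
have cX : 0 < #|X|%:R :> R by rewrite ltr0n card_gt0.
have n0 : 0 < n%:R :> R by rewrite ltr0n.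
have := expander_mixing Y X; set E := (\sum_(y in X) _)%N => mix.
have Ele : c * d%:R * #|X|%:R <= E%:R.
  rewrite natr_sum mulr_natr -sumr_const; exact: ler_sum.
have low : (c - c') * d%:R * #|X|%:R <= E%:R - d%:R * #|Y|%:R * #|X|%:R / n%:R.
  have : d%:R * #|Y|%:R * #|X|%:R / n%:R <= c' * d%:R * #|X|%:R.
    rewrite ler_pdivrMr // -subr_ge0.
    have -> : c' * d%:R * #|X|%:R * n%:R - d%:R * #|Y|%:R * #|X|%:R =
       d%:R * #|X|%:R * (c' * n%:R - #|Y|%:R) by ring.
    by rewrite !mulr_ge0 ?ler0n // subr_ge0.
  by move: Ele; nra.
have h0 : 0 <= (c - c') * d%:R * #|X|%:R by rewrite !mulr_ge0 ?ler0n ?subr_ge0.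
rewrite -(ler_pM2r cX); apply: le_trans _ mix.
apply: (@le_trans _ _ (((c - c') * d%:R * #|X|%:R) ^+ 2)).
  by rewrite le_eqVlt; apply/orP; left; apply/eqP; ring.
by rewrite lerXn2r ?nnegrE // (le_trans h0).
Qed.

Lemma lam_ge0 : 0 <= lam.
Proof. by case: Ge => _ _ [s _]; apply: le_trans. Qed.

(** The projected indicator of one vertex shows that d (n - d) is at most lam^2 (n - 1), while d (n
    - d) is at least n - 1 for d between 1 and n - 1. Once [lam] is a small fraction of [d], this
    forces [d] to be large. *)
Lemma lam_ge1 : (0 < d)%N -> 1 <= lam.
Proof.
move=> d0; pose u := Ordinal n_gt0.
have := ndl_opnorm (ind_sum [set u]); rewrite ind_sqnorm cards1 /sqnorm => h.
have n0 : 0 < n%:R :> R by rewrite ltr0n.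
have d1 : 1 <= d%:R :> R by rewrite ler1n.
have dn1 : d%:R + 1 <= n%:R :> R by rewrite natr1 ler_nat.
have n1 : 1 < n%:R :> R by lra.
have E : \sum_i (ind [set u] *m A) 0 i ^+ 2 = d%:R - d%:R ^+ 2 / n%:R.
  transitivity (\sum_i ((i \in nbhd e u)%:R * (1 - 2 * (d%:R / n%:R)) + (d%:R / n%:R) ^+ 2 : R)).
    apply: eq_bigr => i _; rewrite ind_adjmx cards1.
    have -> : #|nbhd e i :&: [set u]| = (i \in nbhd e u).
      rewrite inE -(ndl_sym i u); case iu : (e i u).
        suff -> : nbhd e i :&: [set u] = [set u] by rewrite cards1.
        by apply/finset.setIidPr; rewrite finset.sub1set inE.
      suff -> : nbhd e i :&: [set u] = finset.set0 by rewrite cards0.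
      by apply/finset.setP => x; rewrite !inE; case: eqP => [->|_]; rewrite ?iu ?andbF.
    by case: (i \in _) => /=; ring.
  rewrite big_split /= -mulr_suml sum_mem ndl_card sumr_const card_ord -[_ *+ n]mulr_natr.
  by field.
rewrite E -(ler_pM2r n0) in h.
have h2 : d%:R * (n%:R - d%:R) <= lam ^+ 2 * (n%:R - 1).
  suff <- : (d%:R - d%:R ^+ 2 / n%:R) * n%:R = d%:R * (n%:R - d%:R) :> R.
    by apply: le_trans h _; rewrite le_eqVlt; apply/orP; left; apply/eqP; field.
  by field.
have l0 := lam_ge0.
rewrite -(@ler_pXn2r _ 2) ?nnegrE // expr1n.
rewrite -(@ler_pM2r _ (n%:R - 1)) ?subr_gt0 //; nra.
Qed.

End Mixing.

(** * Reasoning about the word RAM *)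

Section Ram.
Local Open Scope nat_scope.
Variable W : nat.

(** A total-correctness triple with a time budget. Since the postcondition is an arbitrary
    predicate, [runs_seq] can nest the triple of the second command in that of the first. *)
Definition runs (c : cmd) (t : nat) (s : store) (Q : store -> Prop) : Prop :=
  exists t' s', [/\ exec W c s t' s', t' <= t & Q s'].

Lemma runs_weaken c t1 t2 s (Q1 Q2 : store -> Prop) :
  runs c t1 s Q1 -> t1 <= t2 -> (forall s', Q1 s' -> Q2 s') -> runs c t2 s Q2.
Proof.
move=> [t [s' [ex le q]]] le2 h; exists t, s'; split=> //; [exact: leq_trans le2|exact: h].
Qed.

Lemma runs_skip s (Q : store -> Prop) : Q s -> runs Skip 1 s Q.
Proof. by move=> q; exists 1, s; split=> //; constructor. Qed.

Lemma runs_assign v x s (Q : store -> Prop) :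
  Q (set_var s v (Defs.eval W s x)) -> runs (Assign v x) (cost x).+1 s Q.
Proof. by move=> q; do 2 eexists; split; [constructor|exact: leqnn|]. Qed.

Lemma runs_put a i x s (Q : store -> Prop) :
  Q (set_arr s a (Defs.eval W s i) (Defs.eval W s x)) ->
  runs (Put a i x) (cost i + cost x).+1 s Q.
Proof. by move=> q; do 2 eexists; split; [constructor|exact: leqnn|]. Qed.

Lemma runs_seq c1 c2 t1 t2 s (Q : store -> Prop) :
  runs c1 t1 s (fun s' => runs c2 t2 s' Q) -> runs (Defs.Seq c1 c2) (t1 + t2) s Q.
Proof.
move=> [t1' [s1 [ex1 le1 [t2' [s2 [ex2 le2 q]]]]]].
by exists (t1' + t2'), s2; split=> //; [apply: exec_seq ex2|exact: leq_add].
Qed.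

Lemma runs_if x c1 c2 t s (Q : store -> Prop) :
  runs (if Defs.eval W s x != 0 then c1 else c2) t s Q ->
  runs (If x c1 c2) (cost x + t).+1 s Q.
Proof.
move=> [t' [s' [ex le q]]]; exists (cost x + t').+1, s'; split=> //.
  exact: exec_if.
by rewrite ltnS leq_add2l.
Qed.

Lemma runs_while x c tb (Inv : nat -> store -> Prop) j s :
  (forall s, Inv 0 s -> Defs.eval W s x = 0) ->
  (forall j s, Inv j.+1 s -> Defs.eval W s x <> 0 /\ runs c tb s (Inv j)) ->
  Inv j s -> runs (While x c) ((cost x).+1 + j * (cost x + tb).+1) s (Inv 0).
Proof.
move=> I0 IS; elim: j s => [|j IH] s Is.
  exists (cost x).+1, s; split=> //; last by rewrite leq_addr.
  by apply: exec_while_end; apply: I0.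
have [x0 [t1 [s1 [ex1 le1 /IH [t2 [s2 [ex2 le2 q]]]]]]] := IS _ _ Is.
exists (cost x + t1 + t2).+1, s2; split=> //; first exact: exec_while_step ex2.
by move: le1 le2; rewrite mulSn; lia.
Qed.

Fixpoint wvars (c : cmd) : seq nat :=
  match c with
  | Skip | Put _ _ _ => [::]
  | Assign v _ => [:: v]
  | Defs.Seq c1 c2 | If _ c1 c2 => wvars c1 ++ wvars c2
  | While _ c => wvars c
  end.

Fixpoint warrs (c : cmd) : seq nat :=
  match c with
  | Skip | Assign _ _ => [::]
  | Put a _ _ => [:: a]
  | Defs.Seq c1 c2 | If _ c1 c2 => warrs c1 ++ warrs c2
  | While _ c => warrs c
  end.

(** The frame condition, listing the scalars and arrays that may have changed; [exec_agree] reads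
    such lists off the program text. *)
Definition agree (vs als : seq nat) (s s' : store) : Prop :=
  (forall v, v \notin vs -> var s' v = var s v) /\
  (forall a, a \notin als -> arr s' a = arr s a).

Lemma agree_refl vs als s : agree vs als s s.
Proof. by []. Qed.

Lemma agree_trans vs als s1 s2 s3 :
  agree vs als s1 s2 -> agree vs als s2 s3 -> agree vs als s1 s3.
Proof.
move=> [v1 a1] [v2 a2]; split=> x xn; first by rewrite v2 ?v1.
by rewrite a2 ?a1.
Qed.

Lemma agree_sub vs als vs' als' s1 s2 : {subset vs <= vs'} -> {subset als <= als'} ->
  agree vs als s1 s2 -> agree vs' als' s1 s2.
Proof.
by move=> sv sa [v1 a1]; split=> x xn; [apply: v1|apply: a1];
   apply: contra xn; [apply: sv|apply: sa].
Qed.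

Lemma agree_set_var vs als s v x : v \in vs -> agree vs als s (set_var s v x).
Proof. by move=> vin; split=> //= y; rewrite /upd; case: eqP => // ->; rewrite vin. Qed.

Lemma agree_set_arr vs als s a i x : a \in als -> agree vs als s (set_arr s a i x).
Proof. by move=> ain; split=> //= y; rewrite /upd; case: eqP => // ->; rewrite ain. Qed.

Lemma agree_ext vs als vs' als' s0 s1 s2 :
  agree vs als s0 s1 -> agree vs' als' s1 s2 -> all (mem vs) vs' -> all (mem als) als' ->
  agree vs als s0 s2.
Proof.
move=> ag1 ag2 /allP hv /allP ha; apply: (agree_trans ag1); exact: agree_sub ag2.
Qed.

Lemma agree_setv vs als s s' v x :
  agree vs als s s' -> v \in vs -> agree vs als s (set_var s' v x).
Proof. by move=> ag vin; apply: (agree_trans ag); apply: agree_set_var. Qed.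

Lemma agree_seta vs als s s' a i x :
  agree vs als s s' -> a \in als -> agree vs als s (set_arr s' a i x).
Proof. by move=> ag ain; apply: (agree_trans ag); apply: agree_set_arr. Qed.

Lemma exec_agree c s t s' : exec W c s t s' -> agree (wvars c) (warrs c) s s'.
Proof.
elim=> {c s t s'} /=.
- by [].
- by move=> v x s; apply: agree_set_var; rewrite inE.
- by move=> a i x s; apply: agree_set_arr; rewrite inE.
- move=> c1 c2 s1 t1 s2 t2 s3 _ h1 _ h2; apply: agree_trans (agree_sub _ _ h1) (agree_sub _ _ h2);
  by move=> y yin; rewrite mem_cat yin ?orbT.
- move=> x c1 c2 s t s' _ h; apply: agree_sub h => y; case: ifP => _;
  by rewrite mem_cat => ->; rewrite ?orbT.
- by [].
- by move=> x c s t1 s1 t2 s2 _ _ h1 _ h2; apply: agree_trans h2.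
Qed.

Lemma runs_agree c t s Q :
  runs c t s Q -> runs c t s (fun s' => Q s' /\ agree (wvars c) (warrs c) s s').
Proof.
move=> [t' [s' [ex le q]]]; exists t', s'; split=> //; split=> //.
exact: exec_agree ex.
Qed.

Hypothesis W_gt : 200 < W.

Definition For (v N : nat) (c : cmd) : cmd :=
  Defs.Seq (Assign v (Cst 0))
    (While (Bin OpLt (Var v) (Var N))
       (Defs.Seq c (Assign v (Bin OpAdd (Var v) (Cst 1))))).

(** The invariant is demanded of the store in which the counter has already advanced. The 16 pays
    for test and increment and, because [0 < m], also for the initialisation and the last test. *)
Lemma runs_for v N c tb m (Inv : nat -> store -> Prop) s :
  0 < m < W -> v != N -> var s N = m -> N \notin wvars c -> v \notin wvars c ->
  Inv 0 (set_var s v 0) ->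
  (forall j s, j < m -> Inv j s -> var s v = j -> var s N = m ->
     runs c tb s (fun s' => Inv j.+1 (set_var s' v j.+1))) ->
  runs (For v N c) ((tb + 16) * m) s (fun s' => Inv m s' /\ var s' v = m).
Proof.
move=> /andP [m0 mW] vN sN Nc vc I0 IS.
have c0 : Defs.eval W s (Cst 0) = 0 by rewrite /= mod0n.
pose J k s := [/\ k <= m, Inv (m - k) s, var s v = m - k & var s N = m].
have W1 : 1 < W by lia.
apply: (@runs_weaken _ (2 + (4 + m * (3 + (tb + 4)).+1)) _ _ (J 0)); first last.
- by move=> s' [_]; rewrite subn0.
- by lia.
apply: runs_seq; apply: runs_assign; rewrite c0.
apply: (@runs_while _ _ _ J m).
- move=> s1 [_ _ /= -> ->]; rewrite subn0 ltnn; exact: mod0n.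
- move=> k s1 [km Ik sv sN1]; split.
    have -> : Defs.eval W s1 (Bin OpLt (Var v) (Var N)) = 1 %% W.
      by rewrite /= sv sN1; rewrite (_ : (m - k.+1 < m) = true) //; lia.
    by rewrite modn_small.
  have lt : m - k.+1 < m by lia.
  apply: runs_seq; apply: runs_weaken (runs_agree (IS _ _ lt Ik sv sN1)) (leqnn _) _.
  move=> s2 [Ik2 [av _]]; have e : Defs.eval W s2 (Bin OpAdd (Var v) (Cst 1)) = (m - k.+1).+1.
    rewrite /= av // sv (modn_small W1) addn1 modn_small //; lia.
  apply: runs_weaken (runs_assign (Q := J k) _) _ _ => //; rewrite e.
  split; first by lia.
  - by rewrite (_ : m - k = (m - k.+1).+1) //; lia.
  - by rewrite /= /upd eqxx; lia.
  - by rewrite /= /upd eq_sym (negbTE vN) av.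
split; rewrite ?subnn //= /upd ?eqxx // eq_sym (negbTE vN) //.
Qed.

(** Entries not reached yet keep their initial values, so an update in place may read the entry it
    is about to overwrite. *)
Lemma runs_vec v N c tb m a vs (f : nat -> nat) s :
  0 < m < W -> v != N -> var s N = m -> N \notin wvars c -> v \notin wvars c ->
  {subset wvars c <= vs} ->
  (forall j s', j < m -> agree (v :: vs) [:: a] s s' -> arr s' a j = arr s a j ->
     var s' v = j -> var s' N = m ->
     runs c tb s' (fun s'' => agree vs [:: a] s' s'' /\
        arr s'' a = upd (arr s' a) j (f j))) ->
  runs (For v N c) ((tb + 16) * m) s (fun s' =>
    agree (v :: vs) [:: a] s s' /\ forall j, j < m -> arr s' a j = f j).
Proof.
move=> mW vN sN Nc vc sub H.
pose Inv j s' := agree (v :: vs) [:: a] s s' /\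
  forall i, arr s' a i = if i < j then f i else arr s a i.
apply: (@runs_weaken _ ((tb + 16) * m) _ _ (fun s' => Inv m s' /\ var s' v = m)) => //.
  apply: runs_for => //.
    by split=> //; apply: agree_set_var; rewrite inE eqxx.
  move=> j s1 jm [ag Ij] sv sN1; apply: runs_weaken (H j s1 jm ag _ sv sN1) _ _ => //.
    by rewrite Ij ltnn.
  move=> s2 [ag2 ar]; split.
    apply: (@agree_trans _ _ _ s2); last by apply: agree_set_var; rewrite inE eqxx.
    apply: agree_trans ag (agree_sub _ _ ag2) => // y yin.
    by rewrite inE yin orbT.
  move=> i; rewrite /= ar /upd ltnS Ij.
  by case: eqP => [->|/eqP ij]; rewrite ?leqnn // [i <= j]leq_eqVlt (negbTE ij).
by move=> s' [[ag Im] _]; split=> // j jm; rewrite Im jm.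
Qed.

Definition Sum (acc v N : nat) (x : expr) : cmd :=
  Defs.Seq (Assign acc (Cst 0)) (For v N (Assign acc (Bin OpAdd (Var acc) x))).

Lemma runs_sum acc v N x m s (f : nat -> nat) :
  0 < m < W -> v != N -> acc != N -> acc != v -> var s N = m ->
  \sum_(j < m) f j < W ->
  (forall j s', j < m -> agree [:: v; acc] [::] s s' -> var s' v = j ->
     var s' N = m -> Defs.eval W s' x = f j) ->
  runs (Sum acc v N x) ((cost x + 21) * m) s (fun s' =>
    agree [:: v; acc] [::] s s' /\ var s' acc = \sum_(j < m) f j).
Proof.
move=> mW vN aN av sN lt H.
pose Inv j s' := agree [:: v; acc] [::] s s' /\ var s' acc = \sum_(i < j) f i.
apply: (@runs_weaken _ (2 + ((cost x + 3) + 16) * m) _ _ (fun s' => Inv m s' /\ var s' v = m))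
    => //.
- apply: runs_seq; apply: runs_assign; rewrite /= mod0n.
  apply: runs_for => //=.
  + by rewrite /upd eq_sym (negbTE aN).
  + by rewrite inE eq_sym.
  + by rewrite inE eq_sym.
  + split; last by rewrite /= /upd (negbTE av) eqxx big_ord0.
    apply: (@agree_trans _ _ _ (set_var s acc 0)); apply: agree_set_var; by rewrite !inE eqxx ?orbT.
  move=> j s1 jm [ag Ij] sv sN1.
  apply: runs_weaken (runs_assign (Q := fun s' => Inv j.+1 (set_var s' v j.+1)) _) _ _ => //=;
      last first.
    by rewrite addn3.
  rewrite (H j) // Ij /= modn_small; last first.
    apply: leq_ltn_trans lt; rewrite [X in _ <= X](bigID (fun i : 'I_m => i < j.+1)) /=.
    apply: leq_trans (leq_addr _ _).
    by rewrite -(big_ord_widen _ f jm) big_ord_recr.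
  split; last by rewrite /= /upd eqxx (negbTE av) big_ord_recr.
  apply: (agree_trans ag); apply: (@agree_trans _ _ _ (set_var s1 acc (\sum_(i < j) f i + f j)));
    apply: agree_set_var; by rewrite !inE eqxx ?orbT.
- by lia.
- by move=> s' [].
Qed.

Lemma modW x : x <= 200 -> x %% W = x.
Proof. by move=> h; rewrite modn_small //; lia. Qed.

(** Truth values are the words 0 and 1. [Or] tests positivity because the sum may be 2. *)
Definition And x y := Bin OpMul x y.
Definition Or x y := Bin OpLt (Cst 0) (Bin OpAdd x y).
Definition Not x := Bin OpEq x (Cst 0).

Lemma eval_and s x y (b c : bool) :
  Defs.eval W s x = b -> Defs.eval W s y = c -> Defs.eval W s (And x y) = b && c.
Proof. by move=> /= -> ->; rewrite mulnb modW //; case: (_ && _). Qed.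

Lemma eval_or s x y (b c : bool) :
  Defs.eval W s x = b -> Defs.eval W s y = c -> Defs.eval W s (Or x y) = b || c.
Proof. by move=> /= -> ->; case: b c => [] []; rewrite !modW. Qed.

Lemma eval_not s x (b : bool) : Defs.eval W s x = b -> Defs.eval W s (Not x) = ~~ b.
Proof. by move=> /= ->; rewrite !modW //; case: b. Qed.

Lemma eval_lt s x y i j :
  Defs.eval W s x = i -> Defs.eval W s y = j -> Defs.eval W s (Bin OpLt x y) = (i < j).
Proof. by move=> /= -> ->; rewrite modW //; case: (_ < _). Qed.

Lemma eval_eq s x y i j :
  Defs.eval W s x = i -> Defs.eval W s y = j -> Defs.eval W s (Bin OpEq x y) = (i == j).
Proof. by move=> /= -> ->; rewrite modW //; case: (_ == _). Qed.

Lemma eval_add s x y i j :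
  Defs.eval W s x = i -> Defs.eval W s y = j -> i + j < W -> Defs.eval W s (Bin OpAdd x y) = i + j.
Proof. by move=> /= -> -> h; rewrite modn_small. Qed.

Lemma eval_sub s x y i j :
  Defs.eval W s x = i -> Defs.eval W s y = j -> i < W -> Defs.eval W s (Bin OpSub x y) = i - j.
Proof. by move=> /= -> -> h; rewrite modn_small // (leq_ltn_trans (leq_subr _ _)). Qed.

Lemma eval_mul s x y i j :
  Defs.eval W s x = i -> Defs.eval W s y = j -> i * j < W -> Defs.eval W s (Bin OpMul x y) = i * j.
Proof. by move=> /= -> -> h; rewrite modn_small. Qed.

Lemma eval_div s x y i j :
  Defs.eval W s x = i -> Defs.eval W s y = j -> i < W -> Defs.eval W s (Bin OpDiv x y) = i %/ j.
Proof. by move=> /= -> -> h; rewrite modn_small // (leq_ltn_trans (leq_div _ _)). Qed.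

Lemma eval_mod s x y i j :
  Defs.eval W s x = i -> Defs.eval W s y = j -> i < W -> Defs.eval W s (Bin OpMod x y) = i %% j.
Proof. by move=> /= -> -> h; rewrite modn_small // (leq_ltn_trans (leq_mod _ _)). Qed.

Lemma eval_cst s c : c <= 200 -> Defs.eval W s (Cst c) = c.
Proof. exact: modW. Qed.

Lemma eval_get s a x i k : Defs.eval W s x = i -> arr s a i = k -> Defs.eval W s (Get a x) = k.
Proof. by move=> /= -> ->. Qed.

End Ram.

(** * Plans *)

(* These thresholds leave [9/10 d] open arcs at every vertex. *)
Definition thr (d : nat) : nat := (d %/ 100)%N.
Definition slk (d : nat) : nat := (d %/ 50)%N.

Section Plan.
Local Open Scope nat_scope.
Variables (n d : nat) (e : rel 'I_n).

(** Counting all edges out of [B] gives an upper bound on used plus reserved arcs that does not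
    depend on which arcs are reserved. *)
Definition load (U : rel 'I_n) (B : {set 'I_n}) (y : 'I_n) : nat :=
  #|[set x | U x y || (e x y && (x \in B))]|.

(* Used arcs [U] and reserved arcs [rho] are counted together at their heads, so
   using a reserved arc never overloads a vertex. *)
Definition valid_plan (U : rel 'I_n) (B Q : {set 'I_n}) (rho : rel 'I_n) : Prop :=
  [/\ forall y, #|[set x | U x y || ((x \in B) && rho x y)]| <= (2 * thr d).+1,
      forall x, x \in B ->
        d - 2 * slk d <= #|[set y | rho x y]| /\ (forall y, rho x y -> e x y),
      forall x, x \notin B -> #|nbhd e x :&: Q| <= slk d &
      forall y, y \notin Q -> load U B y < thr d].

Definition saturated (U : rel 'I_n) (B : {set 'I_n}) : {set 'I_n} :=
  [set y | thr d <= load U B y].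

Definition crit_step (U : rel 'I_n) (B : {set 'I_n}) : {set 'I_n} :=
  [set x | slk d < #|nbhd e x :&: saturated U B|].

(** The rounds increase, so [n] of them reach the least fixpoint. Being least matters: its size is
    bounded by following the rounds up from the empty set. *)
Definition critical (U : rel 'I_n) : {set 'I_n} :=
  iter n (crit_step U) finset.set0.

Definition open_arc (U : rel 'I_n) (B Q : {set 'I_n}) (rho : rel 'I_n) : rel 'I_n :=
  fun x y => [&& e x y, ~~ U x y, ~~ U y x & if x \in B then rho x y else y \notin Q].

Lemma crit_step_homo U : {homo crit_step U : X Y / X \subset Y}.
Proof.
move=> X Y sXY; apply/fintype.subsetP => x; rewrite !inE => h; apply: leq_trans h _.
apply/subset_leq_card/finset.setIS/fintype.subsetP => y; rewrite !inE => h.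
apply: leq_trans h _; apply/subset_leq_card/fintype.subsetP => z; rewrite !inE.
by move=> /orP [-> //|/andP [-> /(fintype.subsetP sXY) ->]]; rewrite orbT.
Qed.

Lemma criticalK U : crit_step U (critical U) = critical U.
Proof.
have := fixsetK (@crit_step_homo U); rewrite /fixset card_ord; exact.
Qed.

Lemma valid_plan_sub (U U' : rel 'I_n) B Q rho :
  (forall x y, U' x y -> U x y) -> valid_plan U B Q rho -> valid_plan U' B Q rho.
Proof.
move=> sU [v1 v2 v3 v4]; split=> //.
  move=> y; apply: leq_trans (v1 y); apply/subset_leq_card/fintype.subsetP => x.
  by rewrite !inE => /orP [/sU ->//|->]; rewrite orbT.
move=> y /v4; apply: leq_ltn_trans; apply/subset_leq_card/fintype.subsetP => x.
by rewrite !inE => /orP [/sU ->//|->]; rewrite orbT.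
Qed.

(* The arcs of the new critical vertices are reserved in rounds; [X] is the set of
   those not treated yet. *)
Definition roomy (Q X : {set 'I_n}) : {set 'I_n} :=
  [set y | (#|nbhd e y :&: X| <= thr d) && (y \notin Q)].

Definition peelable (Q X : {set 'I_n}) : {set 'I_n} :=
  [set x in X | d - 2 * slk d <= #|nbhd e x :&: roomy Q X|].

Definition peel_res (Q X : {set 'I_n}) (rho : rel 'I_n) : rel 'I_n :=
  fun x y => if x \in peelable Q X then e x y && (y \in roomy Q X) else rho x y.

(* The last clause: a vertex gets reserved arcs only once it is roomy, and from then
   on its untreated neighbours pay for them. *)
Definition peel_inv (Q X0 : {set 'I_n}) (rho0 : rel 'I_n) (X : {set 'I_n})
    (rho : rel 'I_n) : Prop :=
  [/\ X \subset X0,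
      forall x, x \notin X0 -> rho x =1 rho0 x,
      forall x, x \in X0 :\: X ->
        d - 2 * slk d <= #|[set y | rho x y]| /\
        (forall y, rho x y -> e x y && (y \notin Q)) &
      forall y, let k := #|[set x in X0 :\: X | rho x y]| in
        k = 0 \/ k + #|nbhd e y :&: X| <= thr d].

Hypothesis sym_e : symmetric e.

(** At a roomy [y], each new reserved arc comes from a neighbour that leaves [X] in the same round,
    so the sum in the last clause does not grow; if nothing was reserved into [y] before, roominess
    itself gives the bound. At any other [y] nothing new is reserved. *)
Lemma peel_inv_step Q X0 rho0 X rho :
  peel_inv Q X0 rho0 X rho ->
  peel_inv Q X0 rho0 (X :\: peelable Q X) (peel_res Q X rho).
Proof.
(* [S] and [r] are introduced as opaque names, so that [inE] does not unfold membership in [S]. *)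
move=> [sX p1 p2 p3]; have [S SE] : exists S, S = peelable Q X by eexists.
have [r rE] : exists r : rel 'I_n, r = peel_res Q X rho by eexists.
have re x y : r x y = if x \in S then e x y && (y \in roomy Q X) else rho x y.
  by rewrite rE /peel_res SE.
rewrite -SE -rE.
have SX : S \subset X by apply/fintype.subsetP => x; rewrite SE inE => /andP [].
split.
- by apply: fintype.subset_trans sX; apply: finset.subsetDl.
- move=> x xn y; rewrite re ifN ?p1 //.
  by apply: contra xn => /(fintype.subsetP SX) /(fintype.subsetP sX).
- move=> x; rewrite !inE negb_and negbK => /andP [xS x0].
  case xinS: (x \in S).
    split; last by move=> y; rewrite re xinS inE => /andP [-> /andP [_ ->]].
    move: (xinS); rewrite SE inE => /andP [_ h]; apply: leq_trans h _.
    apply/subset_leq_card/fintype.subsetP => y; rewrite !inE re xinS.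
    by rewrite inE.
  move: xS; rewrite xinS /= => xX.
  have [h1 h2] : d - 2 * slk d <= #|[set y | rho x y]| /\
        (forall y, rho x y -> e x y && (y \notin Q)) by apply: p2; rewrite !inE xX.
  split; last by move=> y; rewrite re xinS; apply: h2.
  apply: leq_trans h1 _; apply/subset_leq_card/fintype.subsetP => y.
  by rewrite !inE re xinS.
move=> y; cbv zeta.
set K' := [set x in X0 :\: (X :\: S) | r x y].
set K := [set x in X0 :\: X | rho x y].
have p3y : #|K| = 0 \/ #|K| + #|nbhd e y :&: X| <= thr d by exact: p3.
have NX : #|nbhd e y :&: (X :\: S)| + #|nbhd e y :&: S| = #|nbhd e y :&: X|.
  rewrite addnC -(cardsID S (nbhd e y :&: X)); congr (_ + _).
    by rewrite -finset.setIA (finset.setIidPr SX).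
  by apply: eq_card => z; rewrite !inE; case: (z \in S); rewrite /= ?andbF ?andbT.
have [yr|yr] := boolP (y \in roomy Q X).
  have K'E : #|K'| <= #|K| + #|nbhd e y :&: S|.
    apply: leq_trans (subset_leq_card _) (finset.leq_card_setU _ _).
    apply/fintype.subsetP => x; rewrite !inE re.
    case xS: (x \in S).
      by rewrite sym_e => /andP [_ /andP [-> _]]; rewrite orbT.
    by rewrite /= andbF orbF => ->.
  move: (yr); rewrite inE => /andP [yT _].
  by right; case: p3y => h; move: K'E; lia.
have K'E : #|K'| <= #|K|.
  apply/subset_leq_card/fintype.subsetP => x; rewrite !inE re.
  case xS: (x \in S); first by rewrite (negbTE yr) !andbF.
  by rewrite /=.
by case: p3y => h; [left|right]; move: K'E; lia.
Qed.

(** A head in the old [Q] gains nothing: new used arcs enter it only along arcs that were reserved,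
    hence already counted, and new reservations avoid [Q]. A head outside [Q] had load at most
    [thr d - 1] and gains at most 2 used arcs and [thr d] reserved ones, which is where the bound
    [(2 * thr d).+1] comes from. The clause on non-critical vertices is the fixpoint equation. *)
Lemma valid_plan_update U A B Q rho rho' :
  (forall x, #|nbhd e x| = d) ->
  let U' := fun x y => U x y || A x y in
  let B' := critical U' in
  valid_plan U B Q rho ->
  (forall x y, A x y -> open_arc U B Q rho x y) ->
  (forall y, #|[set x | A x y]| <= 2) ->
  peel_inv Q (B' :\: B) rho finset.set0 rho' ->
  valid_plan U' B' (saturated U' B') rho'.
Proof.
move=> deg U' B' [v1 v2 v3 v4] AH A2 [_ p1 p2 p3].
have rhoE x y : x \in B' -> x \in B -> rho' x y = rho x y.
  by move=> xB' xB; apply: p1; rewrite !inE xB.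
split.
- move=> y.
  pose V := [set x | U x y || ((x \in B) && rho x y)].
  pose N := [set x in B' :\: B | rho' x y].
  have [yQ|yQ] := boolP (y \in Q).
    apply: leq_trans (v1 y); apply/subset_leq_card/fintype.subsetP => x.
    rewrite !inE => /orP [/orP [->//|/AH /and4P [_ _ _]]|/andP [xB' rx]].
      by case: ifP => [xB ->|_]; rewrite ?orbT // yQ.
    have [xB|xB] := boolP (x \in B); first by move: rx; rewrite rhoE // => ->; rewrite orbT.
    case: (p2 x) => [|_ /(_ y rx)]; first by rewrite !inE xB xB'.
    by rewrite yQ andbF.
  have h : #|[set x | U' x y || ((x \in B') && rho' x y)]| <= #|V| + 2 + #|N|.
    apply: (@leq_trans #|(V :|: [set x | A x y]) :|: N|).
      apply/subset_leq_card/fintype.subsetP => x; rewrite !inE => /orP [/orP [->//|->]|/andP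
          [xB' rx]].
        by rewrite orbT.
      have [xB|xB] := boolP (x \in B); last by rewrite xB' rx !orbT.
      by move: rx; rewrite rhoE // => ->; rewrite !orbT.
    apply: leq_trans (finset.leq_card_setU _ _) _; rewrite leq_add2r.
    by apply: leq_trans (finset.leq_card_setU _ _) _; rewrite leq_add2l.
  have hV : #|V| < thr d.
    apply: leq_ltn_trans (v4 y yQ); apply/subset_leq_card/fintype.subsetP => x.
    rewrite !inE => /orP [->//|/andP [xB rx]].
    by case: (v2 x xB) => _ /(_ y rx) ->; rewrite xB orbT.
  have hN : #|N| <= thr d.
    have := p3 y; cbv zeta; rewrite finset.setD0 -/N finset.setI0 cards0 addn0.
    by case=> [->|].
  lia.
- move=> x xB'; have [xB|xB] := boolP (x \in B).
    case: (v2 x xB) => h1 h2; split; last by move=> y; rewrite rhoE //; apply: h2.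
    apply: leq_trans h1 _; apply/subset_leq_card/fintype.subsetP => y.
    by rewrite !inE rhoE.
  case: (p2 x) => [|h1 h2]; first by rewrite !inE xB xB'.
  by split=> // y /h2 /andP [].
- by move=> x; rewrite /B' -{1}criticalK inE -leqNgt.
- by move=> y; rewrite inE -ltnNge.
Qed.

Lemma open_arc_card U B Q rho x k :
  (forall x, #|nbhd e x| = d) -> valid_plan U B Q rho ->
  #|[set y | U x y]| + #|[set y | U y x]| <= k ->
  d <= #|[set y | open_arc U B Q rho x y]| + 2 * slk d + k.
Proof.
move=> deg [v1 v2 v3 v4] hk.
pose base := [set y | e x y && (if x \in B then rho x y else y \notin Q)].
have hb : d - 2 * slk d <= #|base|.
  rewrite /base; have [xB|xB] := boolP (x \in B).
    case: (v2 x xB) => h1 h2; apply: leq_trans h1 _.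
    apply/subset_leq_card/fintype.subsetP => y.
    by rewrite !inE => rx; rewrite rx h2.
  have := cardsID Q (nbhd e x); rewrite deg => h; have := v3 x xB.
  have E : #|nbhd e x :\: Q| = #|[set y | e x y && (y \notin Q)]|.
    by apply: eq_card => y; rewrite !inE andbC.
  by move: h; rewrite E; lia.
have : #|base| <= #|[set y | open_arc U B Q rho x y]| + (#|[set y | U x y]| + #|[set y | U y x]|).
  apply: (@leq_trans #|[set y | open_arc U B Q rho x y] :|: ([set y | U x y] :|: [set y | U y x])|).
    apply/subset_leq_card/fintype.subsetP => y; rewrite !inE /open_arc.
    by move=> /andP [-> ->]; case: (U x y); case: (U y x).
  apply: leq_trans (finset.leq_card_setU _ _) _; rewrite leq_add2l; exact: finset.leq_card_setU.
lia.
Qed.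

End Plan.

(** * Sizes of the sets in a plan, and growth of the searches *)

Section Expander.
Variables (R : realType) (n d : nat) (lam : R) (e : rel 'I_n).
Hypotheses (Ge : ndl_graph d lam e) (dn : (200 < d < n)%N).
Hypothesis lam_lt : lam * (1000 * 1000) < d%:R.

Let d_gt0 : (0 < d)%N. Proof. by case/andP: dn => + _; apply: leq_trans. Qed.
Let D_gt0 : 0 < d%:R :> R. Proof. by rewrite ltr0n. Qed.
Let d_lt_n : (d < n)%N. Proof. by case/andP: dn. Qed.
Let n_gt0 : (0 < n)%N. Proof. exact: leq_trans d_lt_n. Qed.
Let N_gt0 : 0 < n%:R :> R. Proof. by rewrite ltr0n. Qed.

Let lam_lt_d : lam < d%:R.
Proof. have [l0 lt] := (lam_ge0 Ge, lam_lt); lra. Qed.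

Lemma expansion_scaled (K c c' : R) (X Y : {set 'I_n}) :
  0 <= K -> lam * K <= d%:R ->
  (forall x, x \in X -> c * d%:R <= #|nbhd e x :&: Y|%:R) ->
  #|Y|%:R <= c' * n%:R -> c' <= c ->
  (c - c') ^+ 2 * K ^+ 2 * #|X|%:R <= #|Y|%:R.
Proof.
move=> K0 lK h1 h2 h3; have := expansion Ge d_lt_n lam_lt_d h1 h2 h3 => h.
have l2 : lam ^+ 2 * K ^+ 2 <= d%:R ^+ 2.
  rewrite -exprMn lerXn2r ?nnegrE ?(ltW D_gt0) //.
  by rewrite mulr_ge0 ?(lam_ge0 Ge).
have {}h : ((c - c') * d%:R) ^+ 2 * #|X|%:R * K ^+ 2 <= d%:R ^+ 2 * #|Y|%:R.
  apply: (@le_trans _ _ (lam ^+ 2 * #|Y|%:R * K ^+ 2)).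
    by rewrite ler_wpM2r // exprn_ge0.
  by rewrite mulrAC ler_wpM2r.
rewrite -(ler_pM2l (_ : 0 < d%:R ^+ 2)) ?exprn_gt0 //; apply: le_trans h.
by rewrite le_eqVlt; apply/orP; left; apply/eqP; ring.
Qed.

Lemma expansion_eps (c c' : R) (X Y : {set 'I_n}) :
  (forall x, x \in X -> c * d%:R <= #|nbhd e x :&: Y|%:R) ->
  #|Y|%:R <= c' * n%:R -> c' <= c ->
  (c - c') ^+ 2 * (1000 * 1000) ^+ 2 * #|X|%:R <= #|Y|%:R.
Proof.
have K0 : 0 <= 1000 * 1000 :> R by apply: mulr_ge0; apply: ler0n.
have lK := ltW lam_lt; move: (1000 * 1000 : R) K0 lK => K K0 lK.
exact: expansion_scaled.
Qed.

Lemma d_large : 1000 * 1000 < d%:R :> R.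
Proof. have [l1 lt] := (lam_ge1 Ge d_lt_n lam_lt_d d_gt0, lam_lt); lra. Qed.

Lemma thr_bounds : d%:R / 200 <= (thr d)%:R :> R /\ d%:R / 100 < (thr d).+1%:R :> R.
Proof.
have dl := d_large; have h1 : (d < 100 * (thr d).+1)%N by rewrite mulnC ltn_ceil.
move: h1; rewrite -(ltr_nat R) natrM; move: (@natr1 R (thr d)) => <- h1; split; lra.
Qed.

Lemma slk_bounds : d%:R / 50 < (slk d).+1%:R :> R /\ (slk d)%:R <= d%:R / 50 :> R.
Proof.
have h1 : (d < 50 * (slk d).+1)%N by rewrite mulnC ltn_ceil.
have h2 : (50 * slk d <= d)%N by rewrite mulnC leq_trunc_div.
move: h1 h2; rewrite -(ltr_nat R) -(ler_nat R) !natrM.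
by move: (@natr1 R (slk d)) => <- h1 h2; split; lra.
Qed.

Lemma sum_nbhd_cap (B : {set 'I_n}) : (\sum_y #|nbhd e y :&: B| = d * #|B|)%N.
Proof.
transitivity (\sum_y \sum_(x in B) e y x)%N.
  apply: eq_bigr => y _; rewrite -sum1_card [RHS]big_mkcond [LHS]big_mkcond /=.
  by apply: eq_bigr => x _; rewrite !inE; case: (e y x); case: (x \in B).
rewrite exchange_big /= mulnC -sum_nat_const; apply: eq_bigr => x xB.
rewrite -(ndl_card Ge x) -sum1_card [RHS]big_mkcond /=.
by apply: eq_bigr => y _; rewrite inE (ndl_sym Ge).
Qed.

(** Each saturated vertex carries load at least d/200, and the total load is at most the number of
    used arcs plus d times the size of [B]. Dividing, [Q] has at most n/200 vertices plus a
    negligible term. *)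
Lemma saturated_small (U : rel 'I_n) (B : {set 'I_n}) :
  (\sum_y #|[set x | U x y]|)%:R <= n%:R * d%:R / (200 * 200) :> R ->
  #|B|%:R <= n%:R / 10 ^+ 10 :> R ->
  #|saturated d e U B|%:R <= n%:R / 100 :> R.
Proof.
move=> hU hB; set Q := saturated _ _ _ _.
have h : (#|Q| * thr d <= \sum_y #|[set x | U x y]| + d * #|B|)%N.
  rewrite -sum_nbhd_cap -big_split /= -sum_nat_const.
  apply: (@leq_trans (\sum_(y in Q) load e U B y)).
    by apply: leq_sum => y; rewrite inE.
  rewrite [X in (X <= _)%N]big_mkcond /=; apply: leq_sum => y _; case: ifP => // _.
  apply: leq_trans (finset.leq_card_setU _ _); apply/subset_leq_card/fintype.subsetP => x.
  by rewrite !inE (ndl_sym Ge).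
move: h; rewrite -(ler_nat R) natrD !natrM => h.
have [t1 _] := thr_bounds.
have h' : #|Q|%:R * (d%:R / 200) <= n%:R * d%:R / (200 * 200) + d%:R * (n%:R / 10 ^+ 10) :> R.
  apply: (@le_trans _ _ (#|Q|%:R * (thr d)%:R)); first by rewrite ler_wpM2l.
  by apply: le_trans h _; rewrite lerD // ler_wpM2l // ltW.
have N0 := N_gt0.
have {}h' : #|Q|%:R / 200 <= n%:R / (200 * 200) + n%:R / 10 ^+ 10 :> R.
  rewrite -(ler_pM2l D_gt0); apply: le_trans (le_trans _ h') _;
    rewrite le_eqVlt; apply/orP; left; apply/eqP; ring.
lra.
Qed.

(** The two bounds reproduce each other. If [B] has at most n/10^10 vertices, then [Q] has at most
    n/100, so a vertex expects at most d/100 neighbours in [Q]; those with more than d/50 are fewer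
    than [Q] by a factor 10^8. *)
Lemma critical_small (U : rel 'I_n) k :
  (\sum_y #|[set x | U x y]|)%:R <= n%:R * d%:R / (200 * 200) :> R ->
  #|iter k (crit_step d e U) finset.set0|%:R <= n%:R / 10 ^+ 10 :> R.
Proof.
move=> hU; elim: k => [|k IH]; first by rewrite cards0 divr_ge0 ?exprn_ge0 // ltW.
have hQ := saturated_small hU IH; have N0 := N_gt0.
rewrite iterS; set X := crit_step _ _ _ _; set Q := saturated _ _ _ _ in hQ.
have := @expansion_eps (1 / 50) (1 / 100) X Q.
have -> : (1 / 50 - 1 / 100) ^+ 2 * (1000 * 1000) ^+ 2 = 10 ^+ 8 :> R by field.
move=> h; suff h8 : 10 ^+ 8 * #|X|%:R <= #|Q|%:R :> R by lra.
apply: h; [|by lra|by lra] => x; rewrite inE -(ler_nat R) => hx.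
by have [s1 _] := slk_bounds; lra.
Qed.

(** Let [H] be the set of vertices crowded by [X]. By expansion [H] is much smaller than [X]. Were
    nothing peelable, each vertex of [X] would have more than [slk d] neighbours in [H], as it lacks
    more than [2 * slk d] roomy ones and at most [slk d] of these lie in [Q]; then expansion makes
    [X] much smaller than [H]. *)
Lemma peelable_neq0 (Q X : {set 'I_n}) :
  X != finset.set0 -> #|X|%:R <= n%:R / 10 ^+ 10 :> R ->
  (forall x, x \in X -> (#|nbhd e x :&: Q| <= slk d)%N) ->
  peelable d e Q X != finset.set0.
Proof.
move=> X0 Xs XQ; apply/negP => /eqP P0; have [D0 N0] := (D_gt0, N_gt0).
pose H := [set y | (thr d < #|nbhd e y :&: X|)%N].
have HX : (1 / 200) ^+ 2 * (1000 * 1000) ^+ 2 * #|H|%:R <= #|X|%:R :> R.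
  have := @expansion_eps (1 / 100) (1 / 200) H X.
  have -> : 1 / 100 - 1 / 200 = 1 / 200 :> R by field.
  apply; [|by lra|by lra] => y; rewrite inE -(ler_nat R) => hy.
  by have [_ t2] := thr_bounds; lra.
have XH : (1 / 100) ^+ 2 * (1000 * 1000) ^+ 2 * #|X|%:R <= #|H|%:R :> R.
  have := @expansion_eps (1 / 50) (1 / 100) X H.
  have -> : 1 / 50 - 1 / 100 = 1 / 100 :> R by field.
  apply; [|by lra|by lra] => x xX.
  have : (slk d < #|nbhd e x :&: H|)%N.
    have xP : x \notin peelable d e Q X by rewrite P0 inE.
    move: xP; rewrite inE xX /= -ltnNge => xP.
    have : (#|nbhd e x| <= #|nbhd e x :&: roomy d e Q X| + #|nbhd e x :&: Q| + #|nbhd e x :&: H|)%N.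
      apply: (@leq_trans #|(nbhd e x :&: roomy d e Q X :|: nbhd e x :&: Q) :|: nbhd e x :&: H|).
        apply/subset_leq_card/fintype.subsetP => y; rewrite !inE => ->.
        by rewrite ltnNge; case: (_ <= _)%N; case: (y \in Q).
      apply: leq_trans (finset.leq_card_setU _ _) _; rewrite leq_add2r.
      exact: finset.leq_card_setU.
    rewrite (ndl_card Ge); move: (XQ x xX) xP.
    move: #|_ :&: roomy _ _ _ _| #|_ :&: Q| #|_ :&: H| (slk d) => r q h k; clear; lia.
  rewrite -(ler_nat R) => hx; have [s1 _] := slk_bounds; lra.
have X1 : 1 <= #|X|%:R :> R by rewrite ler1n card_gt0.
lra.
Qed.

(** While the next level has at most n/2 vertices, expansion with 9/10 - 1/2 = 2/5 multiplies the
    size by (2/5)^2 q^2, which is at least q because q exceeds 10^6. Levels growing like powers of q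
    cannot go on for [k] steps without reaching [n]. *)
Lemma reach_half (H : rel 'I_n) (L : nat -> {set 'I_n}) a k :
  (forall x y, H x y -> e x y) ->
  (forall x, 9 / 10 * d%:R <= #|[set y | H x y]|%:R :> R) ->
  a \in L 0%N -> (forall j, (j < k)%N -> L j \subset L j.+1) ->
  (forall j x y, (j < k)%N -> x \in L j -> H x y -> y \in L j.+1) ->
  n%:R <= (d%:R / lam) ^+ k -> (n < 2 * #|L k|)%N.
Proof.
move=> sH degH aL mono step hk.
have l1 : 1 <= lam := lam_ge1 Ge d_lt_n lam_lt_d d_gt0.
have [D0 N0] := (D_gt0, N_gt0).
have l0 : 0 < lam by lra.
set q := d%:R / lam in hk.
have q_big : (1000 * 1000) < q by rewrite ltr_pdivlMr // mulrC.
suff P j : (j <= k)%N -> (n < 2 * #|L j|)%N \/ q ^+ j <= #|L j|%:R.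
  case: (P k (leqnn k)) => // h.
  have nL : (n <= #|L k|)%N by rewrite -(ler_nat R); apply: le_trans hk h.
  have L0 := leq_trans n_gt0 nL; apply: leq_ltn_trans nL _.
  by rewrite mul2n -addnn -[X in (X < _)%N]addn0 ltn_add2l.
elim: j => [|j IH] jk.
  by right; rewrite expr0 ler1n card_gt0; apply/finset.set0Pn; exists a.
case: (IH (ltnW jk)) => {}IH.
  by left; apply: leq_trans IH _; rewrite leq_mul2l /=; apply: subset_leq_card; apply: mono.
case: (ltnP n (2 * #|L j.+1|)) => [|hL]; [by left|right].
have hY : #|L j.+1|%:R <= 1 / 2 * n%:R :> R.
  by move: hL; rewrite -(ler_nat R) natrM => hL; lra.
have := expansion Ge d_lt_n lam_lt_d (X := L j) _ hY (c := 9 / 10) => h.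
have {}h : ((9 / 10 - 1 / 2) * d%:R) ^+ 2 * #|L j|%:R <= lam ^+ 2 * #|L j.+1|%:R.
  apply: h; last by lra.
  move=> x xL; apply: le_trans (degH x) _; rewrite ler_nat.
  apply/subset_leq_card/fintype.subsetP => y; rewrite !inE => Hxy.
  by rewrite (sH _ _ Hxy) (step j x y).
have {}h : (2 / 5) ^+ 2 * q ^+ 2 * #|L j|%:R <= #|L j.+1|%:R.
  rewrite -(ler_pM2l (_ : 0 < lam ^+ 2)) ?exprn_gt0 //.
  apply: le_trans h; rewrite le_eqVlt; apply/orP; left; apply/eqP.
  by rewrite /q; field; lra.
apply: le_trans h; rewrite exprS.
have qj : 0 <= q ^+ j by rewrite exprn_ge0 //; lra.
apply: (@le_trans _ _ ((2 / 5) ^+ 2 * q ^+ 2 * q ^+ j)).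
  by rewrite ler_wpM2r //; nra.
by rewrite ler_wpM2l // mulr_ge0 // ?exprn_ge0 //; lra.
Qed.

End Expander.

(** * Families of paths *)

Section Families.
Local Open Scope nat_scope.
Variables (n : nat).
Implicit Types (p : seq 'I_n) (A : {set 'I_n * 'I_n}).

Lemma mem_path_edges p (E : {set 'I_n}) x0 :
  reflect (exists2 i, i.+1 < size p & E = [set nth x0 p i; nth x0 p i.+1])
          (E \in path_edges p).
Proof.
case: p => [|x p] /=; first by rewrite in_nil; constructor; case.
apply: (iffP (nthP E)) => [[i ip]|[i ip]].
  by rewrite (nth_pairmap x0) -?(size_pairmap (fun u v => [set u; v]) x) // => <-; exists i;
      rewrite /= ?size_pairmap // in ip *.
by move=> ->; exists i; rewrite ?size_pairmap // (nth_pairmap x0).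
Qed.

(** The third clause is the gain from orienting towards the middle: no vertex is left more often
    than it is entered, except once at an end of the path. Trivial paths have no arcs. *)
Definition oriented p A : Prop :=
  [/\ forall x y, (x, y) \in A -> [set x; y] \in path_edges p,
      forall E, E \in path_edges p -> exists x y, (x, y) \in A /\ E = [set x; y],
      forall v, #|[set y | (v, y) \in A]| <= #|[set x | (x, v) \in A]| + is_endpoint v p &
      \sum_y #|[set x | (x, y) \in A]| <= path_length p].

Definition used (F : seq (seq 'I_n * {set 'I_n * 'I_n})) : rel 'I_n :=
  fun x y => has (fun q : seq 'I_n * {set 'I_n * 'I_n} => (x, y) \in q.2) F.

Definition routed (F : seq (seq 'I_n * {set 'I_n * 'I_n})) : Prop :=
  pairwise (fun q q' : seq 'I_n * {set 'I_n * 'I_n} => edge_disjoint q.1 q'.1) F /\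
  forall i, i < size F -> let q := nth ([::], finset.set0) F i in oriented q.1 q.2.

Lemma routed_cons q F :
  routed (q :: F) <->
  [/\ all (fun q' => edge_disjoint q.1 q'.1) F, oriented q.1 q.2 & routed F].
Proof.
split=> [[/= /andP [h1 h2] h3]|[h1 h2 [h3 h4]]].
  by split=> //; [exact: (h3 0)|split=> // i iF; exact: (h3 i.+1)].
by split=> [|[|i]] //=; [rewrite h1|exact: h4].
Qed.

Lemma edge_disjointC p q : edge_disjoint p q = edge_disjoint q p.
Proof. by rewrite /edge_disjoint has_sym. Qed.

Lemma used_edge F x y : routed F -> used F x y ->
  has (fun q => [set x; y] \in path_edges q.1) F.
Proof.
elim: F => [//|q F IH] /routed_cons [_ [or1 _ _ _] rF] /= /orP [/or1 -> //|/(IH rF) ->].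
by rewrite orbT.
Qed.

Lemma unused_edge F x y : routed F -> ~~ used F x y -> ~~ used F y x ->
  ~~ has (fun q => [set x; y] \in path_edges q.1) F.
Proof.
elim: F => [//|q F IH] /routed_cons [_ [_ or2 _ _] rF] /=.
rewrite !negb_or => /andP [h1 h2] /andP [h3 h4]; apply/andP; split; last exact: IH.
apply/negP => /or2 [x1 [y1 [Axy E]]].
have : (x1 \in [set x; y]) && (y1 \in [set x; y]) by rewrite E !inE !eqxx orbT.
have : (x \in [set x1; y1]) && (y \in [set x1; y1]) by rewrite -E !inE !eqxx orbT.
rewrite !inE => /andP [X1 X2] /andP [X3 X4].
have : (x1 == x) && (y1 == y) || (x1 == y) && (y1 == x).
  move: X1 X2 X3 X4; rewrite ![x == _]eq_sym ![y == _]eq_sym.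
  by case: (x1 == x); case: (x1 == y); case: (y1 == x); case: (y1 == y).
by case/orP => /andP [/eqP e1 /eqP e2]; move: Axy; rewrite e1 e2 ?(negbTE h1) ?(negbTE h3).
Qed.

Lemma edges_disjoint q F E : all (fun q' => edge_disjoint q q'.1) F ->
  E \in path_edges q -> ~~ has (fun q' : seq 'I_n * {set 'I_n * 'I_n} => E \in path_edges q'.1) F.
Proof.
move=> dis Eq; elim: F dis => [//|q' F IH] /= /andP [d1 d2].
rewrite negb_or IH // andbT; apply/negP => h.
by move: d1 => /hasPn /(_ _ h) /negP.
Qed.

Lemma used_disjoint q F x y : routed (q :: F) -> (x, y) \in q.2 -> ~~ used F x y.
Proof.
move=> /routed_cons [dis [or1 _ _ _] rF] /or1 qxy; apply/negP => /(used_edge rF).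
by apply/negP; apply: edges_disjoint dis qxy.
Qed.

Let card_pred0 (P : pred 'I_n) : P =1 pred0 -> #|[set x | P x]| = 0.
Proof.
by move=> P0; apply/eqP; rewrite cards_eq0; apply/eqP/finset.setP => x; rewrite !inE P0.
Qed.

(** Summing the third clause of [oriented] over the family. Disjointness is needed because the
    in-degrees, which stand on the larger side, have to add up exactly. *)
Lemma used_degree F v : routed F ->
  #|[set y | used F v y]| <= #|[set x | used F x v]| + count (is_endpoint v) [seq q.1 | q <- F].
Proof.
elim: F => [|q F IH] rqF; first by rewrite card_pred0.
have /routed_cons [_ [_ _ or3 _] rF] := rqF.
have Eo : #|[set y | used (q :: F) v y]| <= #|[set y | (v, y) \in q.2]| + #|[set y | used F v y]|.
  apply: leq_trans (finset.leq_card_setU _ _); apply/subset_leq_card/fintype.subsetP => y.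
  by rewrite !inE.
have Ei : #|[set x | used (q :: F) x v]| = #|[set x | (x, v) \in q.2]| + #|[set x | used F x v]|.
  rewrite -cardsUI [X in _ = _ + X](_ : _ = 0) ?addn0; last first.
    apply: card_pred0 => x; rewrite !inE.
    by apply/negP => /andP [/(used_disjoint rqF) /negP].
  by apply: eq_card => x; rewrite !inE.
by apply: leq_trans Eo (leq_trans (leq_add (or3 v) (IH rF)) _); rewrite Ei addnACA.
Qed.

Lemma used_total F k : routed F -> (forall q, q \in [seq q.1 | q <- F] -> path_length q <= k) ->
  \sum_y #|[set x | used F x y]| <= size F * k.
Proof.
elim: F => [|q F IH] rqF lk.
  by rewrite big1 // => y _; rewrite card_pred0.
have /routed_cons [_ [_ _ _ or4] rF] := rqF.
have h1 : \sum_y #|[set x | used F x y]| <= size F * k.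
  by apply: IH => // z zF; apply: lk; rewrite inE zF orbT.
have h2 : path_length q.1 <= k by apply: lk; rewrite inE eqxx.
have : \sum_y #|[set x | used (q :: F) x y]| <= \sum_y #|[set x | (x, y) \in q.2]| + \sum_y
    #|[set x | used F x y]|.
  rewrite -big_split /=; apply: leq_sum => y _.
  apply: leq_trans (finset.leq_card_setU _ _); apply/subset_leq_card/fintype.subsetP => x.
  by rewrite !inE.
by move=> h; apply: leq_trans h _; rewrite mulSn leq_add // (leq_trans or4).
Qed.

(** The removed arcs are described through undirected edges, since a request to remove [p] does not
    reveal the orientation of [p]. No other path shares these edges, so exactly the arcs of [p]
    disappear. *)
Lemma routed_rem p F : routed F -> p \in [seq q.1 | q <- F] ->
  exists F', [/\ routed F', [seq q.1 | q <- F'] = rem p [seq q.1 | q <- F] &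
    forall x y, used F' x y = used F x y && ([set x; y] \notin path_edges p)].
Proof.
elim: F => [//|q F IH] rqF.
have /routed_cons [dis oq rF] := rqF.
rewrite inE /= eq_sym; case: (eqVneq q.1 p) => [qp _|qp /= pF].
  exists F; split=> // x y.
  case uF: (used F x y).
    rewrite orbT /=; apply/esym; apply/negP => /(edges_disjoint _) h.
    by move: (used_edge rF uF); apply/negP; apply: h; rewrite -qp.
  rewrite orbF; case qxy: ((x, y) \in q.2) => //=.
  by case: oq => /(_ x y qxy); rewrite qp => ->.
have [F' [rF' mF' uF']] := IH rF pF; exists (q :: F'); split.
- apply/routed_cons; split=> //; rewrite -(all_map _ (edge_disjoint q.1)) mF'.
  apply/allP => z /mem_rem; rewrite -(all_map _ (edge_disjoint q.1)) in dis; exact: (allP dis).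
- by rewrite /= mF'.
move=> x y; rewrite /= uF' andb_orl; congr (_ || _).
case qxy: ((x, y) \in q.2) => //=; apply/esym.
rewrite -(all_map _ (edge_disjoint q.1)) in dis.
move: (allP dis p pF) => /hasPn dq; apply/negP => /dq /negP; apply.
by case: oq => /(_ x y qxy).
Qed.

End Families.

(** * Search trees and the route through a meeting vertex *)

Section Routes.
Local Open Scope nat_scope.
Variables (n : nat) (H : rel 'I_n).

(** [D] is 1 plus the depth, so that 0 is free to mark vertices outside the tree. *)
Definition search_tree (a : 'I_n) (D : 'I_n -> nat) (par : 'I_n -> 'I_n) : Prop :=
  [/\ D a = 1, forall v, D v = 1 -> v = a &
      forall v, 1 < D v -> H (par v) v /\ D (par v) = (D v).-1].

(** The walk goes from [w] up to the root, but the arcs point the other way, as the search followed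
    them. *)
Definition climb (par : 'I_n -> 'I_n) (w : 'I_n) (k : nat) : {set 'I_n * 'I_n} :=
  [set (iter t.+1 par w, iter t par w) | t : 'I_k].

Lemma climbP par w k x y :
  reflect (exists2 t, t < k & x = iter t.+1 par w /\ y = iter t par w)
          ((x, y) \in climb par w k).
Proof.
apply: (iffP imsetP) => [[t _ [-> ->]]|[t tk [-> ->]]]; first by exists t; [exact: ltn_ord|].
by exists (Ordinal tk).
Qed.

Lemma climbS par w k x y :
  ((x, y) \in climb par w k.+1) =
  ((x, y) \in climb par w k) || (x == iter k.+1 par w) && (y == iter k par w).
Proof.
apply/climbP/orP => [[t]|[/climbP [t tk xy]|/andP [/eqP -> /eqP ->]]].
- rewrite ltnS leq_eqVlt => /orP [/eqP -> [-> ->]|tk xy]; first by right; rewrite !eqxx.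
  by left; apply/climbP; exists t.
- by exists t => //; apply: leqW.
- by exists k.
Qed.

Lemma climb_in par w k y : #|[set x | (x, y) \in climb par w k]| <= 1.
Proof.
rewrite -(cards1 (par y)); apply/subset_leq_card/fintype.subsetP => x.
by rewrite !inE => /climbP [t _ [-> ->]].
Qed.

Lemma climb_sum par w k : \sum_y #|[set x | (x, y) \in climb par w k]| <= k.
Proof.
apply: (@leq_trans #|[set iter t par w | t : 'I_k]|); last first.
  by apply: leq_trans (leq_imset_card _ _) _; rewrite card_ord.
rewrite -sum1_card [X in _ <= X]big_mkcond /=; apply: leq_sum => y _.
case: ifP => [_|/imsetP yn]; first exact: climb_in.
rewrite leqn0 cards_eq0; apply/eqP/finset.setP => x; rewrite !inE.
by apply/negP => /climbP [t tk [_ e]]; apply: yn; exists (Ordinal tk).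
Qed.

Section Tree.
Variables (a w : 'I_n) (D : 'I_n -> nat) (par : 'I_n -> 'I_n).
Hypotheses (T : search_tree a D par) (Dw : 0 < D w).

Lemma climb_dist t : t < D w -> D (iter t par w) = D w - t.
Proof.
elim: t => [|t IH] tw; first by rewrite subn0.
case: T => _ _ h3; have := IH (ltnW tw) => E.
by case: (h3 (iter t par w)); rewrite E //=; [lia|move=> _ ->; lia].
Qed.

Lemma climb_arc x y : (x, y) \in climb par w (D w).-1 -> H x y.
Proof.
move=> /climbP [t tw [-> ->]]; case: T => _ _ h3.
by case: (h3 (iter t par w)) => //; rewrite climb_dist; lia.
Qed.

Lemma climb_top : iter (D w).-1 par w = a.
Proof. by case: T => _ h2 _; apply: h2; rewrite climb_dist; lia. Qed.

Lemma climb_out v : #|[set y | (v, y) \in climb par w (D w).-1]| <= 1.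
Proof.
case: (set_0Vmem [set y | (v, y) \in climb par w (D w).-1]) => [->|[y]].
  by rewrite cards0.
rewrite inE => /climbP [t tw [e1 e2]]; rewrite -(cards1 y).
apply/subset_leq_card/fintype.subsetP => z; rewrite !inE => /climbP [t' tw' [e1' e2']].
have : D (iter t.+1 par w) = D (iter t'.+1 par w) by rewrite -e1 -e1'.
rewrite !climb_dist; [|by lia|by lia] => e.
by rewrite e2 e2' (_ : t' = t) //; lia.
Qed.

Lemma climb_flow v y : (v, y) \in climb par w (D w).-1 ->
  v = a \/ 0 < #|[set x | (x, v) \in climb par w (D w).-1]|.
Proof.
move=> /climbP [t tw [-> _]]; case: (eqVneq t.+1 (D w).-1) => [->|tn].
  by left; apply: climb_top.
right; rewrite card_gt0; apply/finset.set0Pn; exists (iter t.+2 par w).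
by rewrite inE; apply/climbP; exists t.+1 => //; lia.
Qed.

End Tree.

Variables (a b w : 'I_n) (Da Db : 'I_n -> nat) (pa pb : 'I_n -> 'I_n).
Hypotheses (Ta : search_tree a Da pa) (Tb : search_tree b Db pb).
Hypotheses (wa : 0 < Da w) (wb : 0 < Db w).
Hypothesis wmin : forall v, 0 < Da v -> 0 < Db v -> Da w + Db w <= Da v + Db v.

(** The vertex [w] is counted in both depths, and depths start at 1; hence a route has
    [(Da w + Db w).-1] vertices, with [w] at position [(Da w).-1]. *)
Definition route_at (i : nat) : 'I_n :=
  if i < Da w then iter ((Da w).-1 - i) pa w else iter (i.+1 - Da w) pb w.

Definition route : seq 'I_n := mkseq route_at (Da w + Db w).-1.

Definition route_arcs : {set 'I_n * 'I_n} :=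
  climb pa w (Da w).-1 :|: climb pb w (Db w).-1.

Lemma size_route : size route = (Da w + Db w).-1.
Proof. exact: size_mkseq. Qed.

Lemma route_up i : (Da w).-1 <= i -> route_at i = iter (i.+1 - Da w) pb w.
Proof.
move=> h; rewrite /route_at; case: ltnP => // h2.
by have [-> ->] : (Da w).-1 - i = 0 /\ i.+1 - Da w = 0 by lia.
Qed.

(** A common vertex further up would have a smaller total depth than [w]. This makes the route
    simple. *)
Lemma meet_climbs s t : s < Da w -> t < Db w -> iter s pa w = iter t pb w ->
  s = 0 /\ t = 0.
Proof.
move=> sw tw e; have := wmin (v := iter s pa w).
rewrite (climb_dist Ta wa sw) {1 2}e (climb_dist Tb wb tw); lia.
Qed.

Lemma route_step i : i.+1 < (Da w + Db w).-1 ->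
  (route_at i, route_at i.+1) \in route_arcs \/ (route_at i.+1, route_at i) \in route_arcs.
Proof.
move=> h; case: (ltnP i.+1 (Da w)) => ia.
  left; rewrite inE; apply/orP; left; apply/climbP; exists ((Da w).-1 - i.+1); first by lia.
  rewrite /route_at ia (ltnW ia); split=> //; congr (iter _ _ _); lia.
right; rewrite inE; apply/orP; right; apply/climbP; exists (i.+1 - Da w); first by lia.
rewrite !route_up; [|by lia|by lia]; split=> //; congr (iter _ _ _); lia.
Qed.

Lemma route_arc_index x y : (x, y) \in route_arcs ->
  exists2 i, i.+1 < (Da w + Db w).-1 &
    (x = route_at i /\ y = route_at i.+1) \/ (x = route_at i.+1 /\ y = route_at i).
Proof.
rewrite inE => /orP [/climbP [t tw [-> ->]]|/climbP [t tw [-> ->]]].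
  exists ((Da w).-1 - t.+1); first by lia.
  left; rewrite /route_at !ifT; [|by lia|by lia].
  have [-> ->] : (Da w).-1 - ((Da w).-1 - t.+1) = t.+1 /\
                 (Da w).-1 - ((Da w).-1 - t.+1).+1 = t by lia.
  by [].
exists ((Da w).-1 + t); first by lia.
right; rewrite !route_up; [|by lia|by lia].
have [-> ->] : ((Da w).-1 + t).+2 - Da w = t.+1 /\ ((Da w).-1 + t).+1 - Da w = t by lia.
by [].
Qed.

Lemma route_arc x y : (x, y) \in route_arcs -> H x y.
Proof. by rewrite inE => /orP [/(climb_arc Ta wa)|/(climb_arc Tb wb)]. Qed.

Lemma route_in y : #|[set x | (x, y) \in route_arcs]| <= 2.
Proof.
apply: (@leq_trans #|[set x | (x, y) \in climb pa w (Da w).-1] :|: [set x | (x, y) \in climb pb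
    w (Db w).-1]|).
  by apply/subset_leq_card/fintype.subsetP => x; rewrite !inE.
by apply: leq_trans (finset.leq_card_setU _ _) _; rewrite (leq_add (climb_in _ _ _ _) (climb_in
    _ _ _ _)).
Qed.

Lemma route_inj i j : i < (Da w + Db w).-1 -> j < (Da w + Db w).-1 ->
  route_at i = route_at j -> i = j.
Proof.
wlog ij : i j / i <= j.
  by move=> h im jm e; case: (leqP i j) => [/h|/ltnW /h]; [apply|move=> <-].
move=> im jm; case: (ltnP j (Da w)) => ja.
  rewrite /route_at ja (leq_ltn_trans ij ja) => /(congr1 Da).
  rewrite !(climb_dist Ta wa); lia.
case: (ltnP i (Da w)) => ia.
  rewrite /route_at ia ltnNge ja /= => /meet_climbs; lia.
rewrite /route_at !ltnNge ia ja /= => /(congr1 Db).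
rewrite !(climb_dist Tb wb); lia.
Qed.

Lemma route_neq0 : 0 < (Da w + Db w).-1. Proof. by lia. Qed.

Lemma route_first : route_at 0 = a.
Proof. by rewrite /route_at wa subn0 (climb_top Ta wa). Qed.

Lemma route_last : route_at (Da w + Db w).-2 = b.
Proof.
rewrite route_up; last by lia.
by rewrite -[RHS](climb_top Tb wb); congr (iter _ _ _); lia.
Qed.

Lemma routeE : route = a :: [seq route_at i | i <- iota 1 (Da w + Db w).-2].
Proof.
rewrite /route /mkseq -route_first.
by have := route_neq0; case: (Da w + Db w).-1.
Qed.

Lemma last_route : last a [seq route_at i | i <- iota 1 (Da w + Db w).-2] = b.
Proof.
rewrite -route_last -[in LHS]route_first last_map; congr route_at.
by rewrite (last_nth 0) size_iota -[0 :: _]/(iota 0 _.+1) nth_iota.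
Qed.

Lemma is_path_route (e : rel 'I_n) : symmetric e -> (forall x y, H x y -> e x y) ->
  is_path e a b route.
Proof.
move=> se He; have nthr i : i < (Da w + Db w).-1 -> nth a route i = route_at i.
  by move=> im; rewrite nth_mkseq.
have sz := size_route; have m0 := route_neq0.
have uq : uniq route.
  rewrite map_inj_in_uniq ?iota_uniq // => i j; rewrite !mem_iota /= !add0n => im jm.
  exact: route_inj.
rewrite routeE in nthr sz uq *; rewrite /is_path eqxx uq last_route eqxx !andbT /=.
apply/(pathP a) => i im.
have im' : i.+1 < (Da w + Db w).-1 by rewrite -sz.
have /= -> := nthr i.+1 im'; rewrite (nthr i); last by lia.
by case: (route_step im') => /route_arc /He //; rewrite se.
Qed.

Lemma is_endpoint_route v : is_endpoint v route = (v == a) || (v == b).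
Proof. by rewrite routeE /is_endpoint last_route; case: (_ || _). Qed.

Lemma length_route : path_length route = (Da w + Db w).-2.
Proof.
by rewrite /path_length routeE /path_edges size_pairmap size_map size_iota.
Qed.

Lemma oriented_route : oriented route route_arcs.
Proof.
have sz := size_route.
have nthr i : i < (Da w + Db w).-1 -> nth a route i = route_at i.
  by move=> im; rewrite nth_mkseq.
split.
- move=> x y /route_arc_index [i im h]; apply/(mem_path_edges _ _ a).
  exists i; first by rewrite sz.
  rewrite !nthr //; last by lia.
  by case: h => [[-> ->]|[-> ->]] //; rewrite finset.setUC.
- move=> E /(mem_path_edges _ _ a) [ i im ->]; rewrite sz in im; rewrite !nthr //; last by lia.
  case: (route_step im) => h.
    by exists (route_at i), (route_at i.+1).
  by exists (route_at i.+1), (route_at i); rewrite finset.setUC.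
- move=> v; rewrite is_endpoint_route.
  set Sa := [set y | (v, y) \in climb pa w (Da w).-1].
  set Sb := [set y | (v, y) \in climb pb w (Db w).-1].
  have hS : #|[set y | (v, y) \in route_arcs]| <= #|Sa| + #|Sb|.
    apply: leq_trans (finset.leq_card_setU _ _).
    by apply/subset_leq_card/fintype.subsetP => x; rewrite !inE.
  apply: leq_trans hS _.
  have ha := climb_out Ta wa v; have hb := climb_out Tb wb v.
  rewrite -/Sa in ha; rewrite -/Sb in hb.
  have lea : #|[set x | (x, v) \in climb pa w (Da w).-1]| <= #|[set x | (x, v) \in route_arcs]|.
    by apply/subset_leq_card/fintype.subsetP => x; rewrite !inE => ->.
  have leb : #|[set x | (x, v) \in climb pb w (Db w).-1]| <= #|[set x | (x, v) \in route_arcs]|.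
    by apply/subset_leq_card/fintype.subsetP => x; rewrite !inE => ->; rewrite orbT.
  case: (set_0Vmem Sa) => [Sa0|[y]].
    rewrite Sa0 cards0 add0n; case: (set_0Vmem Sb) => [->|[y]]; first by rewrite cards0.
    rewrite inE => /(climb_flow Tb wb) [->|h]; apply: leq_trans hb _.
      by rewrite eqxx orbT addn1.
    by apply: leq_trans (leq_trans h leb) (leq_addr _ _).
  (* A vertex left in both climbs would lie strictly above [w] in both trees. *)
  rewrite inE => vy; have Sb0 : Sb = finset.set0.
    apply/finset.setP => z; rewrite !inE; apply/negP => vz.
    move: vy vz => /climbP [s sw [e1 _]] /climbP [t tw [e2 _]].
    have := @meet_climbs s.+1 t.+1; rewrite -e1 -e2 => h.
    by case: h => //; lia.
  rewrite Sb0 cards0 addn0.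
  case: (climb_flow Ta wa vy) => [->|h]; apply: leq_trans ha _.
    by rewrite eqxx addn1.
  by apply: leq_trans (leq_trans h lea) (leq_addr _ _).
- rewrite length_route.
  apply: (@leq_trans (\sum_y (#|[set x | (x, y) \in climb pa w (Da w).-1]| + #|[set x | (x, y)
      \in climb pb w (Db w).-1]|))).
    apply: leq_sum => y _; apply: leq_trans (finset.leq_card_setU _ _).
    by apply/subset_leq_card/fintype.subsetP => x; rewrite !inE.
  rewrite big_split /=; apply: leq_trans (leq_add (climb_sum _ _ _) (climb_sum _ _ _)) _.
  lia.
Qed.

End Routes.

(** Closure is claimed for depths up to [n] because the program runs its search for [n] rounds. *)
Definition search n (H : rel 'I_n) (a : 'I_n) (D : 'I_n -> nat) (par : 'I_n -> 'I_n) : Prop :=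
  search_tree H a D par /\
  forall x y, H x y -> (0 < D x <= n)%N -> (0 < D y <= (D x).+1)%N.

(** * One turn of the game in terms of graphs *)

Section Step.
Variables (R : realType) (n d : nat) (lam : R) (e : rel 'I_n).
Hypotheses (Ge : ndl_graph d lam e) (dn : (200 < d < n)%N).
Hypothesis lam_lt : lam * (1000 * 1000) < d%:R.
(** Saturation costs at most [2 * slk d], used arcs entering [x] at most [2 * thr d + 1], and those
    leaving [x] the same plus the d/200 + 1 paths ending there. Together this is 0.085 d + 3, below
    d/10 since [d] exceeds 10^6. *)
Lemma open_degree F B Q rho :
  routed F -> valid_plan d e (used F) B Q rho ->
  (forall v, (count (is_endpoint v) [seq q.1 | q <- F])%:R <= d%:R / 200 + 1 :> R) ->
  forall x, 9 / 10 * d%:R <= #|[set y | open_arc e (used F) B Q rho x y]|%:R :> R.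
Proof.
move=> rF vp ends x; have := ends x.
set c := count _ _ => hc.
have h := open_arc_card (x := x) (k := 2 * (2 * thr d).+1 + c) (ndl_card Ge) vp.
have {}h : (d <= #|[set y | open_arc e (used F) B Q rho x y]| + 2 * slk d + (2 * (2 * thr d).+1
    + c))%N.
  apply: h; have ho := used_degree x rF; rewrite -/c in ho.
  have hi : (#|[set y | used F y x]| <= (2 * thr d).+1)%N.
    case: vp => v1 _ _ _; apply: leq_trans (v1 x).
    by apply/subset_leq_card/fintype.subsetP => y; rewrite !inE => ->.
  apply: (@leq_trans ((2 * thr d).+1 + c + (2 * thr d).+1)%N); last by lia.
  by rewrite leq_add // (leq_trans ho) // leq_add2r.
have ht : (100 * thr d <= d)%N by rewrite mulnC leq_trunc_div.
have [_ hs] := slk_bounds R d.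
have dl := d_large Ge dn lam_lt.
move: h ht; rewrite -(ler_nat R) -(ler_nat R) !natrD !natrM -(@natr1 R (2 * thr d)) natrM => h ht.
lra.
Qed.

Lemma extend_family F B Q rho a b w Da Db pa pb :
  let H := open_arc e (used F) B Q rho in
  routed F -> search H a Da pa -> search H b Db pb ->
  (0 < Da w)%N -> (0 < Db w)%N ->
  (forall v, (0 < Da v)%N -> (0 < Db v)%N -> (Da w + Db w <= Da v + Db v)%N) ->
  let p := route w Da Db pa pb in
  [/\ is_path e a b p, all (edge_disjoint p) [seq q.1 | q <- F] &
      routed ((p, route_arcs w Da Db pa pb) :: F)].
Proof.
move=> H rF [ta _] [tb _] wa wb wm p.
have He x y : H x y -> e x y by case/and4P.
have ip : is_path e a b p.
  by apply: (is_path_route ta tb wa wb wm) => //; exact: (ndl_sym Ge).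
have op : oriented p (route_arcs w Da Db pa pb) := oriented_route ta tb wa wb wm.
have dis : all (fun q' : seq 'I_n * {set 'I_n * 'I_n} => edge_disjoint p q'.1) F.
  apply/allP => q qF; rewrite edge_disjointC; apply/hasPn => E Eq.
  apply/negP => Ep; case: op => _ /(_ E) h _ _.
  have [//|x [y [xy EE]]] := h _.
  have /and4P [_ h1 h2 _] : H x y := (route_arc ta tb wa wb xy).
  move: (unused_edge rF h1 h2) => /hasPn /(_ q qF); rewrite -EE.
  by move/negP; apply.
split=> //; first by rewrite all_map.
exact/routed_cons.
Qed.

Lemma peel_inv0 Q X (rho : rel 'I_n) : peel_inv d e Q X rho X rho.
Proof.
split=> //; first by move=> x; rewrite finset.setDv inE.
move=> y; left; apply/eqP; rewrite cards_eq0; apply/eqP/finset.setP => x.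
by rewrite !inE; case: (x \in X).
Qed.

(** Untreated vertices are critical for [U], hence few, and lie outside the old [B], hence have few
    neighbours in the old [Q]. So a nonempty [X] loses a vertex in each round, and [n] rounds empty
    it. *)
Lemma peel_shrink (U : rel 'I_n) (B Q X : {set 'I_n}) j :
  (\sum_y #|[set x | U x y]|)%:R <= n%:R * d%:R / (200 * 200) :> R ->
  (forall x, x \notin B -> (#|nbhd e x :&: Q| <= slk d)%N) ->
  X \subset critical d e U :\: B -> (#|X| <= n - j)%N ->
  (#|X :\: peelable d e Q X| <= n - j.+1)%N.
Proof.
move=> hU v3 sX Xj; case: (eqVneq X finset.set0) => [->|X0].
  by rewrite finset.set0D cards0.
have Xs : #|X|%:R <= n%:R / 10 ^+ 10 :> R.
  apply: le_trans (critical_small Ge dn lam_lt n hU); rewrite ler_nat.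
  apply: subset_leq_card; apply: fintype.subset_trans sX _; exact: finset.subsetDl.
have P0 : peelable d e Q X != finset.set0.
  apply: (peelable_neq0 Ge dn lam_lt) => // x /(fintype.subsetP sX).
  by rewrite inE => /andP [xB _]; apply: v3.
have := cardsID (peelable d e Q X) X.
have : (0 < #|X :&: peelable d e Q X|)%N.
  rewrite card_gt0; case/finset.set0Pn: P0 => x xP; apply/finset.set0Pn; exists x.
  by rewrite inE xP andbT; move: xP; rewrite inE => /andP [].
by move: Xj; move: #|X| #|X :&: _| #|X :\: _| => i u v; clear; lia.
Qed.

Variable k : nat.
Hypotheses (hk : n%:R <= (d%:R / lam) ^+ k) (kn : (k <= n)%N).

Lemma search_half (H : rel 'I_n) a D par :
  (forall x y, H x y -> e x y) ->
  (forall x, 9 / 10 * d%:R <= #|[set y | H x y]|%:R :> R) ->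
  search H a D par -> (n < 2 * #|[set x | (0 < D x <= k.+1)%N]|)%N.
Proof.
move=> He deg [[D1 _ _] cl].
apply: (@reach_half _ _ _ _ _ Ge dn lam_lt H (fun j => [set x | (0 < D x <= j.+1)%N]) a) => //.
- by rewrite inE D1.
- move=> j _; apply/fintype.subsetP => x; rewrite !inE => /andP [-> h]; exact: leqW.
- move=> j x y jk; rewrite !inE => /andP [x0 xj] Hxy.
  have /andP [-> h] : (0 < D y <= (D x).+1)%N by apply: cl => //; rewrite x0 (leq_trans xj) //
      (leq_trans jk).
  exact: leq_trans h _.
Qed.

Lemma search_meet (H : rel 'I_n) a b Da Db pa pb :
  (forall x y, H x y -> e x y) ->
  (forall x, 9 / 10 * d%:R <= #|[set y | H x y]|%:R :> R) ->
  search H a Da pa -> search H b Db pb ->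
  exists w, (0 < Da w <= k.+1)%N /\ (0 < Db w <= k.+1)%N.
Proof.
move=> He deg sa sb; have ha := search_half He deg sa; have hb := search_half He deg sb.
set A := [set x | (0 < Da x <= _)%N] in ha; set B := [set x | (0 < Db x <= _)%N] in hb.
have : A :&: B != finset.set0.
  rewrite -card_gt0; have := cardsUI A B; have := max_card (mem (A :|: B)).
  rewrite card_ord; move: ha hb; move: #|A| #|B| #|A :|: B| #|A :&: B| => i j u v; lia.
by case/finset.set0Pn => w; rewrite !inE => /andP [wa wb]; exists w.
Qed.

End Step.

(** * Router's program *)

Definition Idx (x y : expr) : expr := Bin OpAdd (Bin OpMul x (Var 0)) y.

Definition Vec (a : nat) (x : expr) : cmd := For 10 0 (Put a (Var 10) x).

Definition MatVec (a : nat) (x g : expr) : cmd :=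
  For 10 0 (Defs.Seq (Sum 12 11 0 x) (Put a (Var 10) g)).

(* Variables 10 and 11 are set to the row and the column of the entry with
   index (variable) 13; variable 9 holds [n * n]. *)
Definition ForMat (c : cmd) : cmd :=
  For 13 9 (Defs.Seq (Assign 10 (Bin OpDiv (Var 13) (Var 0)))
           (Defs.Seq (Assign 11 (Bin OpMod (Var 13) (Var 0))) c)).

Definition Mat (a : nat) (x : expr) : cmd := ForMat (Put a (Var 13) x).

(** * Loops over vectors and matrices *)

Section Macros.
Local Open Scope nat_scope.
Variables (n W : nat).

Lemma mat_index_lt (u v : 'I_n) : u * n + v < n * n.
Proof. by have := ltn_ord u; have := ltn_ord v; nia. Qed.

Lemma mat_index_div (u v : 'I_n) : (u * n + v) %/ n = u.
Proof. by rewrite divnMDl ?divn_small ?addn0 // (leq_ltn_trans _ (ltn_ord u)). Qed.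

Lemma mat_index_mod (u v : 'I_n) : (u * n + v) %% n = v.
Proof. by rewrite modnMDl modn_small. Qed.

Lemma mat_index_inj (u v u' v' : 'I_n) : u * n + v = u' * n + v' -> u = u' /\ v = v'.
Proof.
move=> h; have := congr1 (divn^~ n) h; have := congr1 (modn^~ n) h.
by rewrite /= !mat_index_div !mat_index_mod => hv hu; split; apply: val_inj.
Qed.

Definition isvec (s : store) (a : nat) (S : {set 'I_n}) : Prop :=
  forall v : 'I_n, arr s a v = (v \in S).

Definition ismat (s : store) (a : nat) (M : rel 'I_n) : Prop :=
  forall u v : 'I_n, arr s a (u * n + v) = M u v.

Lemma agree_vec vs als s s' a P :
  agree vs als s s' -> isvec s a P -> a \notin als -> isvec s' a P.
Proof. by move=> [_ h] sP an v; rewrite h. Qed.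

Lemma agree_mat vs als s s' a M :
  agree vs als s s' -> ismat s a M -> a \notin als -> ismat s' a M.
Proof. by move=> [_ h] sM an u v; rewrite h. Qed.

Lemma agree_var vs als s s' x v :
  agree vs als s s' -> x \notin vs -> var s x = v -> var s' x = v.
Proof. by move=> [h _] xn <-; rewrite h. Qed.

Hypotheses (n_gt : 200 < n) (nW : 4 * (n * n) < W).

Let W_gt : 200 < W. Proof. by nia. Qed.
Let n_lt : n < W. Proof. by nia. Qed.

Lemma eval_idx s x y (u v : 'I_n) : var s 0 = n ->
  Defs.eval W s x = u -> Defs.eval W s y = v -> Defs.eval W s (Idx x y) = u * n + v.
Proof.
move=> s0 sx sy; have h := mat_index_lt u v; apply: eval_add => //; last by lia.
by apply: eval_mul => //; lia.
Qed.

Lemma eval_mat s a M x y (u v : 'I_n) : ismat s a M -> var s 0 = n ->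
  Defs.eval W s x = u -> Defs.eval W s y = v -> Defs.eval W s (Get a (Idx x y)) = M u v.
Proof. by move=> sM s0 sx sy; apply: eval_get (eval_idx s0 sx sy) (sM _ _). Qed.

Lemma eval_vec s a S x (v : 'I_n) : isvec s a S ->
  Defs.eval W s x = v -> Defs.eval W s (Get a x) = (v \in S).
Proof. by move=> sP sx; apply: eval_get sx (sP _). Qed.

Lemma runs_Vec a x s (f : 'I_n -> nat) : var s 0 = n ->
  (forall (v : 'I_n) s', agree [:: 10] [:: a] s s' -> arr s' a v = arr s a v ->
     var s' 10 = v -> var s' 0 = n -> Defs.eval W s' x = f v) ->
  runs W (Vec a x) ((cost x + 20) * n) s (fun s' =>
    agree [:: 10] [:: a] s s' /\ forall v : 'I_n, arr s' a v = f v).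
Proof.
(* [runs_vec] takes a function on all numbers; the default 0 is never attained through an index
   below [n]. *)
move=> s0 H; pose F j := if insub j is Some v then f v else 0.
have FE (v : 'I_n) : F v = f v by rewrite /F valK.
apply: (@runs_weaken _ _ ((cost x + 2 + 16) * n) _ _ (fun s' =>
  agree [:: 10] [:: a] s s' /\ forall j, j < n -> arr s' a j = F j)).
- apply: (runs_vec W_gt (vs := [::])) => //; first by rewrite n_lt andbT; lia.
  move=> j s' jn ag ar sj sn; rewrite -[j]/(val (Ordinal jn)) FE.
  apply: runs_weaken (runs_put _) _ (fun s h => h); last by rewrite /=; lia.
  rewrite (H (Ordinal jn)) //= sj; split=> //; last by rewrite /upd eqxx.
  by apply: agree_set_arr; rewrite inE.
- by nia.
- by move=> s' [ag h]; split=> // v; rewrite h.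
Qed.

Lemma runs_MatVec a x g s (f : 'I_n -> 'I_n -> nat) (h : 'I_n -> nat) : var s 0 = n ->
  (forall u, \sum_v f u v < W) ->
  (forall (u v : 'I_n) s', agree [:: 10; 11; 12] [:: a] s s' ->
     var s' 10 = u -> var s' 11 = v -> var s' 0 = n -> Defs.eval W s' x = f u v) ->
  (forall (u : 'I_n) s', agree [:: 10; 11; 12] [:: a] s s' ->
     var s' 10 = u -> var s' 12 = \sum_v f u v -> var s' 0 = n -> Defs.eval W s' g = h u) ->
  runs W (MatVec a x g) ((cost x + cost g + 60) * (n * n)) s (fun s' =>
    agree [:: 10; 11; 12] [:: a] s s' /\ forall v : 'I_n, arr s' a v = h v).
Proof.
move=> s0 lt Hx Hg; pose F j := if insub j is Some v then h v else 0.
have FE (v : 'I_n) : F v = h v by rewrite /F valK.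
apply: (@runs_weaken _ _ (((cost x + 21) * n + (cost g + 2) + 16) * n) _ _ (fun s' =>
  agree [:: 10; 11; 12] [:: a] s s' /\ forall j, j < n -> arr s' a j = F j)).
- apply: (runs_vec W_gt (vs := [:: 11; 12])) => //; first by rewrite n_lt andbT; lia.
    exact/(@allP _ (mem [:: 11; 12])).
  move=> j s' jn ag ar sj sn; set u := Ordinal jn; rewrite -[j]/(val u) FE.
  pose G i := if insub i is Some v then f u v else 0.
  have GE (v : 'I_n) : G v = f u v by rewrite /G valK.
  apply: runs_seq; apply: runs_weaken (runs_sum W_gt (f := G) (m := n) _ _ _ _ _ _ _) (leqnn _)
      _ => //.
  + by rewrite n_lt andbT; lia.
  + by under eq_bigr do rewrite GE.
  + move=> l s1 ln ag1 s1l s1n; rewrite -[l]/(val (Ordinal ln)) GE.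
    apply: Hx => //; last by apply: (agree_var ag1) => //.
    apply: (agree_trans ag); apply: agree_sub ag1 => y //.
    by rewrite !inE => /orP [] ->; rewrite ?orbT.
  move=> s1 [ag1]; under eq_bigr do rewrite GE; move=> s1acc.
  apply: runs_weaken (runs_put _) _ (fun s h => h); last by rewrite /=; lia.
  rewrite [Defs.eval W s1 (Var 10)]/= (agree_var ag1 _ sj) // (Hg u); first last.
  + by apply: agree_var ag1 _ sn.
  + exact: s1acc.
  + by apply: agree_var ag1 _ sj.
  + apply: (agree_trans ag); apply: agree_sub ag1 => y //.
    by rewrite !inE => /orP [] ->; rewrite ?orbT.
  split.
    apply: (@agree_trans _ _ _ s1); last by apply: agree_set_arr; rewrite inE.
    apply: agree_sub ag1 => y //.
  by rewrite /= /upd eqxx; case: ag1 => _ ->.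
- by nia.
- by move=> s' [ag hh]; split=> // v; rewrite hh.
Qed.

Lemma runs_ForMat c tb (Inv : nat -> store -> Prop) s :
  var s 0 = n -> var s 9 = n * n ->
  (forall v, v \in [:: 0; 9; 10; 11; 13] -> v \notin wvars c) ->
  (forall s s' j, agree [:: 10; 11; 13] [::] s s' -> Inv j s -> Inv j s') ->
  Inv 0 s ->
  (forall (u v : 'I_n) s, Inv (u * n + v) s -> var s 10 = u -> var s 11 = v ->
     var s 13 = u * n + v -> var s 0 = n -> runs W c tb s (Inv (u * n + v).+1)) ->
  runs W (ForMat c) ((tb + 30) * (n * n)) s (Inv (n * n)).
Proof.
move=> s0 s9 cw IA I0 IS.
pose J j s' := Inv j s' /\ var s' 0 = n.
apply: (@runs_weaken _ _ ((4 + (4 + tb) + 16) * (n * n)) _ _ (fun s' => J (n * n) s' /\ var s'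
    13 = n * n)).
- apply: (runs_for W_gt) => //=; try by rewrite !inE /= cw.
  + by nia.
  + split; last by [].
    by apply: IA I0; apply: agree_set_var.
  move=> j s1 jn [Ij s10] sj s19.
  have n0 : 0 < n by lia.
  have un : j %/ n < n by rewrite ltn_divLR.
  have vn : j %% n < n by rewrite ltn_mod.
  pose u := Ordinal un; pose v := Ordinal vn.
  have jE : j = u * n + v by exact: divn_eq.
  have jW : j < W by lia.
  apply: runs_seq; apply: runs_assign; rewrite (@eval_div W s1 (Var 13) (Var 0) j n) //.
  set s2 := set_var _ _ _.
  apply: runs_seq; apply: runs_assign; rewrite (@eval_mod W s2 (Var 13) (Var 0) j n) //.
  set s3 := set_var _ _ _.
  have ag3 : agree [:: 10; 11; 13] [::] s1 s3.
    by apply: (@agree_trans _ _ _ s2); apply: agree_set_var.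
  have h3 : runs W c tb s3 (Inv j.+1).
    rewrite jE; apply: IS => //=; [|by rewrite /upd /= sj -jE].
    by rewrite -jE; apply: IA ag3 Ij.
  apply: runs_weaken (runs_agree h3) (leqnn _) _ => s4 [I4 ag4].
  split.
    by apply: IA I4; apply: agree_set_var.
  by rewrite /= /upd /=; case: ag4 => -> //; exact: cw.
- by rewrite leq_mul2r; apply/orP; right; lia.
- by move=> s' [[]].
Qed.

Lemma runs_Mat a x s (f : 'I_n -> 'I_n -> nat) : var s 0 = n -> var s 9 = n * n ->
  (forall (u v : 'I_n) s', agree [:: 10; 11; 13] [:: a] s s' ->
     arr s' a (u * n + v) = arr s a (u * n + v) ->
     var s' 10 = u -> var s' 11 = v -> var s' 0 = n -> Defs.eval W s' x = f u v) ->
  runs W (Mat a x) ((cost x + 40) * (n * n)) s (fun s' =>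
    agree [:: 10; 11; 13] [:: a] s s' /\ forall u v : 'I_n, arr s' a (u * n + v) = f u v).
Proof.
move=> s0 s9 H.
pose Inv j s' := agree [:: 10; 11; 13] [:: a] s s' /\ forall u v : 'I_n,
  arr s' a (u * n + v) = if u * n + v < j then f u v else arr s a (u * n + v).
apply: (@runs_weaken _ _ ((cost x + 2 + 30) * (n * n)) _ _ (Inv (n * n))).
- apply: runs_ForMat => //.
  + move=> s1 s2 j ag [ag1 I1]; split; first by apply: agree_trans ag1 (agree_sub _ _ ag).
    by move=> u v; case: ag => _ -> //; apply: I1.
  move=> u v s1 [ag I1] su sv si sn.
  apply: runs_weaken (runs_put _) _ (fun s h => h); last by rewrite /=; lia.
  rewrite (H u v) //; last by rewrite I1 ltnn.
  split; first by apply: (agree_trans ag); apply: agree_set_arr; rewrite inE.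
  move=> u' v'; rewrite /= si /upd eqxx; case: eqP => [/mat_index_inj [-> ->]|/eqP ne].
    by rewrite ltnSn.
  by rewrite I1 ltnS [u' * n + v' <= _]leq_eqVlt (negbTE ne).
- by rewrite leq_mul2r; apply/orP; right; lia.
- by move=> s' [ag h]; split=> // u v; rewrite h mat_index_lt.
Qed.

Lemma sum_bool (P : pred 'I_n) : \sum_v (P v : nat) = #|[set v | P v]|.
Proof.
by rewrite -sum1_card [RHS]big_mkcond; apply: eq_bigr => v _; rewrite inE; case: (P v).
Qed.

End Macros.

(* Arrays: 2, 3 used and reserved arcs; 4, 5 critical and saturated vertices;
   6 open arcs; 7, 8 and 9, 10 distances and parents of the two searches;
   11, 12 the next 4 and 5; 13, 14, 15 roomy, untreated and peelable vertices. *)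
Definition thr_expr : expr := Bin OpDiv (Var 1) (Cst 100).
Definition slk_expr : expr := Bin OpDiv (Var 1) (Cst 50).

Definition open_cmd : cmd :=
  Mat 6 (And (Get 0 (Idx (Var 10) (Var 11)))
        (And (Not (Get 2 (Idx (Var 10) (Var 11))))
        (And (Not (Get 2 (Idx (Var 11) (Var 10))))
             (Or (And (Get 4 (Var 10)) (Get 3 (Idx (Var 10) (Var 11))))
                 (And (Not (Get 4 (Var 10))) (Not (Get 5 (Var 11)))))))).

(** Variable 10 is the head and the sum runs over tails, so the matrices are read with swapped
    indices. *)
Definition saturate_cmd : cmd :=
  MatVec 12 (Or (Get 2 (Idx (Var 11) (Var 10)))
                (And (Get 0 (Idx (Var 11) (Var 10))) (Get 11 (Var 11))))
            (Not (Bin OpLt (Var 12) thr_expr)).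

Definition crit_cmd : cmd :=
  MatVec 11 (And (Get 0 (Idx (Var 10) (Var 11))) (Get 12 (Var 11)))
            (Bin OpLt slk_expr (Var 12)).

(** Inside the loop array 12 belongs to the previous round's array 11; the last [saturate_cmd]
    brings it up to date. *)
Definition critical_cmd : cmd :=
  Defs.Seq (Vec 11 (Cst 0))
  (Defs.Seq (For 14 0 (Defs.Seq saturate_cmd crit_cmd)) saturate_cmd).

Definition roomy_cmd : cmd :=
  MatVec 13 (And (Get 0 (Idx (Var 10) (Var 11))) (Get 14 (Var 11)))
            (And (Not (Bin OpLt thr_expr (Var 12))) (Not (Get 5 (Var 10)))).

Definition peelable_cmd : cmd :=
  MatVec 15 (And (Get 0 (Idx (Var 10) (Var 11))) (Get 13 (Var 11)))
            (And (Get 14 (Var 10))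
                 (Not (Bin OpLt (Var 12)
                         (Bin OpSub (Var 1) (Bin OpMul (Cst 2) slk_expr))))).

Definition reserve_cmd : cmd :=
  Mat 3 (Or (And (Get 15 (Var 10))
                 (And (Get 0 (Idx (Var 10) (Var 11))) (Get 13 (Var 11))))
            (And (Not (Get 15 (Var 10))) (Get 3 (Idx (Var 10) (Var 11))))).

(** Arrays 4 and 5 still hold the old plan, which decides both who is newly critical and which heads
    to avoid. Scalar 14, the round counter, and array 14 are unrelated. *)
Definition peel_cmd : cmd :=
  Defs.Seq (Vec 14 (And (Get 11 (Var 10)) (Not (Get 4 (Var 10)))))
    (For 14 0 (Defs.Seq roomy_cmd (Defs.Seq peelable_cmd (Defs.Seq reserve_cmd
       (Vec 14 (And (Get 14 (Var 10)) (Not (Get 15 (Var 10))))))))).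

(** * The phases that read and rebuild the plan *)

Section PlanPhases.
Local Open Scope nat_scope.
Variables (n W d : nat) (e : rel 'I_n).
Hypotheses (n_gt : 200 < n) (nW : 4 * (n * n) < W).

Let W_gt : 200 < W. Proof. by nia. Qed.
Let n_lt : n < W. Proof. by nia. Qed.
Let n_range : 0 < n < W. Proof. by rewrite n_lt andbT; lia. Qed.

Ltac ev :=
  match goal with
  | |- Defs.eval _ _ (And _ _) = _ => apply: (eval_and W_gt); ev
  | |- Defs.eval _ _ (Or _ _) = _ => apply: (eval_or W_gt); ev
  | |- Defs.eval _ _ (Not _) = _ => apply: (eval_not W_gt); ev
  | |- Defs.eval _ _ (Get _ (Idx _ _)) = _ =>
      apply: (eval_mat n_gt nW); [eassumption | assumption | assumption | assumption]
  | |- Defs.eval _ _ (Get _ _) = _ => apply: eval_vec; [eassumption | assumption]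
  | |- _ => idtac
  end.

Lemma runs_open s (U rho : rel 'I_n) (B Q : {set 'I_n}) :
  var s 0 = n -> var s 9 = n * n -> ismat s 0 e -> ismat s 2 U -> ismat s 3 rho ->
  isvec s 4 B -> isvec s 5 Q ->
  runs W open_cmd (200 * (n * n)) s (fun s' =>
    agree [:: 10; 11; 13] [:: 6] s s' /\ ismat s' 6 (open_arc e U B Q rho)).
Proof.
move=> s0 s9 he hU hr hB hQ.
apply: runs_weaken (runs_Mat n_gt nW (f := fun u v => open_arc e U B Q rho u v) s0 s9 _) _ _.
- move=> u v s' ag _ su sv sn.
  have {}he := agree_mat ag he isT; have {}hU := agree_mat ag hU isT.
  have {}hr := agree_mat ag hr isT.
  have {}hB := agree_vec ag hB isT; have {}hQ := agree_vec ag hQ isT.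
  have -> : open_arc e U B Q rho u v = e u v && (~~ U u v && (~~ U v u &&
    ((u \in B) && rho u v || ~~ (u \in B) && ~~ (v \in Q)))).
    by rewrite /open_arc; case: (u \in B); rewrite ?orbF.
  ev.
- by rewrite leq_mul2r orbC.
- by [].
Qed.

Hypothesis dn : d < n.

Lemma eval_thr s : var s 1 = d -> Defs.eval W s thr_expr = thr d.
Proof. by move=> s1; apply: eval_div; [exact: s1|exact: eval_cst|lia]. Qed.

Lemma eval_slk s : var s 1 = d -> Defs.eval W s slk_expr = slk d.
Proof. by move=> s1; apply: eval_div; [exact: s1|exact: eval_cst|lia]. Qed.

Lemma sum_bool_lt (P : pred 'I_n) : \sum_v (P v : nat) < W.
Proof.
rewrite sum_bool; apply: leq_ltn_trans (max_card _) _; rewrite card_ord; exact: n_lt.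
Qed.

Lemma runs_saturate s (U : rel 'I_n) (B : {set 'I_n}) :
  var s 0 = n -> var s 1 = d -> ismat s 0 e -> ismat s 2 U -> isvec s 11 B ->
  runs W saturate_cmd (200 * (n * n)) s (fun s' =>
    agree [:: 10; 11; 12] [:: 12] s s' /\ isvec s' 12 (saturated d e U B)).
Proof.
move=> s0 s1 he hU hB.
pose f (u v : 'I_n) : nat := U v u || (e v u && (v \in B)).
apply: runs_weaken (runs_MatVec n_gt nW (f := f) (h := fun u => u \in saturated d e U B) s0 _ _
    _) _ _.
- by move=> u; apply: (sum_bool_lt (fun v => U v u || (e v u && (v \in B)))).
- move=> u v s' ag su sv sn; rewrite /f.
  have {}he := agree_mat ag he isT; have {}hU := agree_mat ag hU isT.
  have {}hB := agree_vec ag hB isT; ev.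
- move=> u s' ag su sacc sn; rewrite inE leqNgt; apply: (eval_not W_gt).
  rewrite /load -sum_bool; apply: (eval_lt W_gt); first exact: sacc.
  by apply: eval_thr; apply: agree_var ag _ s1.
- by rewrite leq_mul2r orbC.
- by [].
Qed.

Lemma card_nbhd_cap u (S : {set 'I_n}) :
  \sum_v ((e u v && (v \in S)) : nat) = #|nbhd e u :&: S|.
Proof. by rewrite (sum_bool (fun v => e u v && (v \in S))); apply: eq_card => v; rewrite !inE. Qed.

Lemma runs_crit s (U : rel 'I_n) (B : {set 'I_n}) :
  var s 0 = n -> var s 1 = d -> ismat s 0 e -> isvec s 12 (saturated d e U B) ->
  runs W crit_cmd (200 * (n * n)) s (fun s' =>
    agree [:: 10; 11; 12] [:: 11] s s' /\ isvec s' 11 (crit_step d e U B)).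
Proof.
move=> s0 s1 he hS.
pose f (u v : 'I_n) : nat := e u v && (v \in saturated d e U B).
apply: runs_weaken (runs_MatVec n_gt nW (f := f) (h := fun u => u \in crit_step d e U B) s0 _ _
    _) _ _.
- by move=> u; apply: (sum_bool_lt (fun v => e u v && (v \in saturated d e U B))).
- move=> u v s' ag su sv sn; rewrite /f.
  have {}he := agree_mat ag he isT; have {}hS := agree_vec ag hS isT; ev.
- move=> u s' ag su sacc sn; rewrite inE; apply: (eval_lt W_gt).
    by apply: eval_slk; apply: agree_var ag _ s1.
  by rewrite -card_nbhd_cap; exact: sacc.
- by rewrite leq_mul2r orbC.
- by [].
Qed.

Lemma isvec0 s a : (forall v : 'I_n, arr s a v = 0) -> isvec s a (finset.set0 : {set 'I_n}).
Proof. by move=> h v; rewrite h inE. Qed.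

Lemma runs_critical s (U : rel 'I_n) :
  var s 0 = n -> var s 1 = d -> ismat s 0 e -> ismat s 2 U ->
  runs W critical_cmd (1000 * (n * n * n)) s (fun s' =>
    [/\ agree [:: 10; 11; 12; 14] [:: 11; 12] s s', isvec s' 11 (critical d e U) &
        isvec s' 12 (saturated d e U (critical d e U))]).
Proof.
move=> s0 s1 he hU.
pose Inv j s' := agree [:: 10; 11; 12; 14] [:: 11; 12] s s' /\
  isvec s' 11 (iter j (crit_step d e U) finset.set0).
apply: (@runs_weaken _ _ ((1 + 20) * n + ((200 * (n * n) + 200 * (n * n) + 16) * n + 200 * (n *
    n)))); last first.
- by move=> s' h; exact: h.
- have : n <= n * n by nia.
  by move: (n * n) => m nm; nia.
apply: runs_seq; apply: runs_weaken (runs_Vec n_gt nW (f := fun=> 0) s0 _) (leqnn _) _.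
  by move=> *; exact: eval_cst.
move=> s2 [ag2 h2].
have h1 : runs W (For 14 0 (Defs.Seq saturate_cmd crit_cmd))
    ((200 * (n * n) + 200 * (n * n) + 16) * n) s2 (fun s' => Inv n s' /\ var s' 14 = n).
  apply: (runs_for W_gt n_range) => //.
  + by case: ag2 => ->.
  + split; last by apply: isvec0.
    by apply: agree_setv => //; apply: agree_ext (agree_refl _ _ _) ag2 _ _.
  move=> j s3 jn [ag3 h3] _ s30.
  have s31 : var s3 1 = d by case: ag3 => ->.
  have he3 := agree_mat ag3 he isT; have hU3 := agree_mat ag3 hU isT.
  apply: runs_seq; apply: runs_weaken (runs_saturate s30 s31 he3 hU3 h3) (leqnn _) _.
  move=> s4 [ag4 h4].
  have s40 : var s4 0 = n by case: ag4 => ->.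
  have s41 : var s4 1 = d by case: ag4 => ->.
  apply: runs_weaken (runs_crit s40 s41 (agree_mat ag4 he3 isT) h4) (leqnn _) _.
  move=> s5 [ag5 h5]; split; last by move=> v; rewrite /= h5.
  have ag34 := agree_ext ag3 ag4 isT isT.
  by apply: agree_setv; first exact: agree_ext ag34 ag5 isT isT.
apply: runs_seq; apply: runs_weaken h1 (leqnn _) _ => s3 [[ag3 h3] _].
have s30 : var s3 0 = n by case: ag3 => ->.
have s31 : var s3 1 = d by case: ag3 => ->.
apply: runs_weaken (runs_saturate s30 s31 (agree_mat ag3 he isT) (agree_mat ag3 hU isT) h3)
    (leqnn _) _.
move=> s4 [ag4 h4]; split=> //; first exact: agree_ext ag3 ag4 isT isT.
exact: agree_vec ag4 h3 isT.
Qed.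

Hypothesis sym_e : symmetric e.

Lemma runs_peel s (rho : rel 'I_n) (B B' Q : {set 'I_n}) :
  var s 0 = n -> var s 1 = d -> var s 9 = n * n -> ismat s 0 e -> ismat s 3 rho ->
  isvec s 4 B -> isvec s 5 Q -> isvec s 11 B' ->
  (forall (X : {set 'I_n}) j, X \subset B' :\: B -> #|X| <= n - j ->
     #|X :\: peelable d e Q X| <= n - j.+1) ->
  runs W peel_cmd (2000 * (n * n * n)) s (fun s' =>
    agree [:: 10; 11; 12; 13; 14] [:: 3; 13; 14; 15] s s' /\
    exists2 rho' : rel 'I_n, ismat s' 3 rho' &
      peel_inv d e Q (B' :\: B) rho finset.set0 rho').
Proof.
move=> s0 s1 s9 he hr hB hQ hB' shrink.
pose vs := [:: 10; 11; 12; 13; 14]; pose als := [:: 3; 13; 14; 15].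
pose Inv j s' := agree vs als s s' /\ exists X rho',
  [/\ isvec s' 14 X, ismat s' 3 rho', peel_inv d e Q (B' :\: B) rho X rho' & #|X| <= n - j].
apply: (@runs_weaken _ _ ((50 + 20) * n + (((200 * (n * n) + (200 * (n * n) + (200 * (n * n) +
    100 * n))) + 16) * n))
   _ _ (fun s' => Inv n s' /\ var s' 14 = n)); last first.
- move=> s' [[ag [X [r [_ hr' pi Xn]]]] _]; move: Xn; rewrite subnn leqn0 cards_eq0 => /eqP X0.
  by split=> //; exists r => //; rewrite -X0.
- have : n <= n * n by nia.
  by move: (n * n) => m nm; nia.
apply: runs_seq; apply: runs_weaken (runs_Vec n_gt nW (f := fun v => (v \in B') && ~~ (v \in B))
    s0 _) _ _.
- move=> v s' ag _ sv sn.
  by have {}hB := agree_vec ag hB isT; have {}hB' := agree_vec ag hB' isT; ev.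
- by rewrite leq_mul2r orbC.
move=> s2 [ag2 h2].
apply: (runs_for W_gt n_range) => //.
- by case: ag2 => ->.
- split.
    by apply: agree_setv => //; apply: agree_ext (agree_refl _ _ _) ag2 _ _.
  exists (B' :\: B), rho; split.
  + by move=> v; rewrite /= h2 !inE andbC.
  + exact: agree_mat ag2 hr isT.
  + exact: peel_inv0.
  + by rewrite subn0 -[X in _ <= X](card_ord n); apply: max_card.
move=> j s3 jn [ag3 [X [r [hX3 hr3 pi Xj]]]] _ s30.
have s31 : var s3 1 = d by case: ag3 => ->.
have s39 : var s3 9 = n * n by case: ag3 => ->.
have he3 := agree_mat ag3 he isT; have hQ3 := agree_vec ag3 hQ isT.
apply: runs_seq.
pose f3 (u v : 'I_n) : nat := e u v && (v \in X).
apply: runs_weaken (runs_MatVec n_gt nW (f := f3) (h := fun u => u \in roomy d e Q X) s30 _ _ _)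
    _ _.
- by move=> u; apply: (sum_bool_lt (fun v => e u v && (v \in X))).
- move=> u v s' ag su sv sn; rewrite /f3.
  by have {}he3 := agree_mat ag he3 isT; have {}hX3 := agree_vec ag hX3 isT; ev.
- move=> u s' ag su sacc sn; rewrite inE leqNgt.
  have {}hQ3 := agree_vec ag hQ3 isT; ev; apply: (eval_lt W_gt).
    by apply: eval_thr; apply: agree_var ag _ s31.
  by rewrite -card_nbhd_cap; exact: sacc.
- by rewrite leq_mul2r orbC.
move=> s4 [ag4 h4].
have s40 : var s4 0 = n by case: ag4 => ->.
have s41 : var s4 1 = d by case: ag4 => ->.
have s49 : var s4 9 = n * n by case: ag4 => ->.
have he4 := agree_mat ag4 he3 isT; have hX4 := agree_vec ag4 hX3 isT.
have hr4 := agree_mat ag4 hr3 isT.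
apply: runs_seq.
pose f4 (u v : 'I_n) : nat := e u v && (v \in roomy d e Q X).
apply: runs_weaken (runs_MatVec n_gt nW (f := f4) (h := fun u => u \in peelable d e Q X) s40 _ _
    _) _ _.
- by move=> u; apply: (sum_bool_lt (fun v => e u v && (v \in roomy d e Q X))).
- move=> u v s' ag su sv sn; rewrite /f4.
  have {}he4 := agree_mat ag he4 isT; have {}h4 := agree_vec ag h4 isT; ev.
- move=> u s' ag su sacc sn; rewrite inE leqNgt.
  have {}hX4 := agree_vec ag hX4 isT; ev; apply: (eval_lt W_gt).
    by rewrite -card_nbhd_cap; exact: sacc.
  have s'1 : var s' 1 = d by apply: agree_var ag _ s41.
  apply: eval_sub; [exact: s'1| |lia].
  apply: eval_mul; [exact: eval_cst|exact: eval_slk|rewrite /slk; lia].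
- by rewrite leq_mul2r orbC.
move=> s5 [ag5 h5].
have s50 : var s5 0 = n by case: ag5 => ->.
have s59 : var s5 9 = n * n by case: ag5 => ->.
have he5 := agree_mat ag5 he4 isT; have hX5 := agree_vec ag5 hX4 isT.
have hr5 := agree_mat ag5 hr4 isT; have h45 := agree_vec ag5 h4 isT.
apply: runs_seq.
apply: runs_weaken (runs_Mat n_gt nW (f := fun u v => peel_res d e Q X r u v) s50 s59 _) _ _.
- move=> u v s' ag own su sv sn.
  have {}he5 := agree_mat ag he5 isT; have {}h5 := agree_vec ag h5 isT.
  have {}h45 := agree_vec ag h45 isT.
  have -> : peel_res d e Q X r u v =
     (u \in peelable d e Q X) && (e u v && (v \in roomy d e Q X))
       || ~~ (u \in peelable d e Q X) && r u v.
    by rewrite /peel_res; case: (u \in peelable _ _ _ _); rewrite ?orbF.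
  (* Array 3 is being overwritten; [own] ensures that the current entry still holds the old
     value. *)
  ev; apply: eval_get; first by apply: (eval_idx n_gt nW sn); [exact: su|exact: sv].
  by rewrite own hr5.
- by rewrite leq_mul2r orbC.
move=> s6 [ag6 h6].
have s60 : var s6 0 = n by case: ag6 => ->.
have hX6 := agree_vec ag6 hX5 isT; have h56 := agree_vec ag6 h5 isT.
apply: runs_weaken (runs_Vec n_gt nW (f := fun v => (v \in X) && ~~ (v \in peelable d e Q X))
    s60 _) _ _.
- move=> v s' ag own sv sn; have {}h56 := agree_vec ag h56 isT.
  by ev; apply: eval_get; [exact: sv|rewrite own hX6].
- by rewrite leq_mul2r orbC.
move=> s7 [ag7 h7]; split.
  have ag34 := agree_ext ag3 ag4 isT isT; have ag35 := agree_ext ag34 ag5 isT isT.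
  have ag36 := agree_ext ag35 ag6 isT isT.
  by apply: agree_setv; first exact: agree_ext ag36 ag7 isT isT.
exists (X :\: peelable d e Q X), (peel_res d e Q X r); split.
- by move=> v; rewrite /= h7 !inE andbC.
- by move=> u v; rewrite -h6; case: ag7 => _ /(_ 3 isT) /= ->.
- exact: peel_inv_step.
- by case: pi => sX _ _ _; apply: shrink.
Qed.

End PlanPhases.

(* [D] holds 1 + the distance to [src], and 0 at the vertices not reached. *)
Definition bfs_cmd (D P src : nat) : cmd :=
  Defs.Seq (Vec D (Cst 0))
  (Defs.Seq (Put D (Var src) (Cst 1))
    (For 14 0 (ForMat
      (If (And (Get 6 (Var 13))
             (And (Bin OpEq (Get D (Var 10)) (Bin OpAdd (Var 14) (Cst 1)))
                  (Bin OpEq (Get D (Var 11)) (Cst 0))))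
          (Defs.Seq (Put D (Var 11) (Bin OpAdd (Var 14) (Cst 2)))
                    (Put P (Var 11) (Var 10)))
          Skip)))).

Definition both_expr : expr := Bin OpAdd (Get 7 (Var 10)) (Get 9 (Var 10)).

(** The value [4 * n] acts as infinity: depths are at most [n + 2], so the sum of two is smaller. *)
Definition meet_cmd : cmd :=
  Defs.Seq (Assign 21 (Bin OpMul (Cst 4) (Var 0)))
    (For 10 0 (If (And (Bin OpLt (Cst 0) (Get 7 (Var 10)))
                  (And (Bin OpLt (Cst 0) (Get 9 (Var 10)))
                       (Bin OpLt both_expr (Var 21))))
       (Defs.Seq (Assign 21 both_expr) (Assign 20 (Var 10))) Skip)).

(** One walk both writes the answer and marks the arcs as used. The loop stops at the root, which
    the last [Put] records. *)
Definition climb_cmd (D P : nat) (pos : expr) : cmd :=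
  Defs.Seq (Assign 22 (Var 20))
  (Defs.Seq
    (While (Bin OpLt (Cst 1) (Get D (Var 22)))
      (Defs.Seq (Assign 23 (Get P (Var 22)))
      (Defs.Seq (Put 1 pos (Var 22))
      (Defs.Seq (Put 2 (Idx (Var 23) (Var 22)) (Cst 1))
                (Assign 22 (Var 23))))))
    (Put 1 pos (Var 22))).

(** * The phases that search and trace back *)

Section SearchPhases.
Local Open Scope nat_scope.
Variables (n W : nat).
Hypotheses (n_gt : 200 < n) (nW : 4 * (n * n) < W).

Let W_gt : 200 < W. Proof. by nia. Qed.
Let n_lt : 4 * n < W. Proof. by nia. Qed.
Let n_range : 0 < n < W. Proof. by lia. Qed.

(** The state within a round: level [k.+1] is being expanded and the pairs of index below [i] have
    been scanned. Newly reached vertices get [k.+2], so they are not expanded in the same round. *)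
Definition bfs_inv (H : rel 'I_n) (a : 'I_n) (k i : nat) (D : 'I_n -> nat)
    (par : 'I_n -> 'I_n) : Prop :=
  [/\ search_tree H a D par, forall v, D v <= k.+2,
      forall x y, H x y -> 0 < D x <= k -> 0 < D y <= (D x).+1 &
      forall x y : 'I_n, H x y -> D x = k.+1 -> x * n + y < i -> 0 < D y].

Lemma bfs_inv_step H a k D par (x y : 'I_n) :
  bfs_inv H a k (x * n + y) D par ->
  let b := [&& H x y, D x == k.+1 & D y == 0] in
  bfs_inv H a k (x * n + y).+1 (fun v => if b && (v == y) then k.+2 else D v)
    (fun v => if b && (v == y) then x else par v).
Proof.
move=> [[t1 t2 t3] b1 b2 b3]; cbv zeta.
case: and3P => [[Hxy /eqP Dx /eqP Dy]|nb] /=; last first.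
  split=> // x' y' Hx' Dx'; rewrite ltnS leq_eqVlt => /orP [/eqP e|]; last exact: b3.
  case: (mat_index_inj e) => ex ey; rewrite ex ey in Hx' Dx' *.
  by rewrite lt0n; apply/negP => D0; apply: nb; split=> //; rewrite Dx'.
have ne v : D v != 0 -> (v == y) = false by move=> Dv; apply/eqP => e; rewrite e Dy in Dv.
split.
- split.
  + by rewrite ne ?t1.
  + by move=> v; case: eqP => [_ //|_]; apply: t2.
  + move=> v; case: (eqVneq v y) => [-> _|vy Dv]; first by rewrite ne ?Dx.
    case: (t3 v Dv) => h1 h2; split=> //; rewrite ne h2 //; lia.
- by move=> v; case: ifP.
- move=> x' y' Hx'; case: (eqVneq x' y) => [_|x'y]; first by move=> /andP [_]; lia.
  move=> Dx'; have := b2 _ _ Hx' Dx'; case: (eqVneq y' y) => [->|//].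
  by rewrite Dy.
- move=> x' y' Hx'; case: (eqVneq x' y) => [_ /eqP|x'y Dx'].
    by rewrite eqSS gtn_eqF.
  case: (eqVneq y' y) => [//|y'y]; rewrite ltnS leq_eqVlt => /orP [/eqP e|]; last exact: b3.
  by case: (mat_index_inj e) => _ ey; rewrite ey eqxx in y'y.
Qed.

Lemma bfs_inv_next H a k i D par : bfs_inv H a k i D par -> n * n <= i ->
  bfs_inv H a k.+1 0 D par.
Proof.
move=> [t b1 b2 b3] ni; split=> //; first by move=> v; apply: leqW.
move=> x y Hxy /andP [x0]; rewrite leq_eqVlt => /orP [/eqP Dx|xk].
  have h := b3 x y Hxy Dx (leq_trans (mat_index_lt x y) ni).
  by rewrite h Dx; exact: b1.
by apply: b2 => //; rewrite x0.
Qed.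

Lemma runs_bfs D P src s (H : rel 'I_n) (a : 'I_n) :
  D != P -> D != 6 -> P != 6 -> src \notin [:: 10; 11; 13; 14] ->
  var s 0 = n -> var s 9 = n * n -> var s src = a -> ismat s 6 H ->
  runs W (bfs_cmd D P src) (1000 * (n * n * n)) s (fun s' =>
    [/\ agree [:: 10; 11; 13; 14] [:: D; P] s s', forall v : 'I_n, arr s' D v <= n.+2 &
      exists2 par : 'I_n -> 'I_n,
        search H a (fun v => arr s' D v) par &
        forall v : 'I_n, 1 < arr s' D v -> arr s' P v = par v]).
Proof.
move=> DP D6 P6 srcn s0 s9 sa hH.
pose vs := [:: 10; 11; 13; 14]; pose als := [:: D; P].
pose J k i s' := [/\ agree vs als s s', var s' 14 = k & exists par : 'I_n -> 'I_n,
  bfs_inv H a k i (fun v => arr s' D v) par /\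
  forall v : 'I_n, 1 < arr s' D v -> arr s' P v = par v].
pose Inv k s' := J k 0 s'.
apply: (@runs_weaken _ _ (21 * n + (3 + ((60 + 30) * (n * n) + 16) * n)) _ _ (fun s' => Inv n s'
    /\ var s' 14 = n)); last first.
- move=> s' [[ag _ [par [[t b1 b2 _] hP]]] _]; split=> //.
  exists par => //; split=> // x y Hxy /b2; exact.
- have : n <= n * n by nia.
  by move: (n * n) => m nm; nia.
apply: runs_seq; apply: runs_weaken (runs_Vec n_gt nW (f := fun=> 0) s0 _) (leqnn _) _.
  by move=> *; exact: eval_cst.
move=> s2 [ag2 h2].
have s20 : var s2 0 = n by case: ag2 => ->.
have s29 : var s2 9 = n * n by case: ag2 => ->.
have s2a : var s2 src = a by case: ag2 => ->; rewrite ?inE //; apply: contra srcn => /eqP ->.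
have hH2 : ismat s2 6 H by apply: agree_mat ag2 hH _; rewrite inE eq_sym.
apply: runs_seq; apply: runs_put; rewrite [Defs.eval W s2 _]/= s2a (eval_cst W_gt) //.
set s3 := set_arr _ _ _ _.
have ag3 : agree vs als s s3.
  apply: agree_seta; last by rewrite inE eqxx.
  by apply: agree_ext (agree_refl _ _ _) ag2 _ _; rewrite //= inE eqxx.
have h3 (v : 'I_n) : arr s3 D v = (v == a) by rewrite /= /upd eqxx h2; case: eqP => [/val_inj
    ->|ne]; rewrite ?eqxx //; case: eqP => // e; rewrite e in ne.
apply: (runs_for W_gt n_range) => //.
  split=> //; first by apply: agree_setv.
  (* No depth exceeds 1 yet, so any parent function will do. Array [P] may hold leftovers of earlier
     requests. *)
  exists id; split; last by move=> v; rewrite -[arr _ D v]/(arr s3 D v) h3; case: eqP.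
  split=> //; try by move=> *; rewrite -[arr _ D _]/(arr s3 D _) h3; case: eqP.
  split.
  + by rewrite -[arr _ D _]/(arr s3 D _) h3 eqxx.
  + by move=> v; rewrite -[arr _ D _]/(arr s3 D _) h3; case: eqP.
  + by move=> v; rewrite -[arr _ D _]/(arr s3 D _) h3; case: eqP.
  + by move=> x y _; rewrite -![arr _ D _]/(arr s3 D _) !h3; case: eqP.
move=> k s4 kn [ag4 s4k J4] _ s40.
have s49 : var s4 9 = n * n by case: ag4 => ->.
have h4 : runs W (ForMat
      (If (And (Get 6 (Var 13))
             (And (Bin OpEq (Get D (Var 10)) (Bin OpAdd (Var 14) (Cst 1)))
                  (Bin OpEq (Get D (Var 11)) (Cst 0))))
          (Defs.Seq (Put D (Var 11) (Bin OpAdd (Var 14) (Cst 2)))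
                    (Put P (Var 11) (Var 10)))
          Skip)) ((60 + 30) * (n * n)) s4 (J k (n * n)).
  apply: (runs_ForMat n_gt nW) => //.
  + move=> s5 s6 i ag [ag5 s5k [par [b5 p5]]].
    have E : arr s6 = arr s5 by apply/funext => x; case: ag => _ ->.
    split; [exact: agree_ext ag5 ag isT isT|by case: ag => ->|].
    by exists par; rewrite E.
  move=> u v s5 [ag5 s5k [par [b5 p5]]] su sv si sn.
  have hH5 : ismat s5 6 H by apply: agree_mat ag5 hH _; rewrite !inE negb_or eq_sym D6 eq_sym.
  pose b := [&& H u v, arr s5 D u == k.+1 & arr s5 D v == 0].
  have bE : Defs.eval W s5 (And (Get 6 (Var 13))
             (And (Bin OpEq (Get D (Var 10)) (Bin OpAdd (Var 14) (Cst 1)))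
                  (Bin OpEq (Get D (Var 11)) (Cst 0)))) = b.
    apply: (eval_and W_gt); first by apply: eval_get; [exact: si|exact: hH5].
    apply: (eval_and W_gt); apply: (eval_eq W_gt).
    * by apply: eval_get; [exact: su|].
    * rewrite -[k.+1]addn1; apply: eval_add; [exact: s5k|exact: eval_cst|lia].
    * by apply: eval_get; [exact: sv|].
    * exact: eval_cst.
  have st := bfs_inv_step b5; rewrite -/b in st.
  apply: (@runs_weaken _ _ (14 + 10).+1 _ _ (J k (u * n + v).+1)) => //.
  apply: runs_if; rewrite bE; case: b st {bE} => /= st; last first.
    apply: (@runs_weaken _ _ 1 _ _ (J k (u * n + v).+1)) => //; apply: runs_skip.
    by split=> //; exists par.
  apply: (@runs_weaken _ _ (5 + 3) _ _ (J k (u * n + v).+1)) => //.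
  apply: runs_seq; apply: runs_put; rewrite [Defs.eval W s5 (Var 11)]/= sv.
  rewrite (@eval_add W s5 _ _ k 2) //; [|exact: eval_cst|lia].
  set s6 := set_arr _ _ _ _.
  apply: runs_put; rewrite /= sv su.
  split=> //.
    apply: agree_seta; last by rewrite !inE eqxx orbT.
    by apply: agree_seta => //; rewrite inE eqxx.
  have PD : (P == D) = false by rewrite eq_sym; apply/negbTE.
  exists (fun y => if y == v then u else par y); split.
    have -> : (fun y : 'I_n => arr (set_arr s6 P v u) D y) =
              (fun y : 'I_n => if y == v then k.+2 else arr s5 D y).
      apply/funext => y; rewrite /= /upd (negbTE DP) eqxx addn2.
      by case: (eqVneq y v) => [->|yv]; rewrite ?eqxx // ifN //; apply: contra yv =>
          /eqP/val_inj ->.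
    exact: st.
  move=> y; rewrite /= /upd eqxx (negbTE DP) eqxx PD.
  case: (eqVneq y v) => [->|yv]; first by rewrite eqxx.
  have -> : (nat_of_ord y == v) = false by apply/negbTE; apply: contra yv => /eqP/val_inj ->.
  exact: p5.
apply: runs_weaken h4 _ _; first by [].
move=> s5 [ag5 s5k [par [b5 p5]]]; split=> //; first exact: agree_setv.
by exists par; split=> //; apply: bfs_inv_next b5 _.
Qed.

Lemma runs_meet s :
  var s 0 = n -> (forall v : 'I_n, arr s 7 v <= n.+2) -> (forall v : 'I_n, arr s 9 v <= n.+2) ->
  (exists w : 'I_n, 0 < arr s 7 w /\ 0 < arr s 9 w) ->
  runs W meet_cmd (100 * n) s (fun s' =>
    agree [:: 10; 20; 21] [::] s s' /\ exists w : 'I_n,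
    [/\ var s' 20 = w, 0 < arr s 7 w, 0 < arr s 9 w &
        forall v : 'I_n, 0 < arr s 7 v -> 0 < arr s 9 v ->
          arr s 7 w + arr s 9 w <= arr s 7 v + arr s 9 v]).
Proof.
move=> s0 ha hb [w0 [wa0 wb0]].
pose Inv j s' := [/\ agree [:: 10; 20; 21] [::] s s',
  forall v : 'I_n, v < j -> 0 < arr s 7 v -> 0 < arr s 9 v -> var s' 21 <= arr s 7 v + arr s 9 v &
  var s' 21 = 4 * n \/ exists w : 'I_n, [/\ var s' 20 = w, 0 < arr s 7 w, 0 < arr s 9 w &
     var s' 21 = arr s 7 w + arr s 9 w]].
apply: (@runs_weaken _ _ (4 + (60 + 16) * n) _ _ (fun s' => Inv n s' /\ var s' 10 = n)); last first.
- move=> s' [[ag mn [e|[w [h1 h2 h3 h4]]]] _]; split=> //.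
    have := mn w0 (ltn_ord w0) wa0 wb0; have := ha w0; have := hb w0; rewrite e; lia.
  by exists w; split=> // v va vb; rewrite -h4; apply: mn.
- by lia.
apply: runs_seq; apply: runs_assign; rewrite (@eval_mul W s _ _ 4 n) //; last exact: eval_cst.
apply: (runs_for W_gt n_range) => //.
  split=> //; last by left.
  by apply: agree_setv => //; apply: agree_setv.
move=> j s1 jn [ag mn opt] sj s10; pose v := Ordinal jn.
have arE : arr s1 = arr s by apply/funext => x; case: ag => _ ->.
have bE : Defs.eval W s1 both_expr = arr s 7 v + arr s 9 v.
  apply: eval_add; try by apply: eval_get; [exact: sj|rewrite arE].
  by have := ha v; have := hb v; lia.
have cE : Defs.eval W s1 (And (Bin OpLt (Cst 0) (Get 7 (Var 10)))
                  (And (Bin OpLt (Cst 0) (Get 9 (Var 10)))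
                       (Bin OpLt both_expr (Var 21)))) =
   [&& 0 < arr s 7 v, 0 < arr s 9 v & arr s 7 v + arr s 9 v < var s1 21].
  apply: (eval_and W_gt); first by apply: (eval_lt W_gt); [exact: eval_cst|apply: eval_get;
      [exact: sj|rewrite arE]].
  apply: (eval_and W_gt); first by apply: (eval_lt W_gt); [exact: eval_cst|apply: eval_get;
      [exact: sj|rewrite arE]].
  by apply: (eval_lt W_gt).
apply: (@runs_weaken _ _ (17 + 20).+1 _ _ (fun s' => Inv j.+1 (set_var s' 10 j.+1))) => //.
apply: runs_if; rewrite cE; case: and3P => [[va vb lt]|nb] /=; last first.
  apply: (@runs_weaken _ _ 1 _ _ (fun s' => Inv j.+1 (set_var s' 10 j.+1))) => //; apply: runs_skip.
  split=> //; first exact: agree_setv.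
  move=> v'; rewrite ltnS leq_eqVlt => /orP [/eqP e va vb|]; last exact: mn.
  have vv : v' = v by apply: val_inj.
  by rewrite vv in va vb *; rewrite leqNgt; apply/negP => h; apply: nb.
apply: (@runs_weaken _ _ (6 + 2) _ _ (fun s' => Inv j.+1 (set_var s' 10 j.+1))) => //.
apply: runs_seq; apply: runs_assign; rewrite bE; apply: runs_assign.
split.
- by do 3 (apply: agree_setv => //).
- move=> v'; rewrite /= /upd /= ltnS leq_eqVlt => /orP [/eqP e va' vb'|lt' va' vb'].
    by have -> : v' = v by apply: val_inj.
  by apply: leq_trans (ltnW lt) _; apply: mn.
- by right; exists v; rewrite /= /upd /= sj.
Qed.

(** [pf] turns a depth into a position of the answer, and its injectivity keeps the writes apart.
    The last clause lets the second climb preserve what the first one wrote. *)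
Lemma runs_climb D P pos (pf : nat -> nat) s (H U : rel 'I_n) (a w : 'I_n)
    (par : 'I_n -> 'I_n) :
  D \notin [:: 1; 2] -> P \notin [:: 1; 2] -> cost pos <= 20 ->
  var s 0 = n -> var s 20 = w -> search_tree H a (fun v => arr s D v) par ->
  (forall v : 'I_n, 1 < arr s D v -> arr s P v = par v) ->
  0 < arr s D w <= n.+2 -> ismat s 2 U ->
  (forall s' (v : 'I_n), agree [:: 22; 23] [:: 1; 2] s s' -> var s' 22 = v ->
     0 < arr s D v <= arr s D w -> Defs.eval W s' pos = pf (arr s D v)) ->
  (forall i j, 0 < i <= arr s D w -> 0 < j <= arr s D w -> pf i = pf j -> i = j) ->
  runs W (climb_cmd D P pos) (200 * n) s (fun s' =>
    [/\ agree [:: 22; 23] [:: 1; 2] s s',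
        ismat s' 2 (fun x y => U x y || ((x, y) \in climb par w (arr s D w).-1)),
        forall t, t < arr s D w -> arr s' 1 (pf (arr s D w - t)) = iter t par w &
        forall i, (forall t, t < arr s D w -> i <> pf (arr s D w - t)) -> arr s' 1 i = arr s 1 i]).
Proof.
move=> D12 P12 cpos s0 sw T hP /andP [Dw Dn] hU hpos pinj.
have D12' : D \notin [:: 1; 2] by [].
move: D12; rewrite !inE negb_or => /andP [D1 D2].
move: P12; rewrite !inE negb_or => /andP [P1 P2].
set m := arr s D w in Dw Dn hpos pinj *.
have dist t : t < m -> arr s D (iter t par w) = m - t by exact: (climb_dist T).
pose K t s' := [/\ agree [:: 22; 23] [:: 1; 2] s s', var s' 22 = iter t par w,
  ismat s' 2 (fun x y => U x y || ((x, y) \in climb par w t)),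
  forall t', t' < t -> arr s' 1 (pf (m - t')) = iter t' par w &
  forall i, (forall t', t' < t -> i <> pf (m - t')) -> arr s' 1 i = arr s 1 i].
pose Inv j s' := j < m /\ K (m.-1 - j) s'.
(* Shared by the loop body and the final [Put] at the root. *)
have put t s' : t < m -> K t s' ->
  (forall t', t' < t.+1 -> arr (set_arr s' 1 (pf (m - t)) (iter t par w)) 1 (pf (m - t')) = iter
      t' par w) /\
  (forall i, (forall t', t' < t.+1 -> i <> pf (m - t')) ->
     arr (set_arr s' 1 (pf (m - t)) (iter t par w)) 1 i = arr s 1 i).
  move=> tm [_ _ _ k4 k5]; split=> [t'|i hi]; rewrite /= /upd /=.
    rewrite ltnS leq_eqVlt => /orP [/eqP ->|t't]; first by rewrite eqxx.
    by case: eqP => [/pinj e|_]; [have := e _ _; lia|exact: k4].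
  case: eqP => [e|_]; first by case: (hi t).
  by apply: k5 => t' t't; apply: hi; apply: ltnW.
have pos_at t s' : t < m -> K t s' -> Defs.eval W s' pos = pf (m - t).
  move=> tm [k1 k2 _ _ _]; rewrite -dist //; apply: hpos => //; rewrite dist //; lia.
apply: (@runs_weaken _ _ (2 + ((5 + m.-1 * (4 + 60).+1) + 22)) _ _ (fun s' =>
    [/\ agree [:: 22; 23] [:: 1; 2] s s',
        ismat s' 2 (fun x y => U x y || ((x, y) \in climb par w m.-1)),
        forall t, t < m -> arr s' 1 (pf (m - t)) = iter t par w &
        forall i, (forall t, t < m -> i <> pf (m - t)) -> arr s' 1 i = arr s 1 i])) => //; last
            first.
  by move: Dn; lia.
apply: runs_seq; apply: runs_assign; rewrite [Defs.eval W s _]/= sw.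
set s1 := set_var _ _ _.
have I1 : Inv m.-1 s1.
  split; first by lia.
  rewrite subnn; split=> //; first exact: agree_set_var.
  move=> x y; rewrite -[arr s1]/(arr s) hU; congr (nat_of_bool _).
  by case: climbP => [[]|_] //; rewrite orbF.
apply: runs_seq.
apply: runs_weaken (runs_while (tb := 60) (Inv := Inv) _ _ I1) _ _ => //.
- move=> s2 [_ [k1 k2 _ _ _]]; rewrite (@eval_lt _ W_gt s2 _ _ 1 1) ?ltnn //.
    exact: eval_cst.
  apply: eval_get; first exact: k2.
  by case: k1 => _ ->; rewrite // dist; lia.
- move=> j s2 [jm k]; set t := m.-1 - j.+1 in k.
  have tm : t.+1 < m by rewrite /t; lia.
  have tj : m.-1 - j = t.+1 by rewrite /t; lia.
  have [k1 k2 k3 k4 k5] := k.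
  have s2D : arr s2 D (iter t par w) = m - t by case: k1 => _ ->; rewrite // dist //; lia.
  have s2P : arr s2 P (iter t par w) = iter t.+1 par w.
    by case: k1 => _ ->; [rewrite hP // dist; lia|rewrite !inE negb_or P1].
  split.
    rewrite (@eval_lt _ W_gt s2 _ _ 1 (m - t)); first by have -> : 1 < m - t by lia.
      exact: eval_cst.
    by apply: eval_get; first exact: k2.
  apply: (@runs_weaken _ _ (3 + (22 + (7 + 2))) _ _ (Inv j)) => //.
  apply: runs_seq; apply: runs_assign.
  have -> : Defs.eval W s2 (Get P (Var 22)) = iter t.+1 par w by rewrite /= k2.
  set s3 := set_var _ _ _.
  have K3 : K t s3 by split=> //; apply: agree_setv.
  apply: runs_seq.
  apply: runs_weaken (runs_put _) _ (fun s h => h); last by rewrite /=; lia.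
  rewrite (pos_at t s3) //; last by lia.
  have -> : Defs.eval W s3 (Var 22) = iter t par w by rewrite /= /upd /= k2.
  set s4 := set_arr _ _ _ _.
  have ag4 : agree [:: 22; 23] [:: 1; 2] s s4 by apply: agree_seta => //; case: K3.
  apply: runs_seq; apply: runs_put.
  have -> : Defs.eval W s4 (Idx (Var 23) (Var 22)) = (iter t.+1 par w) * n + iter t par w.
    by apply: (eval_idx n_gt nW) => //; case: ag4 => ->.
  rewrite (eval_cst W_gt) //; apply: runs_assign; split; first by lia.
  rewrite tj; have [p1 p2] := put t s3 (ltnW tm) K3.
  split=> //.
  + by apply: agree_setv => //; apply: agree_seta.
  + move=> x y; rewrite climbS orbA.
    transitivity (if x * n + y == iter t.+1 par w * n + iter t par w then 1
                  else arr s2 2 (x * n + y)); first by [].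
    case: (x * n + y =P _) => [/mat_index_inj [-> ->]|ne]; first by rewrite !eqxx orbT.
    suff xyF : (x == iter t.+1 par w) && (y == iter t par w) = false by rewrite k3 xyF orbF.
    by apply/negP => /andP [/eqP ex /eqP ey]; apply: ne; rewrite ex ey.
move=> s2 [_ k]; rewrite subn0 in k; have [k1 k2 k3 k4 k5] := k.
have mm : m.-1 < m by lia.
apply: runs_weaken (runs_put _) _ (fun s h => h); last by rewrite /=; lia.
rewrite (pos_at m.-1 s2) // [Defs.eval W s2 _]/= k2.
have [p1 p2] := put m.-1 s2 mm k; rewrite prednK // in p1 p2.
by split=> //; apply: agree_seta.
Qed.

End SearchPhases.

(** The orientation of the path is not stored, so both arcs of every edge are erased. The loop runs
    over vertices because [runs_for] wants a positive bound and a one-vertex path has no edges. *)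
Definition remove_cmd : cmd :=
  For 10 6 (If (Bin OpLt (Bin OpAdd (Var 10) (Cst 1)) (Var 6))
    (Defs.Seq (Assign 22 (Get 1 (Var 10)))
    (Defs.Seq (Assign 23 (Get 1 (Bin OpAdd (Var 10) (Cst 1))))
    (Defs.Seq (Put 2 (Idx (Var 22) (Var 23)) (Cst 0))
              (Put 2 (Idx (Var 23) (Var 22)) (Cst 0)))))
    Skip).

(** Variable 6 gets the number m of vertices. Depth i goes to position i - 1 in the first climb and
    m - i in the second; both put the meeting vertex at the same place. *)
Definition route_cmd : cmd :=
  Defs.Seq (Assign 6 (Bin OpSub (Bin OpAdd (Get 7 (Var 20)) (Get 9 (Var 20))) (Cst 1)))
  (Defs.Seq (climb_cmd 7 8 (Bin OpSub (Get 7 (Var 22)) (Cst 1)))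
            (climb_cmd 9 10 (Bin OpSub (Var 6) (Get 9 (Var 22))))).

Definition find_cmd : cmd :=
  Defs.Seq (Assign 9 (Bin OpMul (Var 0) (Var 0)))
  (Defs.Seq open_cmd
  (Defs.Seq (bfs_cmd 7 8 4)
  (Defs.Seq (bfs_cmd 9 10 5)
  (Defs.Seq meet_cmd
  (Defs.Seq route_cmd
  (Defs.Seq critical_cmd
  (Defs.Seq peel_cmd
  (Defs.Seq (Vec 4 (Get 11 (Var 10))) (Vec 5 (Get 12 (Var 10))))))))))).

Definition router : cmd := If (Var 3) remove_cmd find_cmd.

(** * Erasing a path and recording a new one *)

Section Router.
Local Open Scope nat_scope.
Variables (n W : nat).
Hypotheses (n_gt : 200 < n) (nW : 4 * (n * n) < W).

Let W_gt : 200 < W. Proof. by nia. Qed.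
Let n_lt : 4 * n < W. Proof. by nia. Qed.
Let n_range : 0 < n < W. Proof. by lia. Qed.

Lemma nth_path_edges (p : seq 'I_n) x0 E0 i : i.+1 < size p ->
  nth E0 (path_edges p) i = [set nth x0 p i; nth x0 p i.+1].
Proof. by case: p => [//|x p] /= ip; rewrite (nth_pairmap x0). Qed.

Lemma size_path_edges (p : seq 'I_n) : size (path_edges p) = (size p).-1.
Proof. by case: p => [//|x p]; rewrite /= size_pairmap. Qed.

Lemma eq_set2 (x y a b : 'I_n) :
  ([set x; y] == [set a; b]) = (x == a) && (y == b) || (x == b) && (y == a).
Proof.
apply/eqP/orP => [E|[/andP [/eqP -> /eqP ->]|/andP [/eqP -> /eqP ->]]] //; last exact: finset.setUC.
have : (x \in [set a; b]) && (y \in [set a; b]) by rewrite -E !inE !eqxx orbT.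
have : (a \in [set x; y]) && (b \in [set x; y]) by rewrite E !inE !eqxx orbT.
rewrite !inE ![a == _]eq_sym ![b == _]eq_sym => /andP [X1 X2] /andP [X3 X4].
by move: X1 X2 X3 X4; case: (x == a); case: (x == b); case: (y == a); case: (y == b) => //= _ _
    _ _; auto.
Qed.

Lemma runs_remove s (p : seq 'I_n) (U : rel 'I_n) :
  var s 0 = n -> var s 6 = size p -> 0 < size p <= n ->
  (forall x0 i, i < size p -> arr s 1 i = nth x0 p i) -> ismat s 2 U ->
  runs W remove_cmd (100 * n) s (fun s' => agree [:: 10; 22; 23] [:: 2] s s' /\
    ismat s' 2 (fun x y => U x y && ([set x; y] \notin path_edges p))).
Proof.
move=> s0 s6 /andP [p0 pn] h1 hU.
pose Inv j s' := agree [:: 10; 22; 23] [:: 2] s s' /\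
  ismat s' 2 (fun x y => U x y && ([set x; y] \notin take j (path_edges p))).
apply: (@runs_weaken _ _ ((60 + 16) * size p) _ _ (fun s' => Inv (size p) s' /\ var s' 10 = size
    p)); last first.
- move=> s' [[ag h] _]; split=> //.
  by move: h; rewrite take_oversize // size_path_edges leq_pred.
- by apply: leq_mul => //; lia.
apply: (runs_for W_gt) => //; first by lia.
  split; first exact: agree_set_var.
  by move=> x y; rewrite /= take0 in_nil andbT; apply: hU.
move=> j s1 jp [ag hj] sj s16.
have ar1 : arr s1 1 = arr s 1 by case: ag => _ ->.
have s10 : var s1 0 = n by case: ag => ->.
have jE : Defs.eval W s1 (Bin OpAdd (Var 10) (Cst 1)) = j.+1.
  by rewrite -[j.+1]addn1; apply: eval_add; [exact: sj|exact: eval_cst|lia].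
apply: (@runs_weaken _ _ (5 + 40).+1 _ _ (fun s' => Inv j.+1 (set_var s' 10 j.+1))) => //.
apply: runs_if; rewrite (@eval_lt _ W_gt s1 _ _ j.+1 (size p)) //.
case: ltnP => [jp1|jp1] /=; last first.
  apply: (@runs_weaken _ _ 1 _ _ (fun s' => Inv j.+1 (set_var s' 10 j.+1))) => //; apply: runs_skip.
  split; first exact: agree_setv.
  move=> x y; rewrite -[LHS]/(arr s1 2 (x * n + y)) hj; congr (nat_of_bool (_ && (_ \notin _))).
  by rewrite !take_oversize // size_path_edges; lia.
have x0 : 'I_n by exists 0; lia.
set u := nth x0 p j; set v := nth x0 p j.+1.
apply: (@runs_weaken _ _ (3 + (5 + (7 + 7))) _ _ (fun s' => Inv j.+1 (set_var s' 10 j.+1))) => //.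
apply: runs_seq; apply: runs_assign.
have -> : Defs.eval W s1 (Get 1 (Var 10)) = u by apply: eval_get; [exact: sj|rewrite ar1 (h1 x0)].
set s2 := set_var _ _ _; apply: runs_seq; apply: runs_assign.
have -> : Defs.eval W s2 (Get 1 (Bin OpAdd (Var 10) (Cst 1))) = v.
  by apply: eval_get; [exact: jE|rewrite ar1 (h1 x0)].
set s3 := set_var _ _ _; apply: runs_seq; apply: runs_put.
have -> : Defs.eval W s3 (Idx (Var 22) (Var 23)) = u * n + v by apply: (eval_idx n_gt nW).
rewrite (eval_cst W_gt) //.
set s4 := set_arr _ _ _ _; apply: runs_put.
have -> : Defs.eval W s4 (Idx (Var 23) (Var 22)) = v * n + u by apply: (eval_idx n_gt nW).
rewrite (eval_cst W_gt) //; split.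
  by apply: agree_setv => //; do 2 (apply: agree_seta => //); do 2 (apply: agree_setv => //).
move=> x y; transitivity (if x * n + y == v * n + u then 0 else
   if x * n + y == u * n + v then 0 else arr s1 2 (x * n + y)); first by [].
rewrite (take_nth finset.set0); last by rewrite size_path_edges; lia.
rewrite mem_rcons inE negb_or (nth_path_edges x0) // -/u -/v eq_set2.
case: (x * n + y =P v * n + u) => [/mat_index_inj [-> ->]|n1].
  by rewrite !eqxx orbT andbF.
case: (x * n + y =P u * n + v) => [/mat_index_inj [-> ->]|n2].
  by rewrite !eqxx andbF.
suff -> : (x == u) && (y == v) || (x == v) && (y == u) = false by rewrite hj.
by apply/negP => /orP [] /andP [/eqP ex /eqP ey]; [apply: n2|apply: n1]; rewrite ex ey.
Qed.

Lemma runs_route s (H U : rel 'I_n) (a b w : 'I_n) (pa pb : 'I_n -> 'I_n) :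
  let Da := fun v : 'I_n => arr s 7 v in let Db := fun v : 'I_n => arr s 9 v in
  var s 0 = n -> var s 20 = w -> search_tree H a Da pa -> search_tree H b Db pb ->
  (forall v : 'I_n, 1 < Da v -> arr s 8 v = pa v) ->
  (forall v : 'I_n, 1 < Db v -> arr s 10 v = pb v) ->
  (forall v, Da v <= n.+2) -> (forall v, Db v <= n.+2) -> 0 < Da w -> 0 < Db w ->
  ismat s 2 U ->
  runs W route_cmd (500 * n) s (fun s' =>
    [/\ agree [:: 6; 22; 23] [:: 1; 2] s s', output s' = map val (route w Da Db pa pb) &
        ismat s' 2 (fun x y => U x y || ((x, y) \in route_arcs w Da Db pa pb))]).
Proof.
move=> Da Db s0 sw Ta Tb hPa hPb hDa hDb wa wb hU.
have [lea leb] : Da w <= n.+2 /\ Db w <= n.+2 by [].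
apply: (@runs_weaken _ _ (8 + (200 * n + 200 * n)) _ _ (fun s' =>
    [/\ agree [:: 6; 22; 23] [:: 1; 2] s s', output s' = map val (route w Da Db pa pb) &
        ismat s' 2 (fun x y => U x y || ((x, y) \in route_arcs w Da Db pa pb))])) => //; last by
            lia.
apply: runs_seq; apply: runs_assign.
have -> : Defs.eval W s (Bin OpSub (Bin OpAdd (Get 7 (Var 20)) (Get 9 (Var 20))) (Cst 1)) = (Da
    w + Db w).-1.
  rewrite -subn1; apply: eval_sub; [apply: eval_add|exact: eval_cst|by lia].
  - by apply: eval_get; first exact: sw.
  - by apply: eval_get; first exact: sw.
  - by lia.
set m := (Da w + Db w).-1; set s1 := set_var _ _ _.
apply: runs_seq.
have c1 := runs_climb n_gt nW (D := 7) (P := 8) (s := s1) (pos := Bin OpSub (Get 7 (Var 22))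
    (Cst 1)) (pf := predn) (H := H) (U := U) (a := a) (w := w) (par := pa).
apply: runs_weaken (c1 _ _ _ _ _ _ _ _ _ _ _) (leqnn _) _ => //.
- by rewrite wa hDa.
- move=> s' v ag sv /andP [_ vw]; rewrite -subn1; apply: eval_sub; [|exact: eval_cst|].
    by apply: eval_get; [exact: sv|case: ag => _ ->].
  by apply: leq_ltn_trans vw _; apply: leq_ltn_trans lea _; lia.
- by move=> i j; lia.
rewrite -[arr s1]/(arr s) -/(Da w).
move=> s2 [ag2 hU2 hp2 _].
have [E7 E9 E10 v6] : [/\ arr s2 7 = arr s 7, arr s2 9 = arr s 9, arr s2 10 = arr s 10 & var s2
    6 = m].
  by case: ag2 => hv ha; rewrite hv // !ha.
have c2 := runs_climb n_gt nW (D := 9) (P := 10) (s := s2) (pos := Bin OpSub (Var 6) (Get 9 (Var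
    22))) (pf := fun z => m - z) (H := H) (a := b) (w := w) (par := pb).
have Dbw : arr s2 9 w = Db w by rewrite E9.
apply: runs_weaken (c2 _ _ _ _ _ _ _ _ _ hU2 _ _) (leqnn _) _ => //.
- by case: ag2 => ->.
- by case: ag2 => ->.
- by rewrite E9.
- by move=> v; rewrite E9 E10; apply: hPb.
- by rewrite E9; apply/andP; split; [exact: wb|exact: hDb].
- move=> s' v ag sv /andP [_ vw]; apply: eval_sub.
  + by case: ag => hv _; rewrite /= hv.
  + by apply: eval_get; [exact: sv|case: ag => _ ->].
  + by rewrite /m; lia.
- by rewrite Dbw => i j; rewrite /m; lia.
rewrite Dbw.
move=> s3 [ag3 hU3 hp3 hq3].
have m6 : var s3 6 = m by case: ag3 => ->.
split.
- have ag12 : agree [:: 6; 22; 23] [:: 1; 2] s s1 by apply: agree_set_var.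
  exact: agree_ext (agree_ext ag12 ag2 isT isT) ag3 isT isT.
- rewrite /output m6 /route /mkseq -map_comp; apply/eq_in_map => i.
  rewrite mem_iota add0n => /andP [_ im] /=; rewrite /route_at.
  (* The meeting vertex is written by both climbs and is treated here with the second one. *)
  case: (ltnP i (Da w).-1) => ia.
    rewrite ifT; last by lia.
    rewrite hq3 => [|t tb]; last by rewrite /m; lia.
    by rewrite -hp2; [congr (arr s2 1 _)|]; lia.
  have -> : nat_of_ord (if i < Da w then iter ((Da w).-1 - i) pa w else iter (i.+1 - Da w) pb w)
            = iter (i.+1 - Da w) pb w.
    case: ltnP => // ia2.
    by have [-> ->] : (Da w).-1 - i = 0 /\ i.+1 - Da w = 0 by lia.
  by rewrite -hp3; [congr (arr s3 1 _)|]; move: im; rewrite /m; lia.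
- by move=> x y; rewrite hU3 inE orbA.
Qed.

End Router.

(** * The invariant of the game *)

Section Game.
Variables (R : realType) (n d : nat) (lam : R) (e : rel 'I_n).
Hypotheses (Ge : ndl_graph d lam e) (dn : (200 < d < n)%N).
Variable k : nat.

Let W := (n ^ 3)%N.
Let n_gt : (200 < n)%N. Proof. by case/andP: dn; apply: ltn_trans. Qed.
Let d_lt : (d < n)%N. Proof. by case/andP: dn. Qed.
Let nW : (4 * (n * n) < W)%N. Proof. by have h := n_gt; rewrite /W !expnS expn0; nia. Qed.
Let n_gt0 : (0 < n)%N. Proof. exact: leq_trans n_gt. Qed.

Definition tables (s : store) (U : rel 'I_n) (B Q : {set 'I_n}) (rho : rel 'I_n) : Prop :=
  [/\ var s 0 = n /\ var s 1 = d, ismat s 0 e, ismat s 2 U, ismat s 3 rho &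
      isvec s 4 B /\ isvec s 5 Q].

(** The store holds only the union of the used arcs; how they split into oriented paths is
    existential. A request is legal below d/200 and adds one path, hence the [+ 1]. *)
Definition game_inv (P : seq (seq 'I_n)) (s : store) : Prop :=
  exists F B Q rho,
  [/\ tables s (used F) B Q rho, routed F /\ [seq q.1 | q <- F] = P,
      valid_plan d e (used F) B Q rho,
      forall v, (count (is_endpoint v) P)%:R <= d%:R / 200 + 1 :> R &
      forall p, p \in P -> (0 < size p <= n)%N /\ (path_length p <= 2 * k)%N].

Lemma tables_agree vs als s s' U B Q rho :
  agree vs als s s' -> all [predC vs] [:: 0; 1]%N -> all [predC als] [:: 0; 2; 3; 4; 5]%N ->
  tables s U B Q rho -> tables s' U B Q rho.
Proof.
move=> ag /= /and3P [v0 v1 _] /and5P [a0 a2 a3 a4 /andP [a5 _]] [[s0 s1] he hU hr [hB hQ]].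
split.
- by case: ag => hv _; rewrite !hv.
- exact: agree_mat ag he a0.
- exact: agree_mat ag hU a2.
- exact: agree_mat ag hr a3.
- by split; [exact: agree_vec ag hB a4|exact: agree_vec ag hQ a5].
Qed.

Lemma game_inv_remove P p s :
  game_inv P s -> p \in P ->
  runs W router (200 * n) (load_request (RemovePath p) s) (game_inv (rem p P)).
Proof.
move=> [F [B [Q [rho [[[s0 s1] he hU hr [hB hQ]] [rF mF] vp ends len]]]]] pP.
have [psz _] := len p pP.
set s2 := load_request _ _.
apply: (@runs_weaken _ _ (1 + 100 * n).+1 _ _ (game_inv (rem p P))) => //; last by have h :=
    n_gt; lia.
apply: runs_if => /=.
have [F' [rF' mF' uF']] : exists F', [/\ routed F', [seq q.1 | q <- F'] = rem p [seq q.1 | q <- F] &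
    forall x y, used F' x y = used F x y && ([set x; y] \notin path_edges p)].
  by apply: routed_rem rF _; rewrite mF.
apply: runs_weaken (runs_remove n_gt nW (s := s2) (p := p) (U := used F) _ _ psz _ _) (leqnn _)
    _ => //.
  move=> x0 i ip; rewrite /= /upd eqxx.
  by rewrite (nth_map x0) // .
move=> s3 [ag hU3]; exists F', B, Q, rho; split.
- split.
  + by case: ag => hv _; rewrite !hv.
  + exact: agree_mat ag (_ : ismat s2 0 e) isT.
  + by move=> u v; rewrite hU3 uF'.
  + exact: agree_mat ag (_ : ismat s2 3 rho) isT.
  + by split; [exact: agree_vec ag (_ : isvec s2 4 B) isT|exact: agree_vec ag (_ : isvec s2 5 Q)
      isT].
- by rewrite mF' mF.
- by apply: valid_plan_sub vp => x y; rewrite uF' => /andP [].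
- move=> v; apply: le_trans (ends v); rewrite ler_nat.
  by rewrite (permP (perm_to_rem pP)) /= leq_addl.
- by move=> q /mem_rem; apply: len.
Qed.

Hypothesis lam_lt : lam * (1000 * 1000) < d%:R.
Hypotheses (hk : n%:R <= (d%:R / lam) ^+ k) (kn : (k <= n)%N).

(** The bound on the total length includes the path still to be found, since the new plan is
    computed with its arcs already used. *)
Lemma game_inv_find P s a b :
  game_inv P s ->
  (count (is_endpoint a) P)%:R < d%:R / 200 :> R ->
  (count (is_endpoint b) P)%:R < d%:R / 200 :> R ->
  ((size P).+1 * (2 * k))%:R <= n%:R * d%:R / (200 * 200) :> R ->
  runs W router (100 * 100 * (n * n * n)) (load_request (FindPath a b) s) (fun s' =>
    exists p, [/\ output s' = map val p, is_path e a b p, all (edge_disjoint p) P,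
      (path_length p <= 2 * k)%N & game_inv (p :: P) s']).
Proof.
move=> [F [B [Q [rho [tb [rF mF] vp ends len]]]]] ca cb total.
set s1 := load_request _ _.
have {}tb : tables s1 (used F) B Q rho by [].
have sa : var s1 4 = a by [].
have sb : var s1 5 = b by [].
have sym_e := ndl_sym Ge.
pose H := open_arc e (used F) B Q rho.
have deg := open_degree Ge dn lam_lt rF vp.
rewrite mF in deg; have {}deg := deg ends; rewrite -/H in deg.
have He x y : H x y -> e x y by case/and4P.
pose N := (n * n)%N.
set Post := (fun s' => exists p, _).
apply: (@runs_weaken _ _ (1 + (4 + (200 * N + (1000 * (N * n) + (1000 * (N * n) +
  (100 * n + (500 * n + (1000 * (N * n) + (2000 * (N * n) + (30 * n + 30 * n))))))))))%N.+1 _ _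
      Post) => //; last first.
  have h2 : (n <= N)%N := leq_pmulr n n_gt0; have h3 : (N <= N * n)%N := leq_pmulr N n_gt0.
  have h1 := n_gt0; rewrite -/N; move: (N * n)%N h3 => M h3.
  move: N h2 h3 => m h2 h3; clear -h1 h2 h3; lia.
apply: runs_if; rewrite [Defs.eval W s1 _]/=.
apply: runs_seq; apply: runs_assign.
case: (tb) => -[s10 s1d] _ _ _ _.
rewrite (@eval_mul W s1 _ _ n n) //; last by have h := nW; lia.
set s2 := set_var _ _ _.
have tb2 : tables s2 (used F) B Q rho by [].
case: (tb2) => -[s20 s2d] he2 hU2 hr2 [hB2 hQ2].
apply: runs_seq; apply: runs_weaken (runs_open n_gt nW s20 (erefl : var s2 9 = n * n)%N he2 hU2
    hr2 hB2 hQ2) (leqnn _) _.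
move=> s3 [ag3 hH3].
have tb3 := tables_agree ag3 isT isT tb2.
have s30 : var s3 0 = n by case: tb3 => -[].
have s39 : var s3 9 = (n * n)%N by case: ag3 => ->.
have s34 : var s3 4 = a by case: ag3 => ->.
have s35 : var s3 5 = b by case: ag3 => ->.
apply: runs_seq; apply: runs_weaken (runs_bfs (D := 7) (P := 8) (src := 4) n_gt nW isT isT isT
    isT s30 s39 s34 hH3) (leqnn _) _.
move=> s4 [ag4 ha4 [pa sea hpa]].
have tb4 := tables_agree ag4 isT isT tb3.
have s40 : var s4 0 = n by case: tb4 => -[].
have s49 : var s4 9 = (n * n)%N by case: ag4 => ->.
have s45 : var s4 5 = b by case: ag4 => ->.
have hH4 := agree_mat ag4 hH3 isT.
apply: runs_seq; apply: runs_weaken (runs_bfs (D := 9) (P := 10) (src := 5) n_gt nW isT isT isT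
    isT s40 s49 s45 hH4) (leqnn _) _.
move=> s5 [ag5 hb5 [pb seb hpb]].
have tb5 := tables_agree ag5 isT isT tb4.
have [E7 E8] : arr s5 7 = arr s4 7 /\ arr s5 8 = arr s4 8 by case: ag5 => _ h; rewrite !h.
rewrite -E7 in ha4 sea hpa; rewrite -E8 in hpa.
have s50 : var s5 0 = n by case: tb5 => -[].
have [w0 [/andP [wa0 wak] /andP [wb0 wbk]]] := search_meet Ge dn lam_lt hk kn He deg sea seb.
apply: runs_seq; apply: runs_weaken (runs_meet n_gt nW s50 ha4 hb5 _) (leqnn _) _.
  by exists w0.
move=> s6 [ag6 [w [s6w wa wb wmin]]].
have tb6 := tables_agree ag6 isT isT tb5.
have arE : arr s6 = arr s5 by apply/funext => x; case: ag6 => _ ->.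
rewrite -arE in ha4 hb5 sea seb hpa hpb wa wb wmin wa0 wb0 wak wbk.
have s60 : var s6 0 = n by case: tb6 => -[].
have hU6 : ismat s6 2 (used F) by case: tb6.
case: (sea) => Ta _; case: (seb) => Tb _.
apply: runs_seq; apply: runs_weaken (runs_route n_gt nW s60 s6w Ta Tb hpa hpb ha4 hb5 wa wb hU6)
    (leqnn _) _.
set Da := fun v : 'I_n => arr s6 7 v; set Db := fun v : 'I_n => arr s6 9 v.
move=> s7 [ag7 out7 hU7].
pose p := route w Da Db pa pb; pose A := route_arcs w Da Db pa pb.
have [ip dis rF'] := extend_family Ge rF sea seb wa wb wmin.
rewrite -/Da -/Db -/p -/A in ip dis rF' out7 hU7.
rewrite mF in dis.
(* The vertex [w0] has distance at most [k] from both ends, and [w] is no worse. *)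
have lp : (path_length p <= 2 * k)%N.
  rewrite /p (length_route _ Ta wa wb).
  have aux (x y x0 y0 j : nat) : (x + y <= x0 + y0)%N -> (x0 <= j.+1)%N -> (y0 <= j.+1)%N ->
    ((x + y).-2 <= 2 * j)%N by clear; lia.
  exact: aux (wmin w0 wa0 wb0) wak wbk.
pose U' : rel 'I_n := used ((p, A) :: F).
have hU7' : ismat s7 2 U' by move=> x y; rewrite hU7 /U' /used /= orbC.
case: (tb6) => -[_ s6d] he6 _ hr6 [hB6 hQ6].
have s70 : var s7 0 = n by case: ag7 => ->.
have s7d : var s7 1 = d by case: ag7 => ->.
have he7 := agree_mat ag7 he6 isT; have hr7 := agree_mat ag7 hr6 isT.
have hB7 := agree_vec ag7 hB6 isT; have hQ7 := agree_vec ag7 hQ6 isT.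
have s79 : var s7 9 = (n * n)%N.
  by case: ag7 => -> //; case: ag6 => -> //; case: ag5 => ->.
apply: runs_seq; apply: runs_weaken (runs_critical n_gt nW d_lt s70 s7d he7 hU7') (leqnn _) _.
move=> s8 [ag8 hB8' hQ8'].
have s80 : var s8 0 = n by case: ag8 => ->.
have s8d : var s8 1 = d by case: ag8 => ->.
have s89 : var s8 9 = (n * n)%N by case: ag8 => ->.
have he8 := agree_mat ag8 he7 isT; have hr8 := agree_mat ag8 hr7 isT.
have hU8 := agree_mat ag8 hU7' isT.
have hB8 := agree_vec ag8 hB7 isT; have hQ8 := agree_vec ag8 hQ7 isT.
have v3 x : x \notin B -> (#|nbhd e x :&: Q| <= slk d)%N by case: vp => _ _ h _; apply: h.
have hUt : (\sum_y #|[set x | U' x y]|)%:R <= n%:R * d%:R / (200 * 200) :> R.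
  apply: le_trans total; rewrite ler_nat.
  apply: leq_trans (used_total (k := 2 * k) rF' _) _; last by rewrite /= -mF size_map.
  by move=> q; rewrite /= inE mF => /orP [/eqP -> //|/len []].
have shrink X j := @peel_shrink _ _ _ _ _ Ge dn lam_lt U' B Q X j hUt v3.
apply: runs_seq; apply: runs_weaken (runs_peel n_gt nW d_lt sym_e s80 s8d s89 he8 hr8 hB8 hQ8
    hB8' shrink) (leqnn _) _.
move=> s9 [ag9 [rho' hr9 pinv]].
have s90 : var s9 0 = n by case: ag9 => ->.
have hB9' := agree_vec ag9 hB8' isT; have hQ9' := agree_vec ag9 hQ8' isT.
apply: runs_seq; apply: runs_weaken (runs_Vec n_gt nW (f := fun v => v \in critical d e U') s90
    _) _ _.
- by move=> v s' ag _ sv _; apply: eval_vec; [exact: agree_vec ag hB9' isT|exact: sv].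
- by rewrite leq_mul2r orbC.
move=> s10' [ag10 h10].
have s100 : var s10' 0 = n by case: ag10 => ->.
have hQ10' := agree_vec ag10 hQ9' isT.
apply: runs_weaken (runs_Vec n_gt nW (f := fun v => v \in saturated d e U' (critical d e U'))
    s100 _) _ _.
- by move=> v s' ag _ sv _; apply: eval_vec; [exact: agree_vec ag hQ10' isT|exact: sv].
- by rewrite leq_mul2r orbC.
move=> s11 [ag11 h11]; exists p.
have out11 : output s11 = output s7.
  rewrite /output.
  have [-> ->] : var s11 6 = var s7 6 /\ arr s11 1 = arr s7 1.
    by case: ag11 => h1 h2; case: ag10 => h3 h4; case: ag9 => h5 h6; case: ag8 => h7 h8;
      rewrite h1 // h3 // h5 // h7 // h2 // h4 // h6 // h8.
  by [].
split=> //; first by rewrite out11.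
exists ((p, A) :: F), (critical d e U'), (saturated d e U' (critical d e U')), rho'; split.
- split.
  + by case: ag11 => h1 _; case: ag10 => h3 _; case: ag9 => h5 _; rewrite !h1 // !h3 // !h5.
  + exact: agree_mat ag11 (agree_mat ag10 (agree_mat ag9 he8 isT) isT) isT.
  + exact: agree_mat ag11 (agree_mat ag10 (agree_mat ag9 hU8 isT) isT) isT.
  + exact: agree_mat ag11 (agree_mat ag10 hr9 isT) isT.
  + split; last exact: h11.
    exact: agree_vec ag11 (h10 : isvec s10' 4 _) isT.
- by split=> //=; rewrite mF.
- have E : U' = (fun x y => used F x y || ((x, y) \in A)).
    by apply/funext => x; apply/funext => y; rewrite /U' /used /= orbC.
  rewrite -/U' E; apply: (valid_plan_update (A := fun x y => (x, y) \in A) (ndl_card Ge) vp).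
  + by move=> x y; apply: (route_arc Ta Tb wa wb).
  + by move=> y; apply: route_in.
  + by rewrite -E.
- move=> v; rewrite /= natrD.
  have -> : is_endpoint v p = (v == a) || (v == b) := is_endpoint_route Ta Tb wa wb v.
  case: eqP => [->|_]; first by move: ca; rewrite /=; lra.
  case: eqP => [->|_]; first by move: cb; rewrite /=; lra.
  by rewrite add0r; apply: ends.
- move=> q; rewrite inE => /orP [/eqP ->|/len //]; split=> //.
  rewrite size_route (route_neq0 wa wb) /=.
  rewrite -(size_route w Da Db pa pb) -[X in (_ <= X)%N](card_ord n).
  have up : uniq p by move: ip; rewrite /is_path; case: (p) => // x p' /and4P [].
  by rewrite -(card_uniqP up); apply: max_card.
Qed.

End Game.

(** * The strategy *)

Section Strategy.
Variables (R : realType) (n d : nat) (lam : R) (e : rel 'I_n).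
Hypotheses (Ge : ndl_graph d lam e) (dn : (200 < d < n)%N).
Hypothesis lam_lt : lam * (1000 * 1000) < d%:R.
Variables (k : nat) (r : R).
Hypotheses (hk : n%:R <= (d%:R / lam) ^+ k) (kn : (k <= n)%N).
Hypothesis room : forall m : nat, m%:R < r ->
  (m.+1 * (2 * k))%:R <= n%:R * d%:R / (200 * 200) :> R.

Let T := (100 * 100 * (n * n * n))%N.

Definition step_ok (P : seq (seq 'I_n)) (s : store) (q : request n) (s' : store) : Prop :=
  exists2 t, (t <= T)%N & exec (n ^ 3) router (load_request q s) t s' /\
  match q with
  | FindPath a b => exists p : seq 'I_n, [/\ output s' = map val p, is_path e a b p,
      all (edge_disjoint p) P, (path_length p <= 2 * k)%N & game_inv R d e k (p :: P) s']
  | RemovePath p => game_inv R d e k (rem p P) s'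
  end.

Lemma step_exists P s q : game_inv R d e k P s -> legal d r P q -> exists s', step_ok P s q s'.
Proof.
case: q => [a b|p] inv /=.
  move=> [ca cb Pr].
  have [t [s' [ex le post]]] := game_inv_find Ge dn lam_lt hk kn inv ca cb (room Pr).
  by exists s', t.
move=> pP; have [t [s' [ex le post]]] := game_inv_remove dn inv pP.
exists s', t => //; apply: leq_trans le _; rewrite /T.
have n0 : (0 < n)%N by case/andP: dn => _; apply: leq_ltn_trans.
by apply: leq_mul => //; rewrite -mulnA leq_pmulr // muln_gt0 n0.
Qed.

(** The store after a turn is chosen among those that [step_exists] provides. The strategy decodes
    the very stores that later witness [implements], so both agree by construction; the default
    concerns only positions without such a step. *)
Definition next (P : seq (seq 'I_n)) (s : store) (q : request n) : store :=
  if pselect (exists s', step_ok P s q s') is left h then projT1 (cid h) else s.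

Lemma nextP P s q : game_inv R d e k P s -> legal d r P q -> step_ok P s q (next P s q).
Proof.
move=> inv lq; rewrite /next; case: pselect => [h|[]]; last exact: step_exists.
by case: (cid h).
Qed.

Definition decode (s : store) : seq 'I_n := pmap insub (output s).

Lemma decodeP s (p : seq 'I_n) : output s = map val p -> decode s = p.
Proof. by rewrite /decode => ->; elim: p => [//|x p IH] /=; rewrite valK /= IH. Qed.

Fixpoint position (h : seq (request n)) : seq (seq 'I_n) * store :=
  match h with
  | [::] => ([::], init_store d lam e)
  | q :: h' => let: (P, s) := position h' in let s' := next P s q in
      (match q with FindPath _ _ => decode s' :: P | RemovePath p => rem p P end, s')
  end.

Definition router_strategy : strategy n := fun h => decode (position h).2.

Lemma position_family h : (position h).1 = family_after router_strategy h.
Proof.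
elim: h => [//|q h IH]; rewrite /= /router_strategy /= -IH.
by case: (position h) => P s; case: q.
Qed.

Lemma game_inv_init : game_inv R d e k [::] (init_store d lam e).
Proof.
exists [::], finset.set0, finset.set0, (fun _ _ => false).
have c0 (P : pred 'I_n) : P =1 pred0 -> #|[set x | P x]| = 0%N.
  by move=> P0; apply/eqP; rewrite cards_eq0; apply/eqP/finset.setP => x; rewrite !inE P0.
split=> //.
- split=> //; last by split=> v; rewrite inE.
  move=> u v; rewrite /= ; congr (nat_of_bool _).
  apply/existsP/idP => [[u' /existsP [v' /andP [/eqP E]]]|euv].
    by case: (mat_index_inj E) => -> ->.
  by exists u; apply/existsP; exists v; rewrite eqxx.
- split=> //.
  + by move=> y; rewrite c0 // => x; rewrite inE.
  + by move=> x; rewrite inE.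
  + by move=> x _; rewrite finset.setI0 cards0.
  + move=> y _; rewrite /load c0; last by move=> x; rewrite inE andbF.
    by rewrite divn_gt0 //; case/andP: dn => h _; apply: leq_trans h.
- by move=> v; rewrite /= addr_ge0 ?divr_ge0 ?ler0n.
Qed.

Lemma historyS (q : nat -> request n) i : history q i.+1 = q i :: history q i.
Proof. by rewrite /history /mkseq -addn1 iotaD map_cat rev_cat. Qed.

Lemma position_inv (q : nat -> request n) i :
  legal_before d r router_strategy q i ->
  game_inv R d e k (position (history q i)).1 (position (history q i)).2.
Proof.
elim: i => [_|i IH legal]; first exact: game_inv_init.
have inv := IH (fun j ji => legal j (ltnW ji : (j < i.+1)%N)).
have := legal i (ltnSn i); rewrite -position_family historyS /=.
case: (position _) inv => P s /= inv lq; have := nextP inv lq.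
case: (q i) lq => [a b|p] lq [t _ [_ h]] //=.
by case: h => p [op _ _ _ h]; rewrite (decodeP op).
Qed.

Lemma position_step (q : nat -> request n) i :
  legal_before d r router_strategy q i.+1 ->
  step_ok (position (history q i)).1 (position (history q i)).2 (q i)
          (position (history q i.+1)).2.
Proof.
move=> legal; have inv : game_inv R d e k (position (history q i)).1 (position (history q i)).2.
  by apply: position_inv => j ji; apply: legal; apply: ltnW.
have := legal i (ltnSn i); rewrite -position_family historyS /=.
by case: (position _) inv => P s /= inv lq; apply: nextP.
Qed.

Lemma router_wins : wins d e r router_strategy.
Proof.
move=> q i legal; have := position_step legal; rewrite -position_family.
case: (q i) => [a b|p] // [t _ [_ [p [op ip dis _ _]]]] /=.
by rewrite /router_strategy (decodeP op).
Qed.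

Lemma router_bounded ell : (2 * k)%:R <= ell -> paths_bounded d r ell router_strategy.
Proof.
move=> kl q i legal p; rewrite -position_family => pP.
apply: le_trans kl; rewrite ler_nat.
by have [F [B [Q [rho [_ _ _ _ len]]]]] := position_inv legal; case: (len p pP).
Qed.

Lemma router_implements C : (100 * 100 <= C)%N ->
  implements d lam e r (n ^ 3) (C * n ^ 3 * d ^ 3) router router_strategy.
Proof.
move=> hC q; exists (fun i => (position (history q i)).2); split=> // i legal.
have := position_step legal => -[t tT [ex post]]; split.
  exists t => //; apply: leq_trans tT _; rewrite /T -[X in (X <= _)%N]muln1.
  apply: leq_mul; last by rewrite expn_gt0; case/andP: dn => h _; rewrite (leq_ltn_trans _ h).
  by apply: leq_mul => //; rewrite !expnS expn0 muln1 mulnA.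
by case: (q i) post => [a b|//] [p [op _ _ _ _]]; rewrite /router_strategy (decodeP op).
Qed.

End Strategy.

(** * Numerical estimates for the path length and the number of paths *)

Lemma ln_ge2 (R : realType) (x : R) : 16 <= x -> 2 <= ln x.
Proof.
move=> x16; rewrite -[2]expRK ler_ln ?posrE ?expR_gt0 //; last by lra.
apply: le_trans x16.
(* The bound e^2 <= 16 is the inverse fourth power of e^(-1/2) >= 1 - 1/2. *)
have -> : expR 2 = expR (- (1 / 2)) ^- 4 :> R.
  by rewrite -expRM_natl -expRN; congr expR; field.
have h : 1 / 2 <= expR (- (1 / 2)) :> R.
  by apply: le_trans (expR_ge1Dx _); lra.
have h4 : (1 / 2) ^+ 4 <= expR (- (1 / 2)) ^+ 4 :> R.
  by rewrite lerXn2r ?nnegrE ?expR_ge0 //; lra.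
rewrite -[leRHS]invrK lef_pV2 ?posrE ?exprn_gt0 ?expR_gt0 //; last by lra.
Qed.

(** [k] is the next integer above [rho], at most [2 * rho] because [rho >= 1]. Since ln (d/lam) is
    at least 2, [2 * rho] is at most ln n, hence [k <= n]. The last clause has slack: with 4 rho for
    2 k, the m old paths cost at most 4 n d/10^6 and the new one at most 2 n d/10^6, against the 25
    n d/10^6 allowed. *)
Lemma route_length_exists (R : realType) (n d : nat) (lam : R) (e : rel 'I_n) :
  ndl_graph d lam e -> (200 < d < n)%N -> lam * (1000 * 1000) < d%:R ->
  let rho := ln n%:R / ln (d%:R / lam) in
  exists k : nat,
  [/\ n%:R <= (d%:R / lam) ^+ k, (k <= n)%N, (2 * k)%:R <= 4 * rho &
    forall m : nat,
      m%:R < (1000 * 1000)^-1 * n%:R * d%:R * (ln (d%:R / lam) / ln n%:R) ->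
      (m.+1 * (2 * k))%:R <= n%:R * d%:R / (200 * 200) :> R].
Proof.
move=> Ge dn lt rho.
have dl : 1000 * 1000 < d%:R :> R := d_large Ge dn lt.
have [d200 dn'] := andP dn.
have l0 := lam_ge0 Ge.
have l1 : 1 <= lam.
  apply: (lam_ge1 Ge dn'); last exact: leq_trans d200.
  by move: lt; set D : R := d%:R; lra.
have nd : d%:R <= n%:R :> R by rewrite ler_nat ltnW.
set q := d%:R / lam in rho *.
have q16 : 16 <= q by rewrite ler_pdivlMr; lra.
have qn : q <= n%:R.
  apply: le_trans nd; rewrite ler_pdivrMr; last by lra.
  by rewrite ler_peMr //; lra.
have Lq := ln_ge2 q16; set lq := ln q in rho Lq *.
have Ln : lq <= ln n%:R by rewrite ler_ln ?posrE //; lra.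
set l := ln n%:R in rho Ln *.
have ln1 : l <= n%:R.
  have -> : l = ln (1 + (n%:R - 1)) by congr ln; ring.
  by apply: le_trans (le_ln1Dx _) _; lra.
have rho1 : 1 <= rho by rewrite ler_pdivlMr; lra.
have rhol : 2 * rho <= l by rewrite mulrA ler_pdivrMr; nra.
have [k [k1 k2]] : exists k : nat, rho <= k%:R /\ k%:R <= 2 * rho.
  have /andP [t1 t2] := truncn_itv (le_trans ler01 rho1).
  exists (Num.Def.trunc rho).+1; split; first exact: ltW.
  by rewrite -natr1; lra.
have q0 : 0 < q by apply: lt_le_trans q16.
have n0 : 0 < n%:R :> R by apply: lt_le_trans qn.
have lq0 : 0 < lq by apply: lt_le_trans Lq.
exists k; split.
- rewrite -ler_ln ?posrE ?exprn_gt0 // lnXn // -/lq -/l -[lq *+ k]mulr_natr.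
  have -> : l = lq * rho by rewrite mulrC divfK // gt_eqF.
  by rewrite ler_pM2l.
- by rewrite -(ler_nat R); apply: le_trans k2 (le_trans rhol ln1).
- by rewrite natrM; lra.
move=> m hm; rewrite natrM [(2 * k)%:R]natrM -natr1.
have N0 : 0 < n%:R * d%:R :> R by rewrite mulr_gt0 // ltr0n (leq_trans _ d200).
have m0 : 0 <= m%:R :> R by [].
have mr : m%:R * rho * (1000 * 1000) <= n%:R * d%:R.
  have cancelE (K x y u v : R) : K != 0 -> u != 0 -> v != 0 ->
      K^-1 * x * y * (u / v) * (v / u * K) = x * y.
    by move=> K0 u0 v0; field; rewrite K0 u0 v0.
  have K0 : 0 < 1000 * 1000 :> R by apply: mulr_gt0; rewrite ltr0n.
  have l0' : 0 < l by apply: lt_le_trans Ln.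
  rewrite -[leRHS](cancelE _ _ _ _ _ (lt0r_neq0 K0) (lt0r_neq0 lq0) (lt0r_neq0 l0')) -mulrA.
  apply: ler_wpM2r; last exact: ltW.
  by rewrite mulr_ge0 ?(ltW K0) // (le_trans ler01).
have n1 : n%:R * (1000 * 1000) <= n%:R * d%:R :> R by rewrite ler_wpM2l ?(ltW n0) ?(ltW dl).
apply: (@le_trans _ _ ((m%:R + 1) * (4 * rho))).
  by rewrite ler_wpM2l ?addr_ge0 //; clear -k2; lra.
rewrite mulrDl mul1r mulrCA.
clear -mr n1 rhol ln1 N0; lra.
Qed.

Theorem theorem1p4 (R : realType) :
  exists (alpha eps L : R) (k C : nat) (prog : cmd),
    [/\ 0 < alpha, 0 < eps &
      forall (n d : nat) (lam : R) (e : rel 'I_n),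
        ndl_graph d lam e -> (200 < d < n)%N -> lam < eps * d%:R ->
        let r := alpha * n%:R * d%:R * (ln (d%:R / lam) / ln n%:R) in
        exists sigma : strategy n,
          [/\ wins d e r sigma,
              implements d lam e r (n ^ k) (C * n ^ 3 * d ^ 3) prog sigma &
              paths_bounded d r (L * (ln n%:R / ln (d%:R / lam))) sigma]].
Proof.
have K0 : 0 < (1000 * 1000 : R) by apply: mulr_gt0; rewrite ltr0n.
(* The 4 is that of [2 * k <= 4 * rho]. Words modulo [n ^ 3] suffice, as every value the program
   forms stays below [4 * n ^ 2], up to the small constants that [n > 200] covers. *)
exists (1000 * 1000)^-1, (1000 * 1000)^-1, 4, 3%N, (100 * 100)%N, router.
split; rewrite ?invr_gt0 // => n d lam e Ge dn lam_lt r.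
have lt : lam * (1000 * 1000) < d%:R by rewrite -ltr_pdivlMr // mulrC.
have [k [hk kn kL room]] := route_length_exists Ge dn lt.
exists (router_strategy d lam e k); split.
- exact: (router_wins Ge dn lt hk kn room).
- exact: (router_implements Ge dn lt hk kn room).
- exact: (router_bounded Ge dn lt hk kn room).
Qed.
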